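(* Let $d \geq 3$ be a finite integer, and let $G$ be a Borel graph on a standard Borel space $X$ in which every vertex has degree at most $d$. Suppose that $G$ contains no complete graph on $d+1$ vertices. Then: (1) For every Borel probability measure $\mu$ on $X$, $G$ admits a $\mu$-measurable $d$-coloring. (2) For every Polish topology $\tau$ on $X$ compatible with the Borel structure of $X$, $G$ admits a Baire measurable (with respect to $\tau$) $d$-coloring.
   Context: A graph on a set $X$ is a symmetric irreflexive relation $G \subseteq X \times X$. The degree of a vertex is its number of neighbors. A Borel graph on a standard Borel space $X$ is a graph on $X$ which is Borel as a subset of $X \times X$. A $d$-coloring of $G$ is a proper vertex coloring with $d$ colors, i.e. a function $c \colon X \to \{1,\dots,d\}$ with $c(x) \neq c(y)$ whenever $x \mathrel{G} y$. A function from $X$ to a standard Borel space is $\mu$-measurable if it is measurable with respect to the completion of $\mu$. A Polish topology $\tau$ on $X$ is compatible if the $\sigma$-algebra generated by the $\tau$-open sets is the given Borel $\sigma$-algebra of $X$. A function on $X$ is Baire measurable with respect to $\tau$ if it is measurable with respect to the $\sigma$-algebra of sets with the Baire property (the smallest $\sigma$-algebra containing the Borel sets and all $\tau$-meager sets). *)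

(* Defs.v *)
From mathcomp Require Import all_boot all_order all_algebra.
From mathcomp Require Import all_classical all_reals all_analysis.
From mathcomp Require Import measurable_realfun.

Set Implicit Arguments.
Unset Strict Implicit.
Unset Printing Implicit Defensive.

Local Open Scope classical_set_scope.

Section Topology.
Context {T : topologicalType}.

Definition separable := exists2 D : set T, countable D & dense D.

(* The topology of T is induced by some complete metric.  Completeness is the
   convergence of Cauchy filters, as in the library's completeType, which is not
   used directly because it packs the metric with the topology. *)
Definition completely_metrizable (R : realType) :=
  exists2 m : Metric R T,
    @open (Metric.Pack m) = @open T &
    forall F : set_system (Metric.Pack m),
      ProperFilter F -> cauchy F -> exists x : Metric.Pack m, F --> x.

Definition polish (R : realType) := separable /\ completely_metrizable R.

Definition borel : set (set T) := <<s @open T >>.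

Definition nowhere_dense (A : set T) := interior (closure A) = set0.

Definition meager (A : set T) :=
  exists2 F : (set T)^nat, (forall n, nowhere_dense (F n)) & A = \bigcup_n F n.

Definition baire_property : set (set T) := <<s borel `|` meager >>.

End Topology.
Arguments polish : clear implicits.
Arguments borel : clear implicits.
Arguments baire_property : clear implicits.

(* A topology on the carrier of X is a term [tau : Topological X] of the class
   of topological structures on X; [Topological.Pack tau] is the corresponding
   topological space, whose points are those of X. *)
Definition compatible_polish (R : realType) d (X : measurableType d)
    (tau : Topological X) :=
  polish (Topological.Pack tau) R /\
  borel (Topological.Pack tau) = @measurable d X.

Definition standard_borel (R : realType) d (X : measurableType d) :=
  exists tau : Topological X, compatible_polish R tau.

Section Graph.
Context {X : Type}.
Implicit Types (G : set (X * X)) (k : nat).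

Definition graph G :=
  (forall x y, G (x, y) -> G (y, x)) /\ (forall x, ~ G (x, x)).

Definition neighbors G (x : X) : set X := [set y | G (x, y)].

Definition max_degree_le G k := forall x, (neighbors G x #<= `I_k)%card.

Definition has_clique G k :=
  exists2 f : 'I_k -> X, injective f & forall i j, i != j -> G (f i, f j).

Definition coloring G k (c : X -> 'I_k) := forall x y, G (x, y) -> c x <> c y.

(* The k colors carry the discrete sigma-algebra; 'I_k is not a measurableType
   (it may be empty), so the library's measurable_fun does not apply. *)
Definition measurable_coloring (S : set (set X)) k (c : X -> 'I_k) :=
  forall B : set 'I_k, S (c @^-1` B).

End Graph.

(* The Borel subsets of X * X are the sets measurable for the product
   sigma-algebra, which is the canonical one on X * X. *)
Definition borel_graph d (X : measurableType d) (G : set (X * X)) :=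
  measurable G /\ graph G.

(* Main.v *)
(* Call a finite set K of vertices good if its induced graph is Hamiltonian, not
   complete and not an odd cycle.  A good K can be colored from any lists with as
   many colors as the degrees inside K, so every coloring of the complement of K
   extends to K.  Let W be the union of a Borel maximal family of pairwise
   non-touching good sets; it is enough to color the complement of W, and there
   the neighbors of W may be colored last.  No good set survives in the set Y of
   vertices away from W, so its blocks are cliques or odd cycles.  Call a vertex
   of Y free if it has degree less than d or a neighbor outside Y; as there is no
   clique on d+1 vertices, the other vertices of Y are cut vertices, and the
   spanning forest of Y that is minimal for a Borel ordering of the edges has no
   leaves except free ones.

   Greedy coloring works along every well-founded flow that leads each vertex of
   degree d to a neighbor colored later.  To define such a flow, mark
   a Borel sparse family of segments of the forest between nodes (free vertices
   and vertices of forest degree at least 3), let the vertices of degree 2 on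
   them flow to the marked end, delete the segments and repeat.  Boundedly many
   markings cover all live vertices, so at each step one of them takes a fixed
   proportion of what is left in measure, or in category on a given basic open
   set.  In the limit the vertices that never flow form a null (meager) set B
   with null translates.  The forest left on B has no leaves, and B can flow away
   from a root chosen in each component, regardless of measurability. *)
Require Import Defs.
From mathcomp Require Import all_boot all_order all_algebra.
From mathcomp Require Import all_classical all_reals all_analysis.
From mathcomp Require Import measurable_realfun.
From mathcomp Require Import zify.

Set Implicit Arguments.
Unset Strict Implicit.
Unset Printing Implicit Defensive.

(** * Lists of colors on Hamiltonian sets *)

(** The difficulty is to color without choosing a root: an infinite component may have no free
    vertex, and then no starting point is available in a Borel way. So everything before the limit
    is done by operations that are local and Borel. For this the neighbors are reached by countably
    many Borel maps, obtained from the theorem of Lusin and Novikov for sections of bounded size; a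
    point of the component of [x] is then the value at [x] of a word in these maps, and quantifiers
    over components become countable.

    Marked segments are kept apart for two reasons. A node loses at most one edge per stage, so no
    leaf arises; and two nodes joined by a surviving segment never both cease to be nodes, so
    segments stay finite. The number of markings is [((d+1)^3+1)(d^2+1)]: one color for end nodes up
    to three segments apart, one for the vertex through which a segment enters its end. Since a live
    vertex has at most [d] edges, it is affected by finitely many stages only, and a fixed
    proportion of loss at infinitely many stages is impossible on a set of positive measure or on a
    nonmeager set. *)

Section ListColoring.
Context {X : eqType} (e : rel X) {C : finType} (c0 : C).
Hypotheses (esym : symmetric e) (eirr : irreflexive e).
Implicit Types (s p q : seq X) (L : X -> {set C}).

Definition colorable L s := exists t : X -> C,
  (forall v, v \in s -> t v \in L v) /\
  forall u v, u \in s -> v \in s -> e u v -> t u <> t v.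

(** The list is colored from its end: when a vertex gets its color, exactly the vertices after it
    are already colored. *)
Fixpoint greedy_order L s := if s is v :: s' then
  (count (e v) s' < #|L v|) && greedy_order L s' else true.

Lemma greedy_colorable L s : uniq s -> greedy_order L s -> colorable L s.
Proof.
elim: s => [|v s IH] /=; first by exists (fun=> c0).
move=> /andP[vs us] /andP[hv /(IH us)[t [tL tp]]].
have [c cL cs] : exists2 c, c \in L v & c \notin [seq t u | u <- s & e v u].
  apply/exists_inP; apply: contraTT hv; rewrite negb_exists_in => /forall_inP h.
  rewrite -leqNgt -size_filter -(size_map t) cardE; apply: uniq_leq_size.
    exact: enum_uniq.
  by move=> c; rewrite mem_enum => /h /negPn.
pose t' u := if u == v then c else t u.
have t's u : u \in s -> t' u = t u.
  by rewrite /t'; case: eqP => // ->; rewrite (negPf vs).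
have cu u : u \in s -> e v u -> c <> t u.
  by move=> us' vu E; move/negP: cs; apply; rewrite E map_f// mem_filter vu.
exists t'; split=> [u|u w].
  by rewrite inE => /orP[/eqP ->|us']; [rewrite /t' eqxx|rewrite t's// tL].
have t'v : t' v = c by rewrite /t' eqxx.
rewrite !inE => /orP[/eqP ->|us'] /orP[/eqP ->|ws] uw.
- by rewrite eirr in uw.
- by rewrite t'v t's//; exact: cu.
- by rewrite t'v t's//; apply/nesym/cu; rewrite // esym.
- by rewrite !t's//; exact: tp.
Qed.

Lemma colorable_mem L s s' : s =i s' -> colorable L s -> colorable L s'.
Proof. by move=> E [t [h1 h2]]; exists t; split=> [v|u v]; rewrite -!E; [exact: h1|exact: h2]. Qed.

Fixpoint attached p s := if s is w :: s' then has (e w) p && attached (w :: p) s' else true.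

Lemma attached_sub p p' s : {subset p <= p'} -> attached p s -> attached p' s.
Proof.
elim: s p p' => //= w s IH p p' pp' /andP[/hasP[x xp wx] h]; apply/andP; split.
  by apply/hasP; exists x => //; exact: pp'.
by apply: IH h => y; rewrite !inE => /orP[->//|/pp' ->]; rewrite orbT.
Qed.

Lemma attached_cat p s1 s2 : attached p s1 -> attached p s2 -> attached p (s1 ++ s2).
Proof.
elim: s1 p => //= w s IH p /andP[-> h] h2 /=; apply: IH => //.
by apply: attached_sub h2 => x xp; rewrite inE xp orbT.
Qed.

Lemma path_attached v p s : v \in p -> path e v s -> attached p s.
Proof.
elim: s v p => //= w s IH v p vp /andP[vw h]; apply/andP; split.
  by apply/hasP; exists v => //; rewrite esym.
by apply: IH h; rewrite mem_head.
Qed.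

(** At least one of the neighbors counted in [p ++ s] precedes the vertex in that list, hence is
    colored after it and takes no color away. *)
Lemma attached_greedy L p s : attached p s ->
  (forall u, u \in s -> count (e u) (p ++ s) <= #|L u|) -> greedy_order L s.
Proof.
elim: s p => //= w s IH p /andP[wp h] hL; apply/andP; split.
  apply: leq_trans (hL w (mem_head _ _)); rewrite count_cat /= eirr add0n.
  by rewrite -{1}[count _ s]add0n -addSn leq_add2r -has_count.
apply: IH h _ => u us; have := hL u _; rewrite inE us orbT => /(_ isT).
by apply: leq_trans; rewrite /= !count_cat /= addnCA.
Qed.

(** The vertex with a spare color heads the list and is colored last; every other vertex still has
    its uncolored predecessor on the path. *)
Lemma slack_colorable L v s : path e v s -> uniq (v :: s) ->
  (forall u, u \in v :: s -> count (e u) (v :: s) <= #|L u|) ->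
  count (e v) (v :: s) < #|L v| -> colorable L (v :: s).
Proof.
move=> pvs us hL hv; apply: greedy_colorable => //=; apply/andP; split.
  by move: hv; rewrite /= eirr.
apply: (@attached_greedy L [:: v]); first by apply: (path_attached (v := v)); rewrite ?mem_head.
by move=> u us'; apply: hL; rewrite inE us' orbT.
Qed.

(** Giving [u] the color [c] in advance costs its neighbor [v] nothing, since [c] is not in [L v].
    So [v] has a spare color once [u] is removed, and it can be colored last. *)
Lemma unequal_colorable L v s u c : path e v s -> uniq (v :: rcons s u) -> e v u ->
  (forall w, w \in v :: rcons s u -> count (e w) (v :: rcons s u) <= #|L w|) ->
  c \in L u -> c \notin L v -> colorable L (v :: rcons s u).
Proof.
move=> pvs us vu hL cu cv.
pose L' w := if e w u then L w :\ c else L w.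
move: us; rewrite -rcons_cons rcons_uniq => /andP[uvs us].
have cnt w : count (e w) (v :: rcons s u) = count (e w) (v :: s) + e w u.
  by rewrite -rcons_cons -cats1 count_cat /= addn0.
have [t [tL tp]] : colorable L' (v :: s).
  apply: greedy_colorable => //=; apply/andP; split.
    have := hL v (mem_head _ _); rewrite cnt /= eirr add0n vu addn1.
    suff -> : L' v = L v by [].
    rewrite /L' vu; apply/setP => x; rewrite !inE; case: eqP => // ->.
    by rewrite (negPf cv).
  apply: (@attached_greedy _ [:: v]); first by apply: (path_attached (v := v)); rewrite ?mem_head.
  move=> w ws; have := hL w _; rewrite cnt inE mem_rcons inE ws !orbT => /(_ isT).
  rewrite /L'; case: ifP => wu; rewrite ?addn0//= addn1 => h.
  by rewrite -ltnS; apply: leq_trans h _; rewrite (cardsD1 c (L w)) -addn1 addnC leq_add2l leq_b1.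
pose t' w := if w == u then c else t w.
have t'E w : w \in v :: s -> t' w = t w.
  by rewrite /t'; case: eqP => // ->; rewrite (negPf uvs).
have tc w : w \in v :: s -> e w u -> t w <> c.
  by move=> ws wu; have := tL w ws; rewrite /L' wu !inE => /andP[/eqP].
exists t'; split=> [w|w z]; rewrite !mem_rcons.
  rewrite inE => /orP[/eqP ->|ws]; first by rewrite /t' eqxx.
  by rewrite t'E//; have := tL w ws; rewrite /L'; case: ifP => // _ /setD1P[].
have t'u : t' u = c by rewrite /t' eqxx.
rewrite [w \in _]inE [z \in _]inE => /orP[/eqP ->|ws] /orP[/eqP ->|zs] wz.
- by rewrite eirr in wz.
- by rewrite t'u t'E//; apply/nesym/tc; rewrite // esym.
- by rewrite t'u t'E//; apply: tc.
- by rewrite !t'E//; exact: tp.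
Qed.

(** Lovasz's argument for Brooks' theorem: the nonadjacent neighbors [a] and [b] of [x] share the
    color [c], so that [x], colored last, loses only one color to both of them. *)
Lemma triple_colorable (L0 : {set C}) a x b t : uniq [:: a, x, b & t] ->
  cycle e [:: a, x, b & t] -> ~~ e a b ->
  (forall w, w \in [:: a, x, b & t] -> count (e w) [:: a, x, b & t] = #|L0|) ->
  2 < #|L0| -> colorable (fun=> L0) [:: a, x, b & t].
Proof.
move=> u4 cyc nab hdeg L3; have [c cL] : exists c, c \in L0.
  by apply/card_gt0P; exact: ltn_trans L3.
have [ax xb pbt _] : [/\ e a x, e x b, path e b t & true].
  by move: cyc => /=; rewrite rcons_path => /and3P[? ? /andP[]].
have [ux ua ub] : [/\ uniq (x :: t), a \notin x :: t & b \notin x :: t].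
  move: u4; rewrite /= !inE !negb_or => /and4P[/and3P[ax' ab at'] /andP[xb' xt] bt ->].
  by rewrite xt ax' at' bt eq_sym xb'.
have cnt w : count (e w) [:: a, x, b & t] = count (e w) (x :: t) + (e w a + e w b).
  by rewrite /= [RHS]addnC -addnA; congr (_ + _); rewrite addnCA.
have [y yt xy] : exists2 y, y \in t & e x y.
  apply/hasP; rewrite has_count; have := hdeg x; rewrite cnt /= eirr.
  rewrite !inE eqxx orbT => /(_ isT); have := leq_b1 (e x a); have := leq_b1 (e x b).
  by move: (count _ _) (e x a : nat) (e x b : nat) #|L0| L3; clear; lia.
(* From the neighbor [y] of [x] the path [t] is followed backwards through [p] and forwards through
   [q], which gives a connected order of the remaining vertices headed by [x]. *)
have [p [q tE]] : exists p q, t = p ++ y :: q.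
  by case/splitPr: yt => p q; exists p, q.
pose r := y :: rev p ++ q; pose s := x :: r.
have sE : perm_eq (x :: t) s.
  by rewrite tE /s /r perm_cons perm_catC /= perm_cons perm_catC perm_cat2r perm_sym perm_rev.
pose L' w := if e w a || e w b then L0 :\ c else L0.
have att : attached [:: x] r.
  rewrite /r /= esym xy /=; move: pbt; rewrite tE cat_path /= => /and3P[pbp lpy pq].
  apply: attached_cat; last by apply: (path_attached (v := y)); rewrite ?mem_head.
  apply: (path_attached (v := y)); first exact: mem_head.
  have : path e b (rcons p y) by rewrite rcons_path pbp.
  rewrite -rev_path last_rcons belast_rcons rev_cons rcons_path => /andP[+ _].
  by rewrite (eq_path (e' := e)) // => ? ?; rewrite /= esym.
have us : uniq s by rewrite -(perm_uniq sE).
have cs w : count (e w) s = count (e w) (x :: t) by apply/permP; rewrite perm_sym.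
have cL' w : #|L0| <= #|L' w| + (e w a || e w b).
  rewrite /L'; case: ifP => _; last by rewrite addn0.
  by rewrite (cardsD1 c) cL addnC.
have [f [fL fp]] : colorable L' s.
  apply: greedy_colorable => //; apply/andP; split.
    have := hdeg x; rewrite !inE eqxx orbT => /(_ isT); rewrite cnt -cs /s /= -/r.
    have := cL' x; rewrite eirr add0n xb [e x a]esym ax /= addn1 => + ar.
    by rewrite -ar -/r addn2 ltnS.
  apply: (attached_greedy att) => w ws.
  have ws' : w \in x :: t by rewrite (perm_mem sE) /s inE ws orbT.
  have := hdeg w; rewrite inE [w \in x :: _]inE [w \in b :: _]inE.
  have -> : [|| w == a, w == x, w == b | w \in t].
    by move: ws'; rewrite inE => /orP[->|->]; rewrite !orbT.
  move=> /(_ isT); rewrite cnt -cs -/s; have := cL' w.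
  move: (count _ _) #|L0| #|L' w|; clear.
  by case: (e w a); case: (e w b) => /= *; lia.
pose f' w := if (w == a) || (w == b) then c else f w.
have f's w : w \in s -> f' w = f w.
  rewrite -(perm_mem sE) /f' => ws.
  case: eqP => [wa|_]; first by rewrite -wa ws in ua.
  by case: eqP => [wb|] //; rewrite -wb ws in ub.
have fc w : w \in s -> e w a || e w b -> f w <> c.
  by move=> /fL; rewrite /L' => + ab; rewrite ab => /setD1P[/eqP].
have mem4 w : w \in [:: a, x, b & t] -> (w == a) || (w == b) \/ w \in s.
  rewrite -(perm_mem sE) !inE => /or4P[wa|wx|wb|wt].
  - by left; rewrite wa.
  - by right; rewrite wx.
  - by left; rewrite wb orbT.
  - by right; rewrite wt orbT.
have f'c w : (w == a) || (w == b) -> f' w = c by rewrite /f' => ->.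
exists f'; split=> [w /mem4[wab|ws]|u v /mem4[uab|us'] /mem4[vab|vs] uv].
- by rewrite f'c.
- by rewrite f's//; have := fL w ws; rewrite /L'; case: ifP => // _ /setD1P[].
- exfalso; move: uv; case/orP: uab => /eqP ->; case/orP: vab => /eqP ->;
    by rewrite ?eirr // ?(esym b) (negPf nab).
- rewrite f'c// f's//; apply/nesym; apply: fc => //.
  by case/orP: uab uv => /eqP ->; rewrite esym => ->; rewrite ?orbT.
- rewrite f's// f'c//; apply: fc => //.
  by case/orP: vab uv => /eqP -> ->; rewrite ?orbT.
- by rewrite !f's//; exact: fp.
Qed.

(* If no three consecutive vertices a, x, b of a Hamiltonian ordering of K have
   a and b nonadjacent, adjacent vertices may be exchanged, so that every
   ordering of K is Hamiltonian. *)
Section Exchange.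
Variable K : seq X.
Hypothesis K3 : 2 < size K.
Hypothesis tri : forall a x b t, perm_eq [:: a, x, b & t] K ->
  cycle e [:: a, x, b & t] -> e a b.

Lemma cycle_rot1 v s : cycle e (v :: s) = cycle e (rcons s v).
Proof. by rewrite -(rot_cycle 1) rot1_cons. Qed.

Lemma perm_rot1 v s : perm_eq (rcons s v) (v :: s).
Proof. by rewrite perm_rcons. Qed.

(** Let [z] be the last vertex. The edges needed after the exchange are [a b] and [z x]; they come
    from [tri] at [a, x, b] and, if [z] is not [b], at [z, a, x]. *)
Lemma cycle_swap a x q : perm_eq [:: a, x & q] K -> cycle e [:: a, x & q] ->
  cycle e [:: x, a & q].
Proof.
move=> pK cK; case: q pK cK => [pK|b t pK cK].
  by move: K3; rewrite -(perm_size pK).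
have eab := tri pK cK.
have ezx : e (last b t) x.
  case/lastP: t pK cK eab => [|q z] pK cK eab.
    by move: cK => /=; rewrite [e x b]esym => /and4P[].
  rewrite last_rcons; apply: (@tri z a x (b :: q)).
    by apply: perm_trans pK; rewrite perm_sym; exact: (perm_rot1 z [:: a, x, b & q]).
  by rewrite cycle_rot1.
move: cK; rewrite /= !rcons_path => /and4P[ax xb pt la].
by rewrite esym ax eab pt ezx.
Qed.

Lemma cycle_move v p q : perm_eq (v :: p ++ q) K -> cycle e (v :: p ++ q) ->
  cycle e (p ++ v :: q).
Proof.
elim: p q => [//|w p IH] q pK cK.
have E : rcons (v :: p ++ q) w = v :: p ++ rcons q w by rewrite /= rcons_cat.
have h : cycle e (v :: p ++ rcons q w) by rewrite -E -cycle_rot1; exact: cycle_swap.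
have -> : cycle e (w :: p ++ v :: q) = cycle e (p ++ v :: rcons q w).
  by rewrite cycle_rot1 rcons_cat.
apply: IH h; apply: perm_trans pK; rewrite -E perm_rcons.
by rewrite -[X in perm_eq X _]/([:: w] ++ [:: v] ++ (p ++ q)) perm_catCA.
Qed.

Lemma cycle_exchange_complete : uniq K -> cycle e K ->
  forall u v, u \in K -> v \in K -> u != v -> e u v.
Proof.
move=> uK cK u v /rot_to[i s Ks] vK uv.
have vs : v \in s by move: vK; rewrite -(mem_rot i) Ks inE eq_sym (negPf uv).
case/splitPr: vs Ks => p q Ks.
have pK : perm_eq (u :: p ++ v :: q) K by rewrite -Ks perm_rot.
have cK' : cycle e (u :: p ++ v :: q) by rewrite -Ks rot_cycle.
have := cycle_move pK cK'.
by rewrite -(rot_cycle (size p)) rot_size_cat /= => /andP[].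
Qed.

End Exchange.

Definition chord K u v := [/\ u \in K, v \in K, e u v, v != next K u & u != next K v].

(** For odd size the chord excludes odd cycles. A chordless even cycle on at least four vertices
    does count as good, since it can be colored from any lists of size two. *)
Definition ham_good K := [/\ uniq K, cycle e K,
  exists u v, [/\ u \in K, v \in K, u != v & ~~ e u v] &
  odd (size K) -> exists u v, chord K u v].

Lemma cycle_rcons_to K u : uniq K -> u \in K -> 1 < size K -> cycle e K ->
  exists s, perm_eq (next K u :: rcons s u) K /\ cycle e (next K u :: rcons s u).
Proof.
move=> uK uinK sK cK; have [i s Ks] := rot_to uinK.
have : next (rot i K) u = next K u by rewrite next_rot.
have : 1 < size (u :: s) by rewrite -Ks size_rot.
have pK : perm_eq (u :: s) K by rewrite -Ks perm_rot.
have {}cK : cycle e (u :: s) by rewrite -Ks rot_cycle.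
case: s Ks pK cK => [|v s] Ks pK cK // _.
have -> : next (rot i K) u = v by rewrite Ks /= eqxx.
move=> <-; exists s; split; last by rewrite -rcons_cons -cycle_rot1.
by apply: perm_trans pK; exact: (perm_rot1 u (v :: s)).
Qed.

Lemma odd_index_next (K : seq X) u : uniq K -> ~~ odd (size K) -> u \in K ->
  odd (index (next K u) K) = ~~ odd (index u K).
Proof.
move=> uK ev uin; rewrite next_nth uin; have := uin; rewrite -index_mem.
case: K uK ev {uin} => // y p uyp ev; rewrite [size (y :: p)]/= ltnS leq_eqVlt.
set i := index u (y :: p); case/orP => [/eqP ip|ip].
  rewrite nth_default ?ip//; rewrite {1}/index /= eqxx.
  by move: ev; rewrite /= -ip negbK => ->.
by rewrite -[nth y p i]/(nth y (y :: p) i.+1) index_uniq.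
Qed.

(** Unless some vertex has a spare color or some list is not contained in the next one, all lists
    coincide and [K] induces a regular graph whose degree is the size of the list. What remains is
    the situation of Brooks' theorem: for lists of at least three colors a suitable triple exists,
    as otherwise exchanges would make [K] complete; for shorter lists [K] is an even cycle. *)
Lemma ham_colorable L K : ham_good K ->
  (forall v, v \in K -> count (e v) K <= #|L v|) -> colorable L K.
Proof.
move=> [uK cK [u0 [v0 [u0K v0K uv0 nuv0]]] oddK] hL.
have sK : 2 < size K.
  rewrite ltnNge; apply/negP => s2; move/negP: nuv0; apply.
  case: K s2 cK uK u0K v0K {hL oddK} => [|a [|b [|//]]] //= _; rewrite !inE.
    by rewrite andbT eirr.
  move=> /andP[ab /andP[ba _]] _ /orP[]/eqP ua /orP[]/eqP va;
    by move: uv0; rewrite ua va ?eqxx.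
have s1 : 1 < size K by exact: ltnW.
have cntK s : perm_eq s K -> forall w, count (e w) s = count (e w) K.
  by move=> /permP sE w; exact: sE.
have hLs s : perm_eq s K -> forall w, w \in s -> count (e w) s <= #|L w|.
  by move=> sE w; rewrite (perm_mem sE) (cntK _ sE); exact: hL.
have pcol s : perm_eq s K -> colorable L s -> colorable L K.
  by move=> /perm_mem; exact: colorable_mem.
case: (boolP (has (fun v => count (e v) K < #|L v|) K)) => [/hasP[v vK hv]|].
  have [i s Ks] := rot_to vK; have pK : perm_eq (v :: s) K by rewrite -Ks perm_rot.
  apply: (pcol _ pK); apply: slack_colorable; rewrite ?(cntK _ pK)//.
  - have : cycle e (v :: s) by rewrite -Ks rot_cycle.
    by rewrite /= rcons_path => /andP[].
  - by rewrite (perm_uniq pK).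
  - exact: hLs.
move=> /hasPn hdeg.
have degE v : v \in K -> count (e v) K = #|L v|.
  by move=> vK; apply/eqP; rewrite eqn_leq hL// leqNgt hdeg.
case: (boolP (has (fun u => ~~ (L u \subset L (next K u))) K)) => [/hasP[u uinK]|].
  move=> /subsetPn[c cu cv]; have [s [pK cs]] := cycle_rcons_to uK uinK s1 cK.
  apply: (pcol _ pK); apply: unequal_colorable cu cv.
  - by move: cs; rewrite /= !rcons_path => /andP[/andP[]].
  - by rewrite (perm_uniq pK).
  - by rewrite esym next_cycle.
  - exact: hLs.
move=> /hasPn hsub.
(* Inclusions of the lists all around the cycle force equality. *)
have cL : cycle (fun u v => L u \subset L v) K.
  by apply: cycle_from_next => // u /hsub; rewrite negbK.
have Lall u v : u \in K -> v \in K -> L u = L v.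
  have sub x y : x \in K -> y \in K -> L x \subset L y.
    move=> /rot_to[i s Ks]; rewrite -(mem_rot i) Ks => yK.
    have : cycle (fun u v => L u \subset L v) (x :: s) by rewrite -Ks rot_cycle.
    rewrite /= => /order_path_min; have tr : transitive (fun u v => L u \subset L v).
      by move=> ? ? ?; exact: fintype.subset_trans.
    by move=> /(_ tr) /allP; apply; rewrite mem_rcons yK.
  by move=> uin vin; apply/eqP; rewrite finset.eqEsubset !sub.
have colE : colorable (fun=> L u0) K -> colorable L K.
  by move=> [t [tL tp]]; exists t; split=> // v vK; rewrite (Lall v u0)//; exact: tL.
have deg0 v : v \in K -> count (e v) K = #|L u0|.
  by move=> vK; rewrite degE// (Lall v u0).
apply: colE.
have [k3|k2] := ltnP 2 #|L u0|.
  have [[a [x [b [t [pK cs nab]]]]]|htri] := pselect (exists a x b t,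
    [/\ perm_eq [:: a, x, b & t] K, cycle e [:: a, x, b & t] & ~~ e a b]).
    apply: colorable_mem (perm_mem pK) _; apply: triple_colorable => //.
      by rewrite (perm_uniq pK).
    by move=> w; rewrite (perm_mem pK) (cntK _ pK); exact: deg0.
  move/negP: nuv0; case; apply: (cycle_exchange_complete sK) => // a x b t pK cs.
  by apply: contrapT => /negP nab; apply: htri; exists a, x, b, t.
have two_nbrs u : u \in K -> next K u != prev K u.
  move=> uin; apply/eqP => E; have := next_prev uK u; rewrite -E.
  have [i s Ks] := rot_to uin; rewrite -!(next_rot i uK) Ks.
  have : uniq (u :: s) by rewrite -Ks rot_uniq.
  have : 2 < size (u :: s) by rewrite -Ks size_rot.
  case: s {Ks} => [|a [|b s]] //= _; rewrite !inE !negb_or eqxx.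
  move=> /and4P[/and3P[ua ub _] _ _ _]; rewrite eq_sym (negPf ua) eqxx => bu.
  by rewrite bu eqxx in ub.
have nextprev u v : u \in K -> v \in K -> e u v -> v = next K u \/ u = next K v.
  move=> uin vin uv; have [->|vn] := eqVneq v (next K u); first by left.
  right; have [->|vp] := eqVneq v (prev K u); first by rewrite next_prev.
  have : 2 < count (e u) K; last by rewrite deg0// ltnNge k2.
  rewrite -size_filter; apply: (@uniq_leq_size _ [:: v; next K u; prev K u]).
    by rewrite /= !inE negb_or vn vp two_nbrs.
  move=> w; rewrite mem_filter !inE => /or3P[]/eqP->.
  - by rewrite uv.
  - by rewrite next_cycle// mem_next.
  - by rewrite esym prev_cycle// mem_prev.
have evenK : ~~ odd (size K).
  by apply/negP => /oddK[u [v [uin vin uv vn un]]]; case: (nextprev u v) => // E;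
    [move: vn|move: un]; rewrite E eqxx.
have oddn u : u \in K -> odd (index (next K u) K) = ~~ odd (index u K).
  exact: odd_index_next.
have [c1 [c2 [c1L c2L c12]]] : exists c1 c2, [/\ c1 \in L u0, c2 \in L u0 & c1 != c2].
  have : 1 < #|L u0|.
    rewrite -(deg0 u0 u0K) -size_filter.
    apply: (@uniq_leq_size _ [:: next K u0; prev K u0]).
      by rewrite /= !inE two_nbrs.
    move=> w; rewrite mem_filter !inE => /orP[]/eqP->.
      by rewrite next_cycle// mem_next.
    by rewrite esym prev_cycle// mem_prev.
  by move=> /card_gt1P[x [y [? ? ?]]]; exists x, y.
exists (fun w => if odd (index w K) then c1 else c2); split=> [v _|u v uin vin uv].
  by case: ifP.
have neq : odd (index v K) = ~~ odd (index u K).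
  by case: (nextprev u v uin vin uv) => ->; rewrite oddn// negbK.
by rewrite neq; case: odd => /= E; move: c12; rewrite E eqxx.
Qed.

End ListColoring.

(** * Blocks and the minimal spanning forest *)

Section Blocks.
Context {X : eqType} (e : rel X) (Y : X -> Prop).
Hypotheses (esym : symmetric e) (eirr : irreflexive e).
Hypothesis nogood : forall K : seq X, (forall v, v \in K -> Y v) -> ~ ham_good e K.

(** For a vertex [x] of [Y], this relation says that [a] and [b] lie in one component of [Y] with
    [x] removed; these components are the branches at [x]. *)
Definition linked x a b := exists s, [/\ path e a s, last a s = b &
  forall v, v \in a :: s -> Y v /\ v <> x].

Lemma linked_refl x a : Y a -> a <> x -> linked x a a.
Proof. by move=> Ya ax; exists [::]; split=> // v; rewrite inE => /eqP ->. Qed.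

Lemma linked_trans x a b c : linked x a b -> linked x b c -> linked x a c.
Proof.
move=> [s [ps ls hs]] [t [pt lt ht]]; exists (s ++ t); split.
- by rewrite cat_path ps ls.
- by rewrite last_cat ls.
- move=> v; rewrite -cat_cons mem_cat => /orP[/hs//|vt]; apply: ht.
  by rewrite inE vt orbT.
Qed.

Lemma linked_sym x a b : linked x a b -> linked x b a.
Proof.
move=> [s [ps <- hs]]; exists (rev (belast a s)); split.
- by rewrite rev_path (eq_path (e' := e)) // => ? ?; rewrite esym.
- by case: s {ps hs} => //= c s; rewrite rev_cons last_rcons.
- by move=> v; rewrite -rev_rcons -lastI mem_rev; exact: hs.
Qed.

Lemma linked_edge x a b : e a b -> Y a -> Y b -> a <> x -> b <> x -> linked x a b.
Proof.
move=> ab Ya Yb ax bx; exists [:: b]; split; rewrite ?andbT//=; first by rewrite ab.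
by move=> v; rewrite !inE => /orP[]/eqP->.
Qed.

Definition clique (K : seq X) := forall u v, u \in K -> v \in K -> u != v -> e u v.

Lemma cycle_trichotomy (K : seq X) : (forall v, v \in K -> Y v) -> uniq K ->
  cycle e K -> clique K \/ odd (size K) /\ forall u v, ~ chord e K u v.
Proof.
move=> KY uK cK; have [cl|ncl] := pselect (clique K); first by left.
right; have [[oddK nch]|h] := pselect (odd (size K) /\ forall u v, ~ chord e K u v).
  by split.
exfalso; apply: (nogood KY); split=> //.
  apply: contrapT => nuv; apply: ncl => u v uin vin uv; apply/negPn/negP => euv.
  by apply: nuv; exists u, v.
move=> oddK; apply: contrapT => nch; apply: h; split=> // u v ch.
by apply: nch; exists u, v.
Qed.

Lemma chordless_head x y s v : uniq [:: x, y & s] -> e x v -> v \in [:: x, y & s] ->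
  (forall u w, ~ chord e [:: x, y & s] u w) -> v = y \/ v = last y s.
Proof.
move=> us xv vin nch; have [->|vy] := eqVneq v y; first by left.
right; set K := [:: x, y & s] in us vin nch.
have vn : v != next K x by rewrite /K /= eqxx.
have [xn|xn] := eqVneq x (next K v); last first.
  by case: (nch x v); split=> //; rewrite mem_head.
move: xn; rewrite next_nth vin /K.
set i := index v _ => xi.
have [ip|ip] := ltnP i (size (y :: s)).
  have xin : x \in y :: s by rewrite [X in X \in _]xi mem_nth.
  by move: us; rewrite /K cons_uniq xin.
have iK : i < size K by rewrite index_mem.
have iE : i = size (y :: s) by apply/eqP; rewrite eqn_leq ip andbT -ltnS.
have := nth_index x vin; rewrite -/i iE => <-.
by rewrite /K -[nth x (x :: _) _]/(nth x (y :: s) (size s)) -last_nth.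
Qed.

Lemma linked_shorten x a b : linked x a b -> exists p, [/\ path e a p, last a p = b,
  uniq (a :: p) & forall v, v \in a :: p -> Y v /\ v <> x].
Proof.
move=> [s [ps ls hs]]; move: ls; case: (shortenP ps) => p pp up sub lp.
exists p; split=> // v vp; apply: hs; move: vp.
by rewrite !inE => /orP[->//|/sub ->]; rewrite orbT.
Qed.

(** If [a] and [b] were not adjacent, the cycle through [x], [a] and [b] would be odd and chordless,
    so [c] would lie off it. A path from [c] to the first vertex [w] of this cycle makes a theta
    graph with branch points [x] and [w]. Its three cycles have an even total length, so not all of
    them are odd; and a clique among them would make [x] adjacent to [w], so that [w] is [a] or [b],
    which is refuted in turn. *)
Lemma block_clique x a b c : Y x -> e x a -> e x b -> e x c -> c <> a -> c <> b ->
  a <> b -> linked x a b -> linked x c a -> e a b.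
Proof.
move=> Yx xa xb xc ca cb ab_ lab lca; apply/negPn/negP => nab.
have [p [pp lp up hp]] := linked_shorten lab.
have [q [pq lq uq hq]] := linked_shorten lca.
have xp : x \notin a :: p by apply/negP => /hp[].
pose K := x :: a :: p.
have bp : b \in a :: p by rewrite -lp mem_last.
have uK : uniq K by rewrite /K cons_uniq xp.
have cK : cycle e K by rewrite /= xa rcons_path pp lp esym xb.
have KY v : v \in K -> Y v by rewrite inE => /orP[/eqP ->//|/hp[]].
have [cl|[oddK nch]] := cycle_trichotomy KY uK cK.
  move/negP: nab; apply; apply: cl; rewrite ?inE ?eqxx ?orbT//; last exact/eqP.
  by move: bp; rewrite inE => ->; rewrite orbT.
have xK v : e x v -> v \in a :: p -> v = a \/ v = b.
  move=> xv vp; rewrite -lp; apply: (chordless_head uK xv) => //.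
  by rewrite inE vp orbT.
have cp : c \notin a :: p by apply/negP => /(xK c xc)[].
have hit : has (mem (a :: p)) (c :: q).
  by apply/hasP; exists a; [rewrite -{1}lq mem_last|exact: mem_head].
have [w [q1 [q2 [qE wp q1p]]]] : exists w q1 q2, [/\ q = q1 ++ w :: q2, w \in a :: p &
    forall v, v \in c :: q1 -> v \notin a :: p].
  have hitq : has (mem (a :: p)) q by move: hit; rewrite /= (negPf cp).
  case: (split_find hitq) => w q1 q2 wp nq1; exists w, q1, q2; split=> //.
    by rewrite cat_rcons.
  by move=> v; rewrite inE => /orP[/eqP ->//|vq]; apply: contra nq1 => vp; apply/hasP; exists v.
have [p1 [p2 pE]] : exists p1 p2, a :: p = p1 ++ w :: p2.
  by case/splitPr: wp => p1 p2; exists p1, p2.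
have uw1 : uniq (c :: q1).
  by move: uq; rewrite qE -cat_cons cat_uniq => /andP[].
have pq1 : path e c (rcons q1 w).
  by move: pq; rewrite qE -cat_rcons cat_path => /andP[].
have Yq1 v : v \in c :: q1 -> Y v /\ v <> x.
  move=> vq; apply: hq; rewrite qE -cat_cons mem_cat vq//.
have xq1 : x \notin c :: q1 by apply/negP => /Yq1[].
have lp2 : last w p2 = b by rewrite -lp -[last a p]/(last a (a :: p)) pE last_cat.
have pp2 : path e w p2.
  by have : path e x (a :: p); [rewrite /= xa|rewrite pE cat_path /= => /and3P[]].
pose K2 := x :: c :: q1 ++ w :: p2.
have sub2 v : v \in w :: p2 -> v \in a :: p by move=> vw; rewrite pE mem_cat vw orbT.
have uw2 : uniq (p1 ++ w :: p2) by rewrite -pE.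
have gen r : path e w r -> uniq (w :: r) -> {subset w :: r <= a :: p} -> e (last w r) x ->
    [/\ uniq (x :: c :: q1 ++ w :: r), cycle e (x :: c :: q1 ++ w :: r) &
      forall v, v \in x :: c :: q1 ++ w :: r -> Y v].
  move=> pr ur subr lx; split.
  - rewrite -(cat_cons c) cons_uniq cat_uniq uw1 ur mem_cat negb_or xq1 !andTb !andbT.
    apply/andP; split; first by apply: contra xp => /subr.
    by apply/hasPn => v /subr vp; apply/negP => /q1p; rewrite vp.
  - rewrite /= xc rcons_path -cat_rcons cat_path pq1 last_rcons pr last_cat last_rcons.
    exact: lx.
  - move=> v; rewrite inE => /orP[/eqP ->//|]; rewrite -cat_cons mem_cat.
    by case/orP => [/Yq1[]//|/subr/hp[]].
pose p1' := rev p1.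
have sub1 : {subset w :: p1' <= a :: p}.
  by move=> v; rewrite pE inE mem_rev mem_cat inE => /orP[->|->]; rewrite ?orbT.
have l1 : last w p1' = a.
  by move: pE; rewrite /p1'; case: p1 {sub1 uw2 p1'} => [[]|? ? [-> _]] //=; rewrite rev_cons last_rcons.
have pp1 : path e w p1'.
  have : path e x (rcons p1 w).
    by have : path e x (a :: p); [rewrite /= xa|rewrite pE -cat_rcons cat_path => /andP[]].
  rewrite /p1'; case: (p1) => [//|z r]; rewrite rcons_cons /= => /andP[_ h].
  have := rev_path e z (rcons r w); rewrite last_rcons belast_rcons => ->.
  by rewrite (eq_path (e' := e)) // => ? ?; rewrite /= esym.
have [u2 c2 Y2] : [/\ uniq K2, cycle e K2 & forall v, v \in K2 -> Y v].
  apply: gen => //; last by rewrite lp2 esym.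
  by move: uw2; rewrite cat_uniq => /and3P[].
pose K1 := x :: c :: q1 ++ w :: p1'.
have [u1 c1 Y1] : [/\ uniq K1, cycle e K1 & forall v, v \in K1 -> Y v].
  apply: gen => //; last by rewrite l1 esym.
  rewrite -rev_rcons rev_uniq.
  by move: uw2; rewrite -cat_rcons cat_uniq => /and3P[].
have wK1 : w \in K1 by rewrite !inE mem_cat mem_head !orbT.
have wK2 : w \in K2 by rewrite !inE mem_cat mem_head !orbT.
have bK2 : b \in K2.
  by rewrite /K2 2!inE mem_cat -lp2 mem_last !orbT.
have aK1 : a \in K1.
  by rewrite /K1 2!inE mem_cat -l1 mem_last !orbT.
have wx : w != x by apply: contra xp => /eqP <-.
have xw K' : clique K' -> x \in K' -> w \in K' -> w = a \/ w = b.
  by move=> cl xin win; apply: xK wp; apply: cl; rewrite // eq_sym.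
have nclique K' : clique K' -> a \in K' -> b \in K' -> False.
  by move=> cl ain bin; move/negP: nab; apply; apply: cl => //; apply/eqP.
have nch1 : (forall u v, ~ chord e K1 u v) -> w <> b.
  move=> nch1 wb; have := chordless_head u1 xb; rewrite -wb => /(_ wK1 nch1).
  case=> [wc|]; first by case: cb; rewrite -wb.
  by rewrite last_cat /= l1 => wa; apply: ab_; rewrite -wa.
have nch2 : (forall u v, ~ chord e K2 u v) -> w <> a.
  move=> nch2 wa; have := chordless_head u2 xa; rewrite -wa => /(_ wK2 nch2).
  case=> [wc|]; first by case: ca; rewrite -wa.
  by rewrite last_cat /= lp2 => wb; apply: ab_; rewrite -wb.
have x1 : x \in K1 by rewrite mem_head.
have x2 : x \in K2 by rewrite mem_head.
have [cl1|[odd1 ch1]] := cycle_trichotomy Y1 u1 c1.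
  have [cl2|[odd2 ch2]] := cycle_trichotomy Y2 u2 c2.
    case: (xw K1 cl1 x1 wK1) => E.
      by apply: nclique cl2 _ bK2; rewrite -E.
    by apply: nclique cl1 aK1 _; rewrite -E.
  case: (xw K1 cl1 x1 wK1) => E; first exact: nch2 ch2 E.
  by apply: nclique cl1 aK1 _; rewrite -E.
have [cl2|[odd2 ch2]] := cycle_trichotomy Y2 u2 c2.
  case: (xw K2 cl2 x2 wK2) => E; last exact: nch1 ch1 E.
  by apply: nclique cl2 _ bK2; rewrite -E.
move: oddK odd1 odd2; rewrite /K /K1 /K2 pE /= !size_cat /= size_rev.
rewrite !addnS /= !oddD !negbK.
by case: (odd (size p1)); case: (odd (size p2)); case: (odd (size q1)).
Qed.

End Blocks.

(** * The lexicographic order of edge keys *)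

Section Lexicographic.
Implicit Types f g h : nat -> bool.

Definition lexlt f g := exists n, [/\ ~~ f n, g n & forall m, m < n -> f m = g m].

Lemma lexlt_irr f : ~ lexlt f f.
Proof. by move=> [n [/negPf ->]]. Qed.

Lemma lexlt_trans f g h : lexlt f g -> lexlt g h -> lexlt f h.
Proof.
move=> [n [fn gn fg]] [m [gm hm gh]]; case: (ltngtP n m) => nm.
- by exists n; split=> // [|k kn]; [rewrite -gh|rewrite fg// gh// (ltn_trans kn)].
- by exists m; split=> // [|k km]; [rewrite fg|rewrite fg ?gh// (ltn_trans km)].
- by rewrite nm in gn; rewrite gn in gm.
Qed.

Lemma lexlt_total f g n : f n != g n -> lexlt f g \/ lexlt g f.
Proof.
move=> fgn; have ex : exists n, f n != g n by exists n.
case: (ex_minnP ex) => m fgm mmin.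
have E k : k < m -> f k = g k.
  by move=> km; apply/eqP/negPn/negP => /mmin; rewrite leqNgt km.
case Ef : (f m); case Eg : (g m); rewrite Ef Eg// in fgm.
  by right; exists m; rewrite Ef Eg; split=> // k /E.
by left; exists m; rewrite Ef Eg; split.
Qed.

Lemma lexlt_min (A : eqType) (s : seq A) (P : A -> Prop) (k : A -> nat -> bool) :
  (exists2 a, a \in s & P a) ->
  exists a, [/\ a \in s, P a & forall b, b \in s -> P b -> ~ lexlt (k b) (k a)].
Proof.
elim: s => [[]//|x s IH] [a]; rewrite inE => ain Pa.
have [[b bs Pb]|ns] := pselect (exists2 a, a \in s & P a); last first.
  have ax : a = x.
    by case/orP: ain => [/eqP//|ain]; case: ns; exists a.
  exists a; split=> //.
  move=> b; rewrite inE => /orP[/eqP -> _|bs Pb]; first by rewrite ax; exact: lexlt_irr.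
  by case: ns; exists b.
have [|{b bs Pb} b [bs Pb bmin]] := IH; first by exists b.
have [[Px xb]|h] := pselect (P x /\ lexlt (k x) (k b)).
  exists x; split=> //; first exact: mem_head.
  move=> c; rewrite inE => /orP[/eqP -> _|cs Pc cx]; first exact: lexlt_irr.
  exact: bmin cs Pc (lexlt_trans cx xb).
exists b; split=> //; first by rewrite inE bs orbT.
move=> c; rewrite inE => /orP[/eqP -> Px xb|]; last exact: bmin.
exact: h.
Qed.

End Lexicographic.

Section Walks.
Context {X : eqType} (H : X -> X -> Prop) (F : X -> Prop).

(* Walks without backtracking, recorded by their first edge xy and last edge uv. *)
Inductive nbw x y : X -> X -> Prop :=
| nbw0 : H x y -> nbw x y x y
| nbwS u v w : nbw x y u v -> H v w -> w <> u -> nbw x y v w.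

Definition acyclic := forall x y u v, nbw x y u v -> v <> x.

Definition node x := F x \/ exists y1 y2 y3,
  [/\ H x y1, H x y2 & H x y3] /\ [/\ y1 <> y2, y1 <> y3 & y2 <> y3].

(* The walk that starts with the edge xy and continues through vertices that
   are not nodes meets its first node b, coming from a, after n more steps. *)
Fixpoint reach n x y a b := if n is m.+1 then
    [/\ H x y, ~ node y & exists z, [/\ z <> x, H y z & reach m y z a b]]
  else [/\ H x y, node y, a = x & b = y].

End Walks.

(** * The minimal spanning forest and its nodes *)

Section SpanningForest.
Context {X : eqType} (e : rel X) (nb : X -> seq X) (d : nat) (Y F : X -> Prop)
  (key : X -> X -> nat -> bool).
Hypotheses (esym : symmetric e) (eirr : irreflexive e).
Hypothesis nbE : forall x y, (y \in nb x) = e x y.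
Hypothesis nbU : forall x, uniq (nb x).
Hypothesis d3 : 2 < d.
Hypothesis noclique : forall s : seq X, uniq s -> size s = d.+1 -> ~ clique e s.
Hypothesis nogood : forall K : seq X, (forall v, v \in K -> Y v) -> ~ ham_good e K.
Hypothesis nonfree : forall x, Y x -> ~ F x -> size (nb x) = d /\ forall y, e x y -> Y y.
Hypothesis key_sym : forall x y, key x y =1 key y x.
Hypothesis key_inj : forall x y u v, key x y =1 key u v ->
  x = u /\ y = v \/ x = v /\ y = u.
Local Notation linkedY := (linked e Y).

Fixpoint below n a b x y := if n is m.+1 then
    exists z, [/\ e x z, Y x, Y z, lexlt (key x z) (key a b) & below m a b z y]
  else x = y.

(** Kruskal's forest without a well-ordering of the edges: an edge is dropped as soon as a finite
    walk of strictly smaller edges joins its ends. *)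
Definition forest x y := [/\ e x y, Y x, Y y & forall n, ~ below n x y x y].

Lemma lexlt_keyC x y u v : lexlt (key x y) (key u v) -> lexlt (key y x) (key v u).
Proof.
move=> [n [h1 h2 h3]]; exists n; split; rewrite -?(key_sym u) -?(key_sym x)//.
by move=> m /h3; rewrite -?(key_sym u) -?(key_sym x).
Qed.

Lemma lexlt_keyCr x y f : lexlt f (key x y) -> lexlt f (key y x).
Proof.
move=> [n [h1 h2 h3]]; exists n; split; rewrite -?(key_sym x)//.
by move=> m /h3; rewrite -?(key_sym x).
Qed.

Lemma below_rcons n a b x y z : below n a b x y -> e y z -> Y y -> Y z ->
  lexlt (key y z) (key a b) -> below n.+1 a b x z.
Proof.
elim: n x => [|n IH] x /=; first by move=> -> *; exists z.
by move=> [w [h1 h2 h3 h4 h5]] *; exists w; split=> //; exact: IH.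
Qed.

Lemma below_sym n a b x y : below n a b x y -> below n b a y x.
Proof.
elim: n x y => [|n IH] x y; first by move=> ->.
move=> [z [xz Yx Yz k /IH]] h; apply: below_rcons h _ _ _ _ => //.
  by rewrite esym.
by apply: lexlt_keyC.
Qed.

Lemma forest_sym x y : forest x y -> forest y x.
Proof. by move=> [xy Yx Yy h]; split=> // [|n /below_sym]; [rewrite esym|exact: h]. Qed.

(* Cut the walk at its last visit to x. *)
Lemma below_linked x n a b u v : below n a b u v -> Y v -> v <> x ->
  (u <> x /\ linkedY x u v) \/
  exists w, [/\ e x w, Y w, lexlt (key x w) (key a b) & linkedY x w v].
Proof.
elim: n u => [|n IH] u /=.
  by move=> -> Yv vx; left; split=> //; exact: linked_refl.
move=> [z [uz Yu Yz k /IH h]] Yv vx; case: (h Yv vx) => [[zx lzv]|]; last by right.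
have [ux|ux] := pselect (u = x); first by right; exists z; rewrite ux in uz k; split.
by left; split=> //; apply: linked_trans lzv; exact: linked_edge.
Qed.

(** The least edge from [x] into a branch belongs to the forest: a walk of smaller edges to its
    other end would leave [x] for the last time by a smaller edge into the same branch. *)
Lemma forest_linked x a : Y x -> e x a -> Y a ->
  exists2 b, forest x b & linkedY x b a.
Proof.
move=> Yx xa Ya; have ax : a <> x by move=> E; rewrite E eirr in xa.
have [|b [bnb [Yb lb] bmin]] := @lexlt_min _ (nb x) (fun b => Y b /\ linkedY x b a) (key x).
  by exists a; rewrite ?nbE//; split=> //; exact: linked_refl.
have xb : e x b by rewrite -nbE.
exists b => //; split=> // n hb; have bx : b <> x by move=> E; rewrite E eirr in xb.
have [[//]|[w [xw Yw kw lw]]] := below_linked hb Yb bx.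
apply: (bmin w) kw; first by rewrite nbE.
by split=> //; exact: linked_trans lw lb.
Qed.

Lemma linked_weaken (P : X -> Prop) x a b :
  linked e (fun v => Y v /\ P v) x a b -> linkedY x a b.
Proof. by move=> [s [h1 h2 h3]]; exists s; split=> // v /h3[[]]. Qed.

Lemma linked_swap x y a b :
  linked e (fun v => Y v /\ v <> y) x a b -> linkedY y a b.
Proof. by move=> [s [h1 h2 h3]]; exists s; split=> // v /h3[[]]. Qed.

(** Such a [w] shows that an edge [v1 v2] of [Y] is not a bridge. *)
Definition exit_edge v1 v2 w := [/\ w <> v2, e v1 w, Y w & linkedY v1 w v2].

(** The last time the walk is at [v1] or [v2], it leaves by an exit edge there, whose key is smaller
    than that of [v1 u]. *)
Lemma below_exit v1 v2 n u : v1 <> v2 -> e v1 v2 -> Y v1 -> Y v2 -> exit_edge v1 v2 u ->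
  below n v1 u v1 u ->
  (exists2 w, exit_edge v1 v2 w & lexlt (key v1 w) (key v1 u)) \/
  (exists2 w, exit_edge v2 v1 w & lexlt (key v2 w) (key v1 u)).
Proof.
move=> v12 ev Yv1 Yv2 [uv2 v1u Yu luv2].
have uv1 : u <> v1 by move=> E; rewrite E eirr in v1u.
pose l2 := linked e (fun v => Y v /\ v <> v2) v1.
suff main m z : below m v1 u z u -> (l2 z u /\ z <> v1 /\ z <> v2) \/
   exists i w, [/\ i = v1 \/ i = v2, e i w, Y w, lexlt (key i w) (key v1 u) & l2 w u /\ w <> v1 /\ w <> v2].
  case/main => [[_ []//]|[i [w [[]-> iw Yw kw [lw [wv1 wv2]]]]]].
    left; exists w => //; split=> //; apply: linked_trans luv2.
    exact: linked_weaken lw.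
  right; exists w => //; split=> //; apply: (linked_trans (b := u)).
    exact: linked_swap lw.
  by apply: linked_edge; rewrite 1?esym//; exact/nesym.
elim: m z => [|m IH] z /=.
  by move=> ->; left; split=> //; exact: linked_refl.
move=> [w [zw Yz Yw k /IH[[lw [wv1 wv2]]|]]]; last by right.
have [zv1|zv1] := pselect (z = v1).
  by right; exists v1, w; rewrite zv1 in zw k; split=> //; left.
have [zv2|zv2] := pselect (z = v2).
  by right; exists v2, w; rewrite zv2 in zw k; split=> //; right.
by left; split=> //; apply: linked_trans lw; apply: linked_edge.
Qed.

(** The least of all exit edges at both ends is in the forest, because [below_exit] would provide a
    smaller one. *)
Lemma forest_exit v1 v2 u : forest v1 v2 -> exit_edge v1 v2 u ->
  (exists2 w, exit_edge v1 v2 w & forest v1 w) \/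
  (exists2 w, exit_edge v2 v1 w & forest v2 w).
Proof.
move=> [ev Yv1 Yv2 _] xu; have v12 : v1 <> v2 by move=> E; rewrite E eirr in ev.
have ev' : e v2 v1 by rewrite esym.
pose s := [seq (v1, w) | w <- nb v1] ++ [seq (v2, w) | w <- nb v2].
pose P (a : X * X) := (a.1 = v1 /\ exit_edge v1 v2 a.2) \/ (a.1 = v2 /\ exit_edge v2 v1 a.2).
have Ps a : P a -> a \in s.
  case: a => i w [[/= -> [_ iw _ _]]|[/= -> [_ iw _ _]]]; rewrite mem_cat; apply/orP;
    [left|right]; apply/mapP; by exists w; rewrite ?nbE.
have [|[i w] [_ Pw wmin]] := @lexlt_min _ s P (fun a => key a.1 a.2).
  by exists (v1, u); [apply: Ps|]; left.
case: (Pw) => -[/= iE xw]; [left|right]; exists w => //; rewrite {}iE {i} in wmin Pw *;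
  case: (xw) => wv iw Yw _; split=> // n hb.
  have [[w' x' k]|[w' x' k]] := below_exit v12 ev Yv1 Yv2 xw hb.
    by apply: (wmin (v1, w') _ _ k); [apply: Ps|]; left.
  by apply: (wmin (v2, w') _ _ k); [apply: Ps|]; right.
have [[w' x' k]|[w' x' k]] := below_exit (nesym v12) ev' Yv2 Yv1 xw hb.
  by apply: (wmin (v2, w') _ _ k); [apply: Ps|]; right.
by apply: (wmin (v1, w') _ _ k); [apply: Ps|]; left.
Qed.

(** Otherwise all neighbors of [x] lie in one branch. Any two of them have a third one [c] beside
    them, as [d] is at least three, so [block_clique] makes them adjacent, and with [x] they form a
    clique on [d.+1] vertices. *)
Lemma nonfree_unlinked x : Y x -> ~ F x ->
  exists a b, [/\ e x a, e x b & ~ linkedY x a b].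
Proof.
move=> Yx /(nonfree Yx)[sx nY]; apply: contrapT => h.
have l a b : e x a -> e x b -> linkedY x a b.
  by move=> xa xb; apply: contrapT => nl; apply: h; exists a, b.
apply: (noclique (s := x :: nb x)); rewrite /= ?sx ?nbU ?nbE ?eirr//.
have cl a b : e x a -> e x b -> a != b -> e a b.
  move=> xa xb ab.
  have [c cnb cab] : exists2 c, c \in nb x & c \notin [:: a; b].
    apply: contrapT => nc; have : size (nb x) <= size [:: a; b].
      apply: uniq_leq_size => // c cnb; apply/negPn/negP => cab.
      by apply: nc; exists c.
    by rewrite sx /= leqNgt d3.
  move: cab; rewrite !inE negb_or => /andP[/eqP ca /eqP cb].
  have xc : e x c by rewrite -nbE.
  have ab' : a <> b by exact/eqP.
  by have := block_clique esym nogood Yx xa xb xc ca cb ab' (l _ _ xa xb) (l _ _ xc xa).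
move=> u v; rewrite !inE !nbE => /orP[/eqP->|xu] /orP[/eqP->|xv] uv //.
- by rewrite eqxx in uv.
- by rewrite esym.
- exact: cl.
Qed.

(** A nonfree vertex has two branches, and each contains the end of a forest edge at [x]. *)
Lemma forest_two x : Y x -> ~ F x -> forall y, exists2 y', y' <> y & forest x y'.
Proof.
move=> Yx nFx y; have [a [b [xa xb nl]]] := nonfree_unlinked Yx nFx.
have [_ nY] := nonfree Yx nFx.
have [a' fa la] := forest_linked Yx xa (nY _ xa).
have [b' fb lb] := forest_linked Yx xb (nY _ xb).
have [ay|ay] := pselect (a' = y); last by exists a'.
exists b' => // by_; apply: nl; apply: linked_trans lb.
by rewrite by_ -ay; apply: (linked_sym esym).
Qed.

Lemma forest_inv x y : ~ F x -> forest x y -> exists2 y', y' <> y & forest x y'.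
Proof. by move=> nFx [_ Yx _ _]; exact: forest_two. Qed.

Local Notation node := (node forest F).

(* Two forest-adjacent vertices that are not nodes form a bridge: the block at
   one of them would otherwise provide a third forest edge. *)
Lemma forest_bridge v1 v2 u : forest v1 v2 -> ~ node v1 -> ~ node v2 ->
  ~ exit_edge v1 v2 u.
Proof.
have gen i j w : forest i j -> ~ node i -> exit_edge i j w -> forest i w -> False.
  move=> fij ni [wj iw Yw lw] fiw.
  have nFi : ~ F i by move=> Fi; apply: ni; left.
  apply: ni; right.
  have [_ Yi _ _] := fij.
  have [a [b [ia ib nl]]] := nonfree_unlinked Yi nFi.
  have [_ nY] := nonfree Yi nFi.
  have [a' fa la] := forest_linked Yi ia (nY _ ia).
  have [b' fb lb] := forest_linked Yi ib (nY _ ib).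
  have [c [fc ncl]] : exists c, forest i c /\ ~ linkedY i c j.
    have [laj|] := pselect (linkedY i a' j); last by exists a'.
    exists b'; split=> // lbj; apply: nl.
    apply: (linked_trans (b := j)); last first.
      by apply: linked_trans lb; apply: (linked_sym esym).
    by apply: linked_trans laj; apply: (linked_sym esym).
  have ji : j <> i by case: fij => ij _ _ _ E; rewrite E eirr in ij.
  have Yj : Y j by case: fij.
  exists j, w, c; split=> //; split; first exact/nesym.
    by move=> E; apply: ncl; rewrite -E; exact: linked_refl.
  by move=> E; apply: ncl; rewrite -E.
move=> f12 n1 n2 xu; have [[w xw fw]|[w xw fw]] := forest_exit f12 xu.
  exact: gen f12 n1 xw fw.
exact: gen (forest_sym f12) n2 xw fw.
Qed.

(** A node is met within three edges. If the successive vertices [y], [z] and [w] were not nodes,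
    both forest edges at [z] would be bridges of [Y] and [z] would have no third branch, so [y] and
    [w] would be its only neighbors. *)
Lemma forest_reach x y : forest x y -> exists n a b, reach forest F n x y a b.
Proof.
move=> fxy; have [ny|ny] := pselect (node y); first by exists 0, x, y.
have nFy : ~ F y by move=> Fy; apply: ny; left.
have Yy : Y y by case: fxy.
have [z zx fyz] := forest_two Yy nFy x.
have [nz|nz] := pselect (node z).
  by exists 1, y, z; split=> //; exists z.
have nFz : ~ F z by move=> Fz; apply: nz; left.
have Yz : Y z by case: fyz.
have [w wy fzw] := forest_two Yz nFz y.
have [nw|nw] := pselect (node w).
  by exists 2, z, w; split=> //; exists z; split=> //; split=> //; exists w.
exfalso; have [sz nY] := nonfree Yz nFz.
have fzy := forest_sym fyz.
suff : size (nb z) <= size [:: y; w] by rewrite sz leqNgt d3.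
apply: uniq_leq_size => // a; rewrite nbE !inE => za.
have [b fb lb] := forest_linked Yz za (nY _ za).
have la : linkedY z a b by exact: (linked_sym esym).
have [bE|bE] : b = y \/ b = w.
  apply: contrapT => nb_; apply: nz; right; exists y, w, b; split=> //.
  by split; [exact/nesym|move=> E; apply: nb_; left|move=> E; apply: nb_; right].
- rewrite {}bE in la *; have [//|/eqP ay] := eqVneq a y.
  by case: (forest_bridge fzy nz ny (u := a)); split=> //; exact: nY.
- rewrite {}bE in la *; have [_|/eqP aw] := eqVneq a w; first by rewrite orbT.
  by case: (forest_bridge fzw nz nw (u := a)); split=> //; exact: nY.
Qed.

Definition closed_walk n (w : nat -> X) := [/\ 0 < n, w n = w 0,
  (forall j, j < n -> forest (w j) (w j.+1)) &
  forall j, j.+1 < n -> w j.+2 <> w j].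

Lemma nbw_walk x y u v : nbw forest x y u v -> exists n w,
  [/\ w 0 = x, w n = u, w n.+1 = v, (forall j, j <= n -> forest (w j) (w j.+1)) &
      forall j, j < n -> w j.+2 <> w j].
Proof.
elim=> [fxy|{}u {}v z _ [n [w [w0 wn wn1 hw nw]]] fvz zu].
  by exists 0, (fun j => if j == 0 then x else y); split=> // -[].
exists n.+1, (fun j => if j <= n.+1 then w j else z); split=> //.
- by rewrite ltnSn.
- by rewrite ltnn.
- move=> j jn; have [->|{}jn] : j = n.+1 \/ j < n.+1 by apply/predU1P; rewrite -leq_eqVlt.
    by rewrite ltnSn ltnn wn1.
  by rewrite jn (ltnW jn); apply: hw.
- move=> j jn; have [->|{}jn] : j = n \/ j < n by apply/predU1P; rewrite -leq_eqVlt.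
    by rewrite ltnn leqnSn wn.
  by rewrite ltnS jn (leqW (ltnW jn)); exact: nw.
Qed.

Lemma lexlt_neg (f g : nat -> bool) : lexlt f g ->
  lexlt (fun n => ~~ g n) (fun n => ~~ f n).
Proof.
move=> [n [fn gn fg]]; exists n; split=> //; first by rewrite negbK.
by move=> m /fg ->.
Qed.

(** A shortest closed walk has distinct vertices. Its edge with the largest key would have its ends
    joined by the rest of the walk, whose edges are all smaller. *)
Lemma forest_acyclic : acyclic forest.
Proof.
move=> x y u v /nbw_walk[n [w [w0 wn wn1 hw nw]]] vx.
have ex : exists n, `[< exists w, closed_walk n w >].
  by exists n.+1; apply/asboolP; exists w; split=> //; rewrite wn1 w0.
case: (ex_minnP ex) => {x y u v w w0 wn wn1 hw nw vx ex} {}n /asboolP[w [n0 wn hw nw]] nmin.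
have fxx x : ~ forest x x by case; rewrite eirr.
have n3 : 2 < n.
  case: n n0 wn hw nw {nmin} => [|[|[|]]] //= _ wn hw nw.
    by have := hw 0 isT; rewrite wn => /fxx.
  by have := nw 0 isT; rewrite wn.
have winj i j : i < n -> j < n -> w i = w j -> i = j.
  wlog ij : i j / i <= j => [hwlog|] iN jN E.
    by case/orP: (leq_total i j) => ij; [exact: hwlog|apply: ssrfun.esym; exact: hwlog].
  apply/eqP; rewrite eqn_leq ij leqNgt; apply/negP => ltij.
  have : n <= j - i; last by rewrite leqNgt (leq_ltn_trans (leq_subr _ _) jN).
  apply: nmin; apply/asboolP; exists (fun k => w (i + k)); split.
  - by rewrite subn_gt0.
  - by rewrite subnKC// addn0 E.
  - move=> k kj; rewrite addnS; apply: hw; apply: leq_trans (ltnW jN).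
    by rewrite -ltn_subRL.
  - move=> k kj; rewrite !addnS; apply: nw; apply: leq_trans (ltnW jN).
    by rewrite -addnS -ltn_subRL.
pose t j := w (j %% n).
have tS j : t j.+1 = w (j %% n).+1.
  rewrite /t; have jn : j %% n < n by rewrite ltn_mod.
  have [E|ne] := eqVneq (j %% n).+1 n.
    by rewrite E wn -addn1 -modnDml addn1 E modnn.
  by rewrite -addn1 -modnDml addn1 modn_small// ltn_neqAle ne.
have ft j : forest (t j) (t j.+1) by rewrite tS; apply: hw; rewrite ltn_mod.
have tinj i j : t i = t j -> i = j %[mod n] by apply: winj; rewrite ltn_mod.
have tper j : t (j + n) = t j by rewrite /t modnDr.
(* Complementing the keys reverses their order, so the minimum found here is the edge with the
   largest key. *)
have [i [_ _ imax]] := @lexlt_min _ (iota 0 n) (fun=> True)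
  (fun i m => ~~ key (t i) (t i.+1) m) (ex_intro2 _ _ 0 (etrans (mem_iota 0 n 0) n0) I).
have lt_i j : j <> i %[mod n] -> lexlt (key (t j) (t j.+1)) (key (t i) (t i.+1)).
  move=> ji; have [m] : exists m, key (t j) (t j.+1) m != key (t i) (t i.+1) m.
    apply: contrapT => h; have : key (t j) (t j.+1) =1 key (t i) (t i.+1).
      by move=> m; apply/eqP/negPn/negP => hm; apply: h; exists m.
    move=> /key_inj[[/tinj//]|[/tinj E1 /tinj E2]].
    have : i.+2 = i + 0 %[mod n].
      by rewrite -addn1 -modnDml -E1 modnDml addn1 E2 addn0.
    by rewrite -addn2 => /eqP; rewrite eqn_modDl mod0n modn_small.
  case/lexlt_total => // h; exfalso.
  apply: (imax (j %% n)) => //; first by rewrite mem_iota ltn_mod.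
  by apply: lexlt_neg; rewrite (tS (j %% n)) modn_mod -(tS j) [t (j %% n)]/t modn_mod.
have bel k : k < n -> below k (t i.+1) (t i) (t (i + n - k)) (t (i + n)).
  elim: k => [|k IH] kn; first by rewrite subn0.
  have kin : k < i + n by apply: leq_trans (leq_addl i n); exact: ltnW.
  have [ek Y1 Y2 _] := ft (i + n - k.+1).
  have E : (i + n - k.+1).+1 = i + n - k by rewrite subnSK.
  rewrite E in ek Y2; exists (t (i + n - k)); split=> //; last by apply: IH; exact: ltnW.
  apply: lexlt_keyCr; rewrite -E; apply: lt_i.
  rewrite -addnBA; last exact: ltnW.
  rewrite -[X in _ <> X %[mod n]]addn0 => /eqP; rewrite eqn_modDl mod0n modn_small.
    by rewrite subn_eq0 leqNgt kn.
  by rewrite ltn_subrL n0.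
have := bel n.-1; rewrite prednK// => /(_ (leqnn n)).
have -> : i + n - n.-1 = i.+1.
  by rewrite -{1}(prednK n0) addnS subSn ?leq_addl// addnK.
by rewrite tper => hb; have [_ _ _ /(_ n.-1)] := forest_sym (ft i); apply.
Qed.

End SpanningForest.

(** * Pruning a forest along marked segments *)

Section Walks.
Context {X : eqType} (F : X -> Prop).
Implicit Types H : X -> X -> Prop.

Lemma nbw_turn H x y u v w s t : nbw H x y u v -> w <> u -> nbw H v w s t -> nbw H x y s t.
Proof.
move=> h wu; elim=> [vw|{}s {}t z _ h' tz zs]; first exact: nbwS h vw wu.
exact: nbwS h' tz zs.
Qed.

Lemma nbw_sub H H' x y u v : (forall a b, H' a b -> H a b) ->
  nbw H' x y u v -> nbw H x y u v.
Proof.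
move=> sub; elim=> [h|{}u {}v w _ h vw wu]; first by apply: nbw0; apply: sub.
exact: nbwS h (sub _ _ vw) wu.
Qed.

(** The invariant of the deletion process: [pr_deg] forbids leaves outside [F], and [pr_reach] keeps
    the segments between nodes finite. *)
Record pruned (H : X -> X -> Prop) : Prop := Pruned {
  pr_sym : forall x y, H x y -> H y x;
  pr_irr : forall x, ~ H x x;
  pr_acyclic : acyclic H;
  pr_deg : forall x y, ~ F x -> H x y -> exists2 y', y' <> y & H x y';
  pr_reach : forall x y, H x y -> exists n a b, reach H F n x y a b }.

End Walks.

Section Prune.
Context {X : eqType} (F : X -> Prop) (H : X -> X -> Prop) (hH : pruned F H).
Local Notation node_of K := (node K F).
Local Notation reach_of K := (reach K F).
Local Notation node := (node H F).
Local Notation reach := (reach H F).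
Let Hsym := pr_sym hH.

Lemma reach_node n x y a b : reach n x y a b -> [/\ H x y, H a b & node b].
Proof.
elim: n x y => [|n IH] x y /=; first by move=> [h nb -> ->].
by move=> [h _ [z [_ _ /IH[_ ? ?]]]].
Qed.

Lemma nonnode_uniq x y z z' : ~ node y -> H y x -> H y z -> H y z' -> z <> x -> z' <> x ->
  z = z'.
Proof.
move=> ny yx yz yz' zx z'x; apply: contrapT => zz'; apply: ny; right.
by exists x, z, z'; split=> //; split=> //; exact/nesym.
Qed.

Lemma reach_fun n n' x y a b a' b' : reach n x y a b -> reach n' x y a' b' ->
  [/\ n = n', a = a' & b = b'].
Proof.
elim: n n' x y => [|n IH] [|n'] x y /=.
- by move=> [_ _ -> ->] [_ _ -> ->].
- by move=> [_ ny _ _] [_ []].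
- by move=> [_ ny _] [_ /ny].
move=> [xy ny [z [zx yz hz]]] [_ _ [z' [z'x yz' hz']]].
have E := nonnode_uniq ny (Hsym xy) yz yz' zx z'x; rewrite -E in hz'.
by have [-> -> ->] := IH _ _ _ hz hz'.
Qed.

Lemma reach_step n x y z a b : reach n x y a b -> ~ node y -> H y z -> z <> x ->
  exists2 m, n = m.+1 & reach m y z a b.
Proof.
case: n => [|n] /=; first by move=> [_ ny].
move=> [xy ny [z' [z'x yz' hz']]] _ yz zx; exists n => //.
by rewrite (nonnode_uniq ny (Hsym xy) yz yz' zx z'x).
Qed.

Lemma reach_rev_gen n m x y a b c f : reach n x y a b -> reach m y x c f ->
  reach (n + m) b a c f.
Proof.
elim: n m x y => [|n IH] m x y; first by move=> [_ _ -> ->].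
move=> [xy ny [z [zx yz hz]]] h; rewrite addSnnS; apply: IH hz _.
split; [exact: Hsym|by []|].
by exists x; split=> //; [exact/nesym|exact: Hsym].
Qed.

Lemma reach_rev n x y a b : reach n x y a b -> node x -> reach n b a y x.
Proof.
move=> h nx; have [xy _ _] := reach_node h; rewrite -(addn0 n).
by apply: reach_rev_gen h _; split=> //; exact: Hsym.
Qed.

Lemma reach_nbw n x y a b : reach n x y a b -> nbw H x y a b.
Proof.
elim: n x y => [|n IH] x y /=; first by move=> [xy _ -> ->]; exact: nbw0.
move=> [xy _ [z [zx yz /IH hz]]].
exact: nbw_turn (nbw0 xy) zx hz.
Qed.

Lemma reach_neq n x y a b : reach n x y a b -> b <> x.
Proof. by move=> /reach_nbw h; exact: (pr_acyclic hH h). Qed.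

(** Two different segments from [p] to [q] would close a cycle. *)
Lemma reach_inj n n' p y y' a a' q : node p -> reach n p y a q -> reach n' p y' a' q ->
  y = y' /\ a = a'.
Proof.
move=> np h h'; have [yy'|yy'] := pselect (y = y').
  by rewrite -yy' in h'; have [_ -> _] := reach_fun h h'.
exfalso; have hr := reach_nbw (reach_rev h np).
by apply: (pr_acyclic hH (nbw_turn hr (nesym yy') (reach_nbw h'))).
Qed.

Definition adjacent_nodes p q := p = q \/ exists n y a, reach n p y a q.

Lemma adjacent_nodes_sym p q : node p -> adjacent_nodes p q -> adjacent_nodes q p.
Proof.
move=> np [->|[n [y [a h]]]]; first by left.
by right; exists n, a, y; exact: reach_rev.
Qed.

(* M a b marks the segment that enters its end node b through a. *)
Variable M : X -> X -> Prop.
Hypothesis M_edge : forall a b, M a b -> node b /\ H a b.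
Hypothesis M_uniq : forall a a' b, M a b -> M a' b -> a = a'.
Hypothesis M_sparse : forall a b a' b' p q, M a b -> M a' b' -> node p -> node q ->
  adjacent_nodes b p -> adjacent_nodes p q -> adjacent_nodes q b' -> b = b'.

Definition cut x y := exists n a b, (reach n x y a b \/ reach n y x a b) /\ M a b.
Definition prune x y := H x y /\ ~ cut x y.

Lemma cut_sym x y : cut x y -> cut y x.
Proof. by move=> [n [a [b [h m]]]]; exists n, a, b; split=> //; tauto. Qed.

Lemma prune_sym x y : prune x y -> prune y x.
Proof. by move=> [xy nc]; split=> [|/cut_sym//]; exact: Hsym. Qed.

Lemma cut_step x y z : ~ node y -> H x y -> H y z -> z <> x -> cut x y -> cut y z.
Proof.
move=> ny xy yz zx [n [a [b [[h|h] m]]]].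
  by have [k _ hk] := reach_step h ny yz zx; exists k, a, b; split=> //; left.
exists n.+1, a, b; split=> //; right; split=> //; first exact: Hsym.
by exists x; split=> //; [exact/nesym|exact: Hsym].
Qed.

Lemma M_adj a b : M a b -> node b. Proof. by case/M_edge. Qed.

Lemma cut_node q y : node q -> cut q y ->
  M y q \/ exists n a b, reach n q y a b /\ M a b.
Proof.
move=> nq [n [a [b [[h|h] m]]]]; first by right; exists n, a, b.
by left; case: n h => [[_ _ <- <-]//|n [_ /(_ nq)]].
Qed.

(** The marked ends of the two cut segments are [q] itself or adjacent to it. So [M_sparse]
    identifies these ends and [M_uniq] the segments. *)
Lemma cut_node_uniq q y y' : node q -> cut q y -> cut q y' -> y = y'.
Proof.
move=> nq /(cut_node nq)[m|[n [a [b [h m]]]]] /(cut_node nq)[m'|[n' [a' [b' [h' m']]]]].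
- exact: M_uniq m m'.
- exfalso; apply: (reach_neq h'); apply/esym; apply: (M_sparse m m' nq nq); try by left.
  by right; exists n', y', a'.
- exfalso; apply: (reach_neq h); apply/esym; apply: (M_sparse m' m nq nq); try by left.
  by right; exists n, y, a.
have bb' : b = b'.
  apply: (M_sparse m m' nq nq); try by left.
    by right; exists n, a, y; exact: reach_rev.
  by right; exists n', y', a'.
rewrite -{}bb' in h' m'; have aa' := M_uniq m m'; rewrite -{}aa' in h'.
by have [_ -> _] := reach_fun (reach_rev h nq) (reach_rev h' nq).
Qed.

Lemma prune_deg x y : ~ F x -> prune x y -> exists2 y', y' <> y & prune x y'.
Proof.
move=> nFx [xy ncut]; have [nx|nx] := pselect (node x).
  have [//|[y1 [y2 [y3 [[h1 h2 h3] [d12 d13 d23]]]]]] := nx.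
  have [y' [z' [hy' hz' ny' nz' yz]]] : exists y' z', [/\ H x y', H x z', y' <> y, z' <> y & y' <> z'].
    have [E1|n1] := pselect (y1 = y).
      by exists y2, y3; split=> // E; [apply: d12|apply: d13]; rewrite E1 E.
    have [E2|n2] := pselect (y2 = y).
      by exists y1, y3; split=> // E; apply: d23; rewrite E2 E.
    by exists y1, y2.
  have [cy'|cy'] := pselect (cut x y'); last by exists y'.
  exists z' => //; split=> // cz'; apply: yz; exact: cut_node_uniq nx cy' cz'.
have [y' yy' xy'] := pr_deg hH nFx xy; exists y' => //; split=> // c; apply: ncut.
by apply: (cut_step nx (Hsym xy') xy (nesym yy')); exact: cut_sym.
Qed.

Local Notation node' := (node_of prune).
Local Notation reach' := (reach_of prune).

Lemma node_prune x : node' x -> node x.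
Proof.
case=> [?|[y1 [y2 [y3 [[[? _] [? _] [? _]] ?]]]]]; first by left.
by right; exists y1, y2, y3.
Qed.

Lemma touched b : node b -> ~ node' b -> exists a s, M a s /\
  (b = s \/ exists n y, reach n b y a s) /\ adjacent_nodes b s.
Proof.
move=> nb nb'; have nFb : ~ F b by move=> Fb; apply: nb'; left.
have [//|[y1 [y2 [y3 [[h1 h2 h3] d123]]]]] := nb.
have [y cy] : exists y, cut b y.
  apply: contrapT => /forallNP nc; apply: nb'; right.
  by exists y1, y2, y3; split=> //; split.
case: (cut_node nb cy) => [m|[n [a [s [h m]]]]].
  by exists y, b; split=> //; split; left.
by exists a, s; split=> //; split; right; [exists n, y|exists n, y, a].
Qed.

Lemma prune_reach_cat n x y a b : reach n x y a b -> prune x y ->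
  (exists m c f, reach' m a b c f) -> exists m c f, reach' m x y c f.
Proof.
elim: n x y => [|n IH] x y; first by move=> [_ _ -> ->].
move=> [xy ny [z [zx yz hz]]] pxy hab.
have pyz : prune y z.
  split=> // c; case: pxy => _; apply; apply: cut_sym.
  by apply: (cut_step ny (Hsym yz) (Hsym xy) (nesym zx)); exact: cut_sym.
have [m [c [f h]]] := IH _ _ hz pyz hab.
exists m.+1, c, f; split=> //; first by move=> /node_prune.
by exists z.
Qed.

Lemma prune_end n x y a b : reach n x y a b -> prune x y -> prune a b.
Proof.
elim: n x y => [|n IH] x y; first by move=> [_ _ -> ->].
move=> [xy ny [z [zx yz hz]]] pxy; apply: IH hz _.
split=> // c; case: pxy => _; apply; apply: cut_sym.
by apply: (cut_step ny (Hsym yz) (Hsym xy) (nesym zx)); exact: cut_sym.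
Qed.

(** If the end [b] of a segment is no longer a node, the walk continues along a surviving segment to
    the next old node [b2]. Were [b2] lost as well, both would bound marked segments, which
    sparseness identifies. That segment would have the ends [b] and [b2], so by acyclicity it would
    be the surviving one. *)
Lemma prune_reach x y : prune x y -> exists n a b, reach' n x y a b.
Proof.
move=> pxy; have [n [a [b h]]] := pr_reach hH pxy.1.
have pab := prune_end h pxy; have [_ _ nb] := reach_node h.
apply: prune_reach_cat h pxy _.
have [nb'|nb'] := pselect (node' b); first by exists 0, a, b.
have nFb : ~ F b by move=> Fb; apply: nb'; left.
have [z za pbz] := prune_deg nFb (prune_sym pab).
have [n2 [a2 [b2 h2]]] := pr_reach hH pbz.1.
have [_ _ nb2] := reach_node h2.
have pab2 := prune_end h2 pbz.
have [nb2'|nb2'] := pselect (node' b2).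
  have [m [c [f hm]]] := prune_reach_cat h2 pbz (ex_intro _ 0 (ex_intro _ a2 (ex_intro _ b2 (And4 pab2 nb2' erefl erefl)))).
  by exists m.+1, c, f; split=> //; exists z.
exfalso; have b12 := reach_neq h2.
have [as_ [s [m1 [e1 adj1]]]] := touched nb nb'.
have [as2 [s2 [m2 [e2 adj2]]]] := touched nb2 nb2'.
have ss2 : s = s2.
  apply: (M_sparse m1 m2 nb nb2) => //; first exact: adjacent_nodes_sym adj1.
  by right; exists n2, z, a2.
rewrite -{}ss2 in m2 e2 adj2 *; have E := M_uniq m1 m2; rewrite -{}E in e2 {m2}.
have ncut n' c f : reach n' b z c f \/ reach n' z b c f -> ~ M c f.
  by move=> hc mc; case: pbz => _; apply; exists n', c, f.
case: e1 e2 => [E1|[k1 [y1 r1]]] [E2|[k2 [y2 r2]]].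
- by apply: b12; rewrite E1 E2.
- rewrite -E1 in r2 m1; have [_ E3] := reach_inj nb2 (reach_rev h2 nb) r2.
  by apply: (ncut 0 as_ b) m1; rewrite -E3; right; split=> //; exact: Hsym pbz.1.
- rewrite -E2 in r1 m1; have [_ E3] := reach_inj nb h2 r1.
  by rewrite -E3 in m1; apply: (ncut n2 a2 b2) m1; left.
- have [_ _ E3] := reach_fun (reach_rev r1 nb) (reach_rev r2 nb2).
  exact: b12.
Qed.

Lemma prune_pruned : pruned F prune.
Proof.
split.
- exact: prune_sym.
- by move=> x [/(pr_irr hH)].
- move=> x y u v /nbw_sub h; apply: (pr_acyclic hH (x := x) (y := y) (u := u)).
  by apply: h => ? ? [].
- exact: prune_deg.
- exact: prune_reach.
Qed.

Definition freed x := [/\ ~ F x, exists y, H x y & forall y, ~ prune x y].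
Definition flow x y := H x y /\ exists n a b, reach n x y a b /\ M a b.

Lemma freed_nonnode x : freed x -> ~ node x.
Proof.
move=> [nFx [y xy] hx] nx; have [//|[y1 [y2 [y3 [[h1 h2 h3] [d12 _ _]]]]]] := nx.
have c y' : H x y' -> cut x y'.
  by move=> xy'; apply: contrapT => nc; apply: (hx y').
by apply: d12; exact: cut_node_uniq nx (c _ h1) (c _ h2).
Qed.

Lemma freed_flow x : freed x -> exists y, flow x y.
Proof.
move=> fx; have nx := freed_nonnode fx; case: fx => nFx [y xy] hx.
have [n [a [b [[h|h] m]]]] : cut x y.
  by apply: contrapT => nc; apply: (hx y).
  by exists y; split=> //; exists n, a, b.
have [y' yy' xy'] := pr_deg hH nFx xy.
have [k _ hk] := reach_step h nx xy' yy'.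
by exists y'; split=> //; exists k, a, b.
Qed.

Lemma flow_asym x z : flow x z -> flow z x -> False.
Proof.
move=> [_ [n [a [b [h m]]]]] [_ [n' [a' [b' [h' m']]]]].
have hr := reach_rev_gen h h'; have [_ nb] := M_edge m.
apply: (reach_neq hr); apply/esym; apply: (M_sparse m m' (M_adj m) (M_adj m)); try by left.
by right; exists (n + n'), a, a'.
Qed.

(** Against the flow one moves along the segment away from its marked end and arrives after finitely
    many steps at the node at the other end, which is not freed. *)
Lemma flow_acc x : freed x -> Acc (fun y x => freed y /\ flow y x) x.
Proof.
move=> fx; have [z fz] := freed_flow fx.
have [nFx _ _] := fx; have [w wz xw] := pr_deg hH nFx fz.1.
have [m [c [f hm]]] := pr_reach hH xw.
elim: m x fx z fz {nFx} w wz xw hm => [|m IH] x fx z fz w wz xw hm;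
  constructor=> y [fy yx]; have nx := freed_nonnode fx; have ny := freed_nonnode fy.
all: have yz : y <> z by move=> E; rewrite E in yx; exact: flow_asym fz yx.
all: have yw : y = w by exact: (nonnode_uniq nx fz.1 (Hsym yx.1) xw yz wz).
  by case: hm => _ nw _ _; rewrite yw in ny.
rewrite -{}yw in hm xw wz; have [nFy _ _] := fy.
have [y' yx' yy'] := pr_deg hH nFy yx.1.
have [k [<-] hk] := reach_step hm ny yy' yx'.
exact: (IH y fy x yx y' yx' yy' hk).
Qed.

End Prune.

Local Open Scope classical_set_scope.

(** * Projections of Borel sets with finite sections *)

Definition agree N (f g : nat -> nat) := forall n, (n < N)%N -> f n = g n.

Lemma agreeW N M f g : (N <= M)%N -> agree M f g -> agree N f g.
Proof. by move=> NM h n nN; apply: h; apply: leq_trans NM. Qed.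

Definition unpair m : nat * nat := odflt (0, 0)%N (unpickle m).
Definition interleave (c : nat -> nat -> nat) m := c (unpair m).1 (unpair m).2.

Lemma interleave_agree i M : exists N, forall c a,
  agree N (interleave c) a -> agree M (c i) (fun n => a (pickle (i, n))).
Proof.
elim: M => [|M [N IH]]; first by exists 0%N.
exists (maxn N (pickle (i, M)).+1) => c a h n; rewrite ltnS leq_eqVlt.
case/orP => [/eqP ->|nM]; last first.
  by apply: (IH c a) => // k kN; apply: h; rewrite leq_max kN.
rewrite -h; last by rewrite leq_max ltnSn orbT.
by rewrite /interleave /unpair pickleK.
Qed.

(* Every point z of Z carries a code c z in the Baire space; whenever a is in
   the closure of the set of codes it is itself the code of some z, and p z is
   the limit of the points with codes close to a.  Thus p(Z) is the image of a
   closed subset of the Baire space under a continuous map. *)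
Definition presentation {T} (op : set (set T)) {T0} (Z : set T0) (p : T0 -> T) (c : T0 -> nat -> nat) :=
  forall a, (forall N, exists2 z, Z z & agree N (c z) a) ->
  exists z, [/\ Z z, c z =1 a & forall U, op U -> U (p z) ->
    exists N, forall z', Z z' -> agree N (c z') a -> U (p z')].

Definition lusin {T} (op : set (set T)) (A : set T) :=
  exists c, presentation op A id c.

Definition op_hausdorff {T} (op : set (set T)) := forall x y, x <> y ->
  exists U V, [/\ op U, op V, U x, V y & U `&` V = set0].

Definition bilusin {T} (op : set (set T)) A := lusin op A /\ lusin op (~` A).

Section Presentation.
Context {T : Type} (op : set (set T)).
Hypothesis hT : op_hausdorff op.

(** A number [m] that codes no pair is read as the pair [(0, 0)]. The value of [a] there equals that
    at [pickle (0, 0)] because [a] is a limit of interleaved codes. *)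
Lemma interleave_eq (c : nat -> nat -> nat) a :
  (forall i n, c i n = a (pickle (i, n))) ->
  (forall N, exists c', agree N (interleave c') a) -> interleave c =1 a.
Proof.
move=> h ha m; have [c' hc'] := ha (maxn m (pickle (unpair m))).+1.
have := hc' m; rewrite ltnS leq_maxl => /(_ isT) <-.
have := hc' (pickle (unpair m)); rewrite ltnS leq_maxr => /(_ isT).
by rewrite /interleave h /unpair pickleK /= => ->; case: (odflt _ _).
Qed.

(* The points of the intersection of the projections carry the codes of all
   their witnesses. *)
Lemma presentation_proj (T1 : Type) (op1 : set (set T1)) (q : T1 -> T)
    (Q : nat -> set T1) (c : nat -> T1 -> nat -> nat) :
  (forall U, op U -> op1 (q @^-1` U)) ->
  (forall i, presentation op1 (Q i) id (c i)) ->
  presentation op [set w : nat -> T1 | forall i, Q i (w i) /\ q (w i) = q (w 0%N)]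
    (fun w => q (w 0%N)) (fun w => interleave (fun i => c i (w i))).
Proof.
move=> hq hc a ha.
have /choice[x hx] : forall i, exists y : T1, [/\ Q i y,
    c i y =1 (fun n => a (pickle (i, n))) &
    forall U, op U -> U (q y) -> exists N, forall z', Q i z' ->
      agree N (c i z') (fun n => a (pickle (i, n))) -> U (q z')].
  move=> i.
  have [|z [Az cz hz]] := hc i (fun n => a (pickle (i, n))).
    move=> M; have [N hN] := interleave_agree i M.
    by have [w /(_ i)[Qw _] /hN hz] := ha N; exists (w i).
  exists z; split=> // U oU Uz; apply: (hz (q @^-1` U)) => //; exact: hq.
have xx i : q (x i) = q (x 0%N).
  apply: contrapT => /hT[U [V [oU oV Ui V0 UV]]].
  have [_ _ /(_ _ oU Ui)[N1 h1]] := hx i.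
  have [_ _ /(_ _ oV V0)[N2 h2]] := hx 0%N.
  have [M1 g1] := interleave_agree i N1; have [M2 g2] := interleave_agree 0%N N2.
  have [w Aw hw] := ha (maxn M1 M2).
  have : (U `&` V) (q (w 0%N)).
    split.
      rewrite -(Aw i).2; apply: h1; first exact: (Aw i).1.
      by apply: (g1 (fun i => c i (w i))); apply: agreeW hw; rewrite leq_maxl.
    apply: h2; first exact: (Aw _).1.
    by apply: (g2 (fun i => c i (w i))); apply: agreeW hw; rewrite leq_maxr.
  by rewrite UV.
exists x; split.
- by move=> i; split; [case: (hx i)|exact: xx].
- apply: interleave_eq => [i n|N]; first by case: (hx i) => _ ->.
  by have [w _ hw] := ha N; exists (fun i => c i (w i)).
move=> U oU Ux; have [_ _ /(_ _ oU Ux)[N h]] := hx 0%N.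
have [M g] := interleave_agree 0%N N; exists M => w Aw hw.
apply: h; first exact: (Aw _).1.
exact: (g (fun i => c i (w i))).
Qed.

Lemma lusin_bigcap (A : nat -> set T) :
  (forall i, lusin op (A i)) -> lusin op (\bigcap_i A i).
Proof.
move=> /choice[c hc]; exists (fun y => interleave (fun i => c i y)) => a ha.
have [|N|w [Aw cw hw]] := @presentation_proj T op id A c _ hc a => //.
  by have [z Az hz] := ha N; exists (fun=> z) => // i; split => //; apply: Az.
have wE i : w i = w 0%N by have [] := Aw i.
exists (w 0%N); split => [i _||U oU Uw]; first by have [] := Aw i; rewrite wE.
  by move=> m; rewrite -cw /interleave wE.
have [N hN] := hw U oU Uw; exists N => z Az hz.
by apply: (hN (fun=> z)) => // i; split => //; apply: Az.
Qed.

(** The code begins with the index of the piece, which is well defined by disjointness. *)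
Lemma lusin_bigcup_disjoint (A : nat -> set T) :
  (forall i j x, A i x -> A j x -> i = j) ->
  (forall i, lusin op (A i)) -> lusin op (\bigcup_i A i).
Proof.
move=> dA /choice[c hc]; pose k y := xget 0%N [set i | A i y].
have kE i y : A i y -> k y = i.
  move=> Aiy; apply: (dA _ _ y) (Aiy).
  exact: (@xgetPex _ 0%N [set i | A i y] (ex_intro _ i Aiy)).
exists (fun y n => if n is m.+1 then c (k y) y m else k y) => a ha.
have AaN N : exists2 z, A (a 0%N) z & agree N (c (a 0%N) z) (fun n => a n.+1).
  have [z [i _ Aiz] hz] := ha N.+1.
  have ka : a 0%N = i by rewrite -(hz 0%N)// (kE i).
  exists z; first by rewrite ka.
  by move=> n nN; have := hz n.+1 nN; rewrite (kE i)// -ka.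
have [z [Az cz hz]] := hc _ _ AaN.
exists z; split=> [||U oU Uz]; first by exists (a 0%N).
  by move=> -[|n]; rewrite (kE (a 0%N))//.
have [N hN] := hz U oU Uz; exists N.+1 => y [i _ Aiy] h.
have ka : a 0%N = i by rewrite -(h 0%N)// (kE i).
apply: hN; first by rewrite ka.
by move=> n nN; have := h n.+1 nN; rewrite (kE i)// ka.
Qed.

Lemma lusin0 : lusin op set0.
Proof. by exists (fun _ _ => 0%N) => a /(_ 0%N)[]. Qed.

(** Including the complements in the property allows a countable union to be made disjoint, by
    assigning each point to the first set that contains it. *)
Lemma bilusin_sigma : lusin op setT -> sigma_algebra setT (bilusin op).
Proof.
move=> lT; have l0 := lusin0; split=> [|A [lA lcA]|A lA]; first by split; rewrite ?setC0.
  by rewrite setTD; split; rewrite ?setCK.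
split; last by rewrite setC_bigcup; apply: lusin_bigcap => i; case: (lA i).
have -> : \bigcup_i A i =
    \bigcup_i (A i `&` \bigcap_j (if (j < i)%N then ~` A j else setT)).
  rewrite eqEsubset; split=> x [i _]; last by case=> Ai _; exists i.
  move=> Aix; have ex : exists i, `[< A i x >] by exists i; apply/asboolP.
  case: (ex_minnP ex) => n /asboolP Anx nmin; exists n => //; split => // j _.
  case: ifP => // jn Ajx; have := nmin j; rewrite asboolT// => /(_ isT).
  by rewrite leqNgt jn.
apply: lusin_bigcup_disjoint => [i j x [Ai hi] [Aj hj]|i].
  case: (ltngtP i j) => // ij; [have := hj i I|have := hi j I];
    by rewrite ij.
pose B j := if j is j'.+1 then (if (j' < i)%N then ~` A j' else setT) else A i.
have -> : A i `&` \bigcap_j (if (j < i)%N then ~` A j else setT) = \bigcap_j B j.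
  rewrite eqEsubset; split=> x; last first.
    by move=> h; split; [exact: (h 0%N)|move=> j _; exact: (h j.+1)].
  by move=> [Ai h] [|j] _ //; exact: (h j).
apply: lusin_bigcap => -[|j]; first by case: (lA i).
by rewrite /B; case: ifP => // _; case: (lA j).
Qed.

End Presentation.

(** * Separation by Borel sets and injective images *)

Section Separation.
Context {T : Type} (op : set (set T)).
Local Notation bor := (<<s op >>).

Let sbor : sigma_algebra setT bor.
Proof. exact: smallest_sigma_algebra. Qed.

Lemma bor0 : bor set0. Proof. by case: sbor. Qed.
Lemma borC A : bor A -> bor (~` A).
Proof. by case: sbor => _ h _ /h; rewrite setTD. Qed.
Lemma bor_bigcup (A : nat -> set T) : (forall i, bor (A i)) -> bor (\bigcup_i A i).
Proof. by case: sbor => ? ?; apply. Qed.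
Lemma bor_bigcap (A : nat -> set T) : (forall i, bor (A i)) -> bor (\bigcap_i A i).
Proof.
move=> h; rewrite -[X in bor X]setCK setC_bigcap; apply: borC.
by apply: bor_bigcup => i; apply: borC.
Qed.
Lemma borU A B : bor A -> bor B -> bor (A `|` B).
Proof.
move=> bA bB; have -> : A `|` B = \bigcup_i (if i is 0 then A else B).
  rewrite eqEsubset; split=> x.
    by case=> h; [exists 0%N|exists 1%N].
  by case=> -[|i] _ h; [left|right].
by apply: bor_bigcup => -[].
Qed.
Lemma borI A B : bor A -> bor B -> bor (A `&` B).
Proof.
move=> bA bB; rewrite -[A]setCK -[B]setCK -setCU; apply: borC.
by apply: borU; apply: borC.
Qed.

Lemma borT : bor setT.
Proof. by rewrite -[X in bor X]setC0; apply: borC; exact: bor0. Qed.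

Definition separated (A B : set T) := exists C, [/\ bor C, A `<=` C & C `&` B = set0].

Lemma separated_bigcup (A B : nat -> set T) :
  (forall i j, separated (A i) (B j)) -> separated (\bigcup_i A i) (\bigcup_j B j).
Proof.
move=> h.
have /choice[C hC] : forall i, exists C : nat -> set T, forall j,
    [/\ bor (C j), A i `<=` C j & C j `&` B j = set0].
  by move=> i; have /choice[C hC] := h i; exists C.
exists (\bigcup_i \bigcap_j C i j); split.
- by apply: bor_bigcup => i; apply: bor_bigcap => j; case: (hC i j).
- by move=> x [i _ Ax]; exists i => // j _; case: (hC i j) => _ + _; apply.
- rewrite -subset0 => x [[i _ Cx] [j _ Bx]]; have [_ _ <-] := hC i j.
  by split => //; apply: Cx.
Qed.

Section Prefix.
Context {T0 : Type} (Z : set T0) (p : T0 -> T) (c : T0 -> nat -> nat).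

Definition part (s : seq nat) : set T0 :=
  [set z | Z z /\ agree (size s) (c z) (nth 0%N s)].

Lemma part_rcons s : p @` part s = \bigcup_i (p @` part (rcons s i)).
Proof.
rewrite eqEsubset; split=> x.
  move=> [z [Zz h] <-]; exists (c z (size s)) => //; exists z => //; split => //.
  move=> n; rewrite size_rcons ltnS leq_eqVlt nth_rcons => /orP[/eqP ->|ns].
    by rewrite ltnn eqxx.
  by rewrite ns; apply: h.
move=> [i _ [z [Zz h] <-]]; exists z => //; split => // n ns.
by rewrite h ?size_rcons ?nth_rcons ?ns// ltnS ltnW.
Qed.

Lemma part_mkseq a N z : part (mkseq a N) z <-> Z z /\ agree N (c z) a.
Proof.
rewrite /part /= size_mkseq; split=> -[Zz h]; split=> // n nN.
  by rewrite h// nth_mkseq.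
by rewrite nth_mkseq// h.
Qed.

End Prefix.

Hypothesis hT : op_hausdorff op.

(** Lusin's argument: if the images are not separated, longer and longer prefixes can be chosen
    whose parts remain unseparated. They define limits [a] and [b], codes of two points with
    different images, and disjoint open neighborhoods of these images separate the parts of some
    finite stage. *)
Lemma presentation_separated {T1 T2 : Type} (Z1 : set T1) (Z2 : set T2) p1 p2 c1 c2 :
  presentation op Z1 p1 c1 -> presentation op Z2 p2 c2 ->
  p1 @` Z1 `&` p2 @` Z2 = set0 -> separated (p1 @` Z1) (p2 @` Z2).
Proof.
move=> h1 h2 d12; apply: contrapT => nsep.
pose P (st : seq nat * seq nat) :=
  ~ separated (p1 @` part Z1 c1 st.1) (p2 @` part Z2 c2 st.2).
have P0 : P ([::], [::]).
  rewrite /P /=; suff E U (Y : set U) c : part Y c [::] = Y by rewrite !E.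
  by rewrite eqEsubset; split=> [x []|x Yx]//; split.
have PS st : exists ij : nat * nat, P st -> P (rcons st.1 ij.1, rcons st.2 ij.2).
  apply: contrapT => /forallNP h; case: (h (0, 0)%N) => /= Pst; exfalso.
  apply: Pst; rewrite part_rcons (part_rcons Z2).
  apply: separated_bigcup => i j; apply: contrapT => nij.
  by apply: (h (i, j)).
have [step hstep] := choice PS.
pose x n := iter n (fun st => (rcons st.1 (step st).1, rcons st.2 (step st).2)) ([::], [::]).
have Px n : P (x n) by elim: n => //= n /hstep.
pose a n := (step (x n)).1; pose b n := (step (x n)).2.
have xE n : x n = (mkseq a n, mkseq b n).
  by elim: n => [//|n IH]; rewrite !mkseqS /a /b [in LHS]/x iterS -/(x n) {1 3}IH.
have Pab n : P (mkseq a n, mkseq b n) by rewrite -xE.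
have ne1 N : exists2 z, Z1 z & agree N (c1 z) a.
  apply: contrapT => h; apply: (Pab N); exists set0; split; first exact: bor0.
    by move=> y [z /part_mkseq[Zz hz]] _; apply: h; exists z.
  by rewrite set0I.
have ne2 N : exists2 z, Z2 z & agree N (c2 z) b.
  apply: contrapT => h; apply: (Pab N); exists setT; split => //; first exact: borT.
  by rewrite -subset0 => y [_ [z /part_mkseq[Zz hz]] _]; apply: h; exists z.
have [z1 [Zz1 _ l1]] := h1 _ ne1; have [z2 [Zz2 _ l2]] := h2 _ ne2.
have z12 : p1 z1 <> p2 z2.
  move=> E; suff : (p1 @` Z1 `&` p2 @` Z2) (p1 z1) by rewrite d12.
  by split; [exists z1|exists z2].
have [U [V [oU oV Uz Vz UV]]] := hT z12.
have [N1 g1] := l1 _ oU Uz; have [N2 g2] := l2 _ oV Vz.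
apply: (Pab (maxn N1 N2)); exists U; split; first exact: sub_sigma_algebra.
  move=> y [z /part_mkseq[Zz hz] <-]; apply: g1 => //.
  by apply: agreeW hz; rewrite leq_maxl.
rewrite -subset0 => y [Uy [z /part_mkseq[Zz hz] E]].
suff : (U `&` V) y by rewrite UV.
split => //; rewrite -E; apply: g2 => //.
by apply: agreeW hz; rewrite leq_maxr.
Qed.

Hypothesis op_union : forall F : set (set T), F `<=` op -> op (\bigcup_(U in F) U).

Hypothesis opT : op setT.

(** The Lusin-Souslin theorem. Points whose codes differ in the [n]-th digit have different images,
    so separation yields disjoint Borel sets [D n i] around the images. These sets assign at most
    one code to a point, and the closures of the images of the parts ensure that a preimage has this
    code. *)
Lemma presentation_borel {T0 : Type} (Z : set T0) p c :
  presentation op Z p c ->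
  (forall z z', Z z -> Z z' -> p z = p z' -> c z = c z') ->
  bor (p @` Z).
Proof.
move=> hp inj.
pose Zi n i := [set z | Z z /\ c z n = i].
have pZi n i : presentation op (Zi n i) p c.
  move=> a ha; have [N|z [Zz cz hz]] := hp a.
    by have [z [Zz _] hz] := ha N; exists z.
  exists z; split=> //; last first.
    by move=> U oU Uz; have [N hN] := hz U oU Uz; exists N => z' [Zz' _]; apply: hN.
  split => //; have [z1 [Zz1 <-] h1] := ha n.+1.
  by rewrite h1// cz.
have /choice[C' hC'] : forall nij : nat * nat * nat, exists C : set T,
    nij.1.2 <> nij.2 -> [/\ bor C, p @` Zi nij.1.1 nij.1.2 `<=` C &
                           C `&` p @` Zi nij.1.1 nij.2 = set0].
  case=> -[n i] j /=; have [->|/eqP ij] := eqVneq i j; first by exists set0.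
  have [|D hD] := presentation_separated (pZi n i) (pZi n j); last by exists D.
  rewrite -subset0 => y [[z [Zz zi] <-] [z' [Zz' zj] /(inj _ _ Zz' Zz) E]].
  by apply: ij; rewrite -zi -zj E.
pose C n i j := C' (n, i, j).
have hC n i j : i <> j -> [/\ bor (C n i j), p @` Zi n i `<=` C n i j &
  C n i j `&` p @` Zi n j = set0] by exact: (hC' (n, i, j)).
pose D n i := \bigcap_j (if j == i then setT else C n i j `&` ~` C n j i).
have bD n i : bor (D n i).
  apply: bor_bigcap => j; case: eqP => [_|/nesym ij]; first exact: borT.
  apply: borI; first by case: (hC n i j ij).
  by apply: borC; case: (hC n j i) => // /esym.
have DZ n i z : Z z -> c z n = i -> D n i (p z).
  move=> Zz zi j _; case: eqP => // /nesym ij; split.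
    by case: (hC n i j ij) => _ h _; apply: h; exists z.
  case: (hC n j i) => [/esym//|_ _ + h]; rewrite -subset0; apply; split; first exact: h.
  by exists z.
have Ddisj n i j x : D n i x -> D n j x -> i = j.
  move=> Di Dj; apply/eqP/negPn/negP => ij; have := Di j I; have := Dj i I.
  by rewrite (negPf ij) eq_sym (negPf ij) => -[_ +] [].
pose cl (A : set T) := ~` \bigcup_(U in [set U | op U /\ U `&` A = set0]) U.
have bcl A : bor (cl A).
  by apply: borC; apply: sub_sigma_algebra; apply: op_union => U [].
pose B s := cl (p @` part Z c s) `&` \bigcap_n (if (n < size s)%N then D n (nth 0%N s n) else setT).
have -> : p @` Z = \bigcap_N \bigcup_k
    (if unpickle k is Some s then (if size s == N then B s else set0) else set0).
  rewrite eqEsubset; split=> [x [z Zz <-] N _|x hx].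
    exists (pickle (mkseq (c z) N)) => //; rewrite pickleK size_mkseq eqxx; split.
      move=> [U [oU UA] Uz]; suff : (U `&` p @` part Z c (mkseq (c z) N)) (p z).
        by rewrite UA.
      by split => //; exists z => //; apply/part_mkseq.
    move=> n _; rewrite size_mkseq; case: ifP => // nN; rewrite nth_mkseq//.
    exact: DZ.
  have /choice[a Da] : forall n, exists i, D n i x.
    move=> n; have [k _] := hx n.+1 I.
    case: (unpickle k) => // s; case: eqP => // sn [_ /(_ n I)].
    by rewrite sn ltnSn => ?; exists (nth 0%N s n).
  have Ba N : cl (p @` part Z c (mkseq a N)) x.
    have [k _] := hx N I.
    case: (unpickle k) => // s; case: eqP => // sN [clx Ds].
    suff <- : s = mkseq a N by [].
    apply: (@eq_from_nth _ 0%N); rewrite ?size_mkseq// => n ns.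
    rewrite nth_mkseq -?sN//; apply: Ddisj (Da n).
    by have := Ds n I; rewrite ns.
  have [N|z [Zz cz hz]] := hp a.
    apply: contrapT => nz; apply: (Ba N); exists setT => //; split.
      exact: opT.
    rewrite -subset0 => y [_ [z /part_mkseq[Zz hz] _]]; apply: nz; by exists z.
  exists z => //; apply: contrapT => /hT[U [V [oU oV Uz Vx UV]]].
  have [N hN] := hz U oU Uz; apply: (Ba N); exists V => //; split=> //.
  rewrite -subset0 => y [Vy [w /part_mkseq[Zw hw] yw]].
  suff : (U `&` V) y by rewrite UV.
  by split => //; rewrite -yw; apply: hN.
apply: bor_bigcap => N; apply: bor_bigcup => k.
case: eqP => _; last exact: bor0.
rewrite /B; apply: borI => //; apply: bor_bigcap => n; case: ifP => // _; exact: borT.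
Qed.

End Separation.

Section First.
Context {T : Type}.
Implicit Types (W : nat -> set T) (y : T).

Definition first W y : nat :=
  if pselect (exists m, `[< W m y >]) is left h then ex_minn h else 0%N.

Lemma firstP W y : (exists m, W m y) ->
  W (first W y) y /\ forall j, (j < first W y)%N -> ~ W j y.
Proof.
move=> [m Wm]; rewrite /first; case: pselect => [h|[]]; last first.
  by exists m; apply/asboolP.
case: ex_minnP => n /asboolP Wn nmin; split=> // j jn /asboolP /nmin.
by rewrite leqNgt jn.
Qed.

Lemma first_eq W y m : W m y -> (forall j, (j < m)%N -> ~ W j y) -> first W y = m.
Proof.
move=> Wm h; have [Wf hf] := firstP (ex_intro _ m Wm).
by case: (ltngtP (first W y) m) => [/h//|/hf//|].
Qed.

Lemma first0 W y : ~ (exists m, W m y) -> first W y = 0%N.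
Proof.
move=> h; rewrite /first; case: pselect => // ex; exfalso; apply: h.
by case: ex => m Wm; exists m; apply/asboolP.
Qed.

End First.

(** * Codes for the points of a Polish space *)

Section Metric.
Context {R : realType} {M : metricType R}.
Import Order.TTheory GRing.Theory Num.Theory.
Local Open Scope ring_scope.

Lemma metric_ball_open (x : M) (d : R) : open (ball x d).
Proof.
rewrite openE => y; rewrite ballEmdist /= => xy.
apply/nbhs_ballP; exists (d - mdist x y); first by rewrite /= subr_gt0.
move=> z; rewrite !ballEmdist /= ltrBrDl; apply: le_lt_trans.
exact: metric_triangle.
Qed.

Lemma metric_base : separable (T := M) -> inhabited M ->
  exists U : nat -> set M, (forall n, open (U n)) /\
    forall O x, open O -> O x -> exists2 n, U n x & U n `<=` O.
Proof.
move=> [D cD dD] [x0].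
have [q hq] : exists q : nat -> M, forall x, D x -> exists n, q n = x.
  have [->|[f]] := pfcard_geP cD; first by exists (fun=> x0).
  exists f => x Dx; have [n _ <-] := @surj _ _ _ _ f x Dx; first by exists n.
exists (fun n => ball (q (unpair n).1) (unpair n).2.+1%:R^-1).
split=> [n|O x]; first exact: metric_ball_open.
rewrite openE => /[apply] /nbhs_ballP[e /= e0 xO].
have [k hk] : exists k, k.+1%:R^-1 < e / 2.
  have /ltr_add_invr[k] : 0 < e / 2 by rewrite divr_gt0.
  by rewrite add0r; exists k.
have k0 : 0 < k.+1%:R^-1 :> R by rewrite invr_gt0.
have [y [xy /hq[n qn]]] := dD (ball x k.+1%:R^-1)
  (ex_intro _ x (ballxx x k0)) (metric_ball_open x _).
exists (pickle (n, k)); rewrite /unpair pickleK /= qn; first exact: ball_sym.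
move=> z yz; apply: xO; rewrite (splitr e); apply: ball_triangle.
  exact: le_ball (ltW hk) _ xy.
exact: le_ball (ltW hk) _ yz.
Qed.

Hypothesis complete : forall F : set_system M,
  ProperFilter F -> cauchy F -> exists x : M, F --> x.

Variable U : nat -> set M.
Hypothesis oU : forall n, open (U n).
Hypothesis bU : forall O x, open O -> O x -> exists2 n, U n x & U n `<=` O.

Let reg n m := closure (U m) `<=` U n.
Let small k m := exists x : M, U m `<=` ball x k.+1%:R^-1.

Let regP n y : U n y -> exists m, U m y /\ reg n m.
Proof.
move=> Uy; have : nbhs y (U n) by apply: open_nbhs_nbhs.
move=> /nbhs_ballP[e /= e0 eU].
have e20 : 0 < e / 2 by rewrite divr_gt0.
have [m Um mb] := bU (metric_ball_open y (e / 2)) (ballxx y e20).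
exists m; split=> // z /(closureS mb) hz; apply: eU.
exact: (@subset_closure_half _ _ y e e0).
Qed.

Let smallP k y : exists m, U m y /\ small k m.
Proof.
have k0 : 0 < k.+1%:R^-1 :> R by rewrite invr_gt0.
have [m Um mb] := bU (metric_ball_open y _) (ballxx y k0).
by exists m; split=> //; exists y.
Qed.

(* The first coordinate family records which U n contain y, together with a
   witness for regularity; the second one makes the codes control the metric. *)
Let codeU y n := if `[< U n y >] then (first (fun m => [set y | U m y /\ reg n m]) y).+1
  else 0%N.
Let codeS y k := first (fun m => [set y | U m y /\ small k m]) y.
Let code y := interleave (fun i => if i is 0 then codeU y else codeS y).

Let codeUP y n m : codeU y n = m.+1 -> U m y /\ reg n m.
Proof.
rewrite /codeU; case: asboolP => // Uy [<-].
by have [] := @firstP _ (fun m => [set y | U m y /\ reg n m]) y (regP Uy).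
Qed.

(** Meant for [U n0], its complement and the whole space. The points with codes near [a] form a
    Cauchy filter because of the digits of [codeS]. Its limit [x] lies in the same sets [U n] as
    they do, since a regularity witness prevents limits from leaving [U n]. Each digit is settled by
    finitely many memberships, so the code of [x] is [a]. *)
Lemma decided_lusin n0 (A : set M) :
  (forall x y, (U n0 x <-> U n0 y) -> A x -> A y) -> lusin open A.
Proof.
move=> hA; exists code => a ha.
pose a0 (n : nat) := a (pickle (0%N, n)).
have h0 (M0 : nat) : exists N, forall y, agree N (code y) a -> agree M0 (codeU y) a0.
  have [N hN] := interleave_agree 0%N M0.
  by exists N => y /hN.
have h1 (i M0 : nat) : exists N, forall y, agree N (code y) a ->
    agree M0 (codeS y) (fun n => a (pickle (i.+1, n))).
  have [N hN] := interleave_agree i.+1 M0.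
  by exists N => y /hN.
pose F : set_system M := [set S | exists N, forall y, A y -> agree N (code y) a -> S y].
have FF : ProperFilter F.
  apply: Build_ProperFilter_ex => [S [N hN]|].
    by have [y Ay /(hN _ Ay)] := ha N; exists y.
  split; first by exists 0%N.
    move=> P Q [N hN] [N' hN']; exists (maxn N N') => y Ay h; split.
      by apply: hN => //; apply: agreeW h; rewrite leq_maxl.
    by apply: hN' => //; apply: agreeW h; rewrite leq_maxr.
  by move=> P Q PQ [N hN]; exists N => y Ay /(hN y Ay) /PQ.
have [x Fx] : exists x : M, F --> x.
  apply: complete; apply: cauchy_exP => e e0.
  have [k hk] : exists k, k.+1%:R^-1 < e.
    by have /ltr_add_invr[k] := e0; rewrite add0r; exists k.
  have [N hN] := h1 0%N k.+1; pose m := a (pickle (1%N, k)).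
  have Sy y : agree N (code y) a -> U m y /\ small k m.
    rewrite /m => /hN /(_ k (ltnSn k)) /= <-.
    by have [] := @firstP _ (fun m => [set y | U m y /\ small k m]) y (smallP k y).
  have [y Ay /Sy[_ [z hz]]] := ha N.
  exists z; exists N => w Aw /Sy[Uw _]; exact: le_ball (ltW hk) _ (hz _ Uw).
have xU n : U n x <-> a0 n <> 0%N.
  have [N hN] := h0 n.+1; split.
    move=> Ux a00; have [N' hN'] : F (U n) by apply: Fx; apply: open_nbhs_nbhs.
    have [y Ay hy] := ha (maxn N N').
    have Uy : U n y by apply: hN' => //; apply: agreeW hy; rewrite leq_maxr.
    have : codeU y n = 0%N.
      by rewrite -a00; apply: (hN y _ n) => //; apply: agreeW hy; rewrite leq_maxl.
    by rewrite /codeU asboolT.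
  case E : (a0 n) => [//|m] _.
  have Sy y : agree N (code y) a -> U m y /\ reg n m.
    by move=> /hN /(_ n (ltnSn n)); rewrite E; exact: codeUP.
  have [y Ay /Sy[_ rnm]] := ha N; apply: rnm => B /Fx[N' hN'].
  have [z Az hz] := ha (maxn N N'); exists z; split.
    by apply: (Sy z _).1; apply: agreeW hz; rewrite leq_maxl.
  by apply: hN' => //; apply: agreeW hz; rewrite leq_maxr.
have yU K : exists N, forall y, agree N (code y) a ->
    forall n, (n < K)%N -> (U n x <-> U n y).
  have [N hN] := h0 K; exists N => y /hN hy n nK.
  by rewrite xU -(hy n nK) /codeU; case: asboolP => Uy; split.
have firstE (Q : nat -> Prop) K : exists N, forall y, agree N (code y) a ->
   (exists m, U m y /\ Q m) ->
   (first (fun m => [set y | U m y /\ Q m]) y < K)%N ->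
   first (fun m => [set y | U m y /\ Q m]) x = first (fun m => [set y | U m y /\ Q m]) y.
  have [N hN] := yU K; exists N => y hy ex.
  have [] := @firstP _ (fun m => [set y | U m y /\ Q m]) y ex.
  move: (first _ y) => f Wf fmin fK; apply: first_eq.
    by case: Wf => Uf Qf; split=> //; apply/(hN y hy f fK).
  move=> j jf [Ux Qj]; apply: (fmin j jf); split=> //.
  by apply/(hN y hy) => //; exact: ltn_trans jf fK.
exists x; split.
- have [N hN] := yU n0.+1; have [y Ay hy] := ha N.
  by apply: hA Ay; split=> /(hN y hy n0 (ltnSn n0)).
- apply: interleave_eq => [[|i] n|N]; last by have [y _ hy] := ha N; eexists; exact: hy.
    have [N hN] := h0 n.+1; rewrite /codeU; case: asboolP => [/xU|].
      rewrite -/(a0 n); case E : (a0 n) => [//|m] _.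
      have [N' hN'] := firstE (reg n) m.+1.
      have [y Ay hy] := ha (maxn N N').
      have cy : codeU y n = m.+1.
        by rewrite -E; apply: (hN y) => //; apply: agreeW hy; rewrite leq_maxl.
      have fy : first (fun m => [set y | U m y /\ reg n m]) y = m.
        by move: cy; rewrite /codeU; case: asboolP => // _ [].
      congr S; rewrite (hN' y) ?fy//; first by apply: agreeW hy; rewrite leq_maxr.
      by exists m; exact: codeUP.
    by move=> nUx; apply: contrapT => /nesym /xU.
  have [N hN] := h1 i n.+1; set f := a _.
  have [N' hN'] := firstE (small n) f.+1.
  have [y Ay hy] := ha (maxn N N').
  have cy : codeS y n = f.
    by apply: (hN y) => //; apply: agreeW hy; rewrite leq_maxl.
  rewrite /codeS (hN' y) -/(codeS y n) ?cy//.
  by apply: agreeW hy; rewrite leq_maxr.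
move=> V oV Vx; have [N hN] : F V by apply: Fx; apply: open_nbhs_nbhs.
by exists N.
Qed.

End Metric.

(** * Projections of sets in the product with sections of bounded size *)

Section Projection.
Context {T : choiceType} (op : set (set T)).
Local Notation bor := (<<s op >>).
Hypothesis hT : op_hausdorff op.
Hypothesis op_union : forall F : set (set T), F `<=` op -> op (\bigcup_(U in F) U).
Hypothesis opT : op setT.
Variable U : nat -> set T.
Hypothesis oU : forall n, op (U n).
Hypothesis bU : forall O x, op O -> O x -> exists2 n, U n x & U n `<=` O.
Hypothesis lU : forall n, bilusin op (U n).
Hypothesis lT : lusin op setT.

Lemma bor_bilusin A : bor A -> bilusin op A.
Proof.
have sl : sigma_algebra setT (bilusin op) by exact: bilusin_sigma.
suff : bor `<=` bilusin op by exact.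
apply: smallest_sub => // O oO.
have -> : O = \bigcup_n (if `[< U n `<=` O >] then U n else set0).
  rewrite eqEsubset; split=> x.
    by move=> /(bU oO)[n Ux UO]; exists n => //; rewrite asboolT.
  by move=> [n _]; case: asboolP => // h /h.
by case: sl => l0 _; apply => n; case: ifP.
Qed.

(** Open rectangles are enough to separate points and to express continuity into the product. *)
Definition op2 : set (set (T * T)) := [set A | exists V W, [/\ op V, op W & A = V `*` W]].

Lemma op2_hausdorff : op_hausdorff op2.
Proof.
move=> [x y] [x' y'] ne; have [E|xx'] := pselect (x = x').
  have /hT[V [W [oV oW Vy Wy VW]]] : y <> y' by move=> E'; apply: ne; rewrite E E'.
  exists (setT `*` V), (setT `*` W); split=> //.
  - by exists setT, V.
  - by exists setT, W.
  - by rewrite -subset0 => -[a b] [[_ /= Vb] [_ /= Wb]]; suff : (V `&` W) b by rewrite VW.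
have [V [W [oV oW Vx Wx VW]]] := hT xx'.
exists (V `*` setT), (W `*` setT); split=> //.
- by exists V, setT.
- by exists W, setT.
- by rewrite -subset0 => -[a b] [[/= Va _] [/= Wa _]]; suff : (V `&` W) a by rewrite VW.
Qed.

Lemma lusinX A B : lusin op A -> lusin op B -> lusin op2 (A `*` B).
Proof.
move=> [c hc] [c' hc'].
pose k (z : T * T) (i : nat) := if i is 0 then c z.1 else c' z.2.
exists (fun z => interleave (k z)) => a ha.
have [|x [Ax cx hx]] := hc (fun n => a (pickle (0%N, n))).
  move=> M; have [N hN] := interleave_agree 0%N M.
  by have [z [Az _] /hN hz] := ha N; exists z.1.
have hB i : exists y, [/\ B y, c' y =1 (fun n => a (pickle (i.+1, n))) &
    forall V, op V -> V y -> exists N, forall z, B z ->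
      agree N (c' z) (fun n => a (pickle (i.+1, n))) -> V z].
  apply: hc' => M; have [N hN] := interleave_agree i.+1 M.
  by have [z [_ Bz] /hN hz] := ha N; exists z.2.
have [y [By cy hy]] := hB 0%N.
exists (x, y); split=> //.
  apply: interleave_eq => [[|i] n|N]; [exact: cx| |].
    rewrite /k /= cy; have [N hN] := interleave_agree 1%N n.+1.
    have [N' hN'] := interleave_agree i.+1 n.+1.
    have [z _ hz] := ha (maxn N N').
    rewrite -(hN (k z) a _ n)//; first last.
      by apply: agreeW hz; rewrite leq_maxl.
    by apply: (hN' (k z) a _ n) => //; apply: agreeW hz; rewrite leq_maxr.
  by have [z _ hz] := ha N; exists (k z).
move=> _ [V [W [oV oW ->]]] [/= Vx Wy].
have [N1 h1] := hx V oV Vx; have [N2 h2] := hy W oW Wy.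
have [M1 g1] := interleave_agree 0%N N1; have [M2 g2] := interleave_agree 1%N N2.
exists (maxn M1 M2) => z [Az Bz] hz; split.
  by apply: h1 => //; apply: (g1 (k z)); apply: agreeW hz; rewrite leq_maxl.
by apply: h2 => //; apply: (g2 (k z)); apply: agreeW hz; rewrite leq_maxr.
Qed.

Definition rect : set (set (T * T)) := [set A `*` B | A in bor & B in bor].
Local Notation bor2 := (<<s rect >>).

Lemma bor2_lusin Q : bor2 Q -> lusin op2 Q.
Proof.
move=> bQ; suff : bor2 `<=` bilusin op2 by move=> /(_ Q bQ)[].
apply: smallest_sub.
  apply: bilusin_sigma; first exact: op2_hausdorff.
  by rewrite -setXTT; apply: lusinX.
move=> _ [A /bor_bilusin[lA lcA] [B /bor_bilusin[lB lcB] <-]].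
split; first exact: lusinX.
pose F (i : nat) := match i with 0 => ~` A `*` setT | 1 => A `*` ~` B | _ => set0 end.
have -> : ~` (A `*` B) = \bigcup_i F i.
  rewrite eqEsubset; split=> -[x y] /=.
    move=> h; have [Ax|nAx] := pselect (A x); last by exists 0%N.
    by exists 1%N => //; split=> // By; apply: h.
  by move=> [[|[|i]] _] //= [h1 h2] [].
apply: lusin_bigcup_disjoint.
  by move=> [|[|i]] [|[|j]] [x y] //= [? ?] [? ?].
by move=> [|[|i]] /=; [exact: lusinX|exact: lusinX|exact: lusin0].
Qed.

Definition section_le (Q : set (T * T)) k := forall x (s : seq T), uniq s ->
  (forall y, y \in s -> Q (x, y)) -> (size s <= k)%N.

Definition cell (b : seq bool) : set T := [set y | forall n, (n < size b)%N ->
  nth false b n = `[< U n y >]].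

Lemma bor_cell b : bor (cell b).
Proof.
have -> : cell b = \bigcap_n (if (n < size b)%N then
    (if nth false b n then U n else ~` U n) else setT).
  rewrite eqEsubset; split=> y h n.
    by move=> _; case: ifP => // nb; rewrite (h n nb); case: asboolP.
  move=> nb; have := h n I; rewrite nb.
  by case: (nth false b n) => h'; [rewrite asboolT|rewrite asboolF].
apply: bor_bigcap => n; case: ifP => _; last exact: borT.
case: ifP => _; last apply: borC; exact: sub_sigma_algebra.
Qed.

Lemma cell_eq b b' y : size b = size b' -> cell b y -> cell b' y -> b = b'.
Proof.
move=> sb h h'; apply: (@eq_from_nth _ false) => // n nb.
by rewrite h// h'// -sb.
Qed.

Definition pattern N y := mkseq (fun n => `[< U n y >]) N.

Lemma cell_pattern N y : cell (pattern N y) y.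
Proof. by move=> n; rewrite size_mkseq => nN; rewrite nth_mkseq. Qed.

Lemma pattern_inj (s : seq T) : exists N, {in s &, injective (pattern N)}.
Proof.
have sep x y : x <> y -> exists n, `[< U n x >] <> `[< U n y >].
  move=> /hT[V [W [oV oW Vx Wy VW]]]; have [n Ux UV] := bU oV Vx.
  exists n; rewrite asboolT// asboolF// => /UV Vy.
  by suff : (V `&` W) y by rewrite VW.
have sep1 x y : exists N, forall M, (N <= M)%N -> pattern M x = pattern M y -> x = y.
  have [->|/sep[n hn]] := pselect (x = y); first by exists 0%N.
  exists n.+1 => M nM E; exfalso; apply: hn.
  by have := congr1 (fun s => nth false s n) E; rewrite !nth_mkseq.
have sep2 x : exists N, forall M y, (N <= M)%N -> y \in s -> pattern M x = pattern M y -> x = y.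
  elim: s => [|z s [N IH]]; first by exists 0%N.
  have [N' h] := sep1 x z; exists (maxn N N') => M y.
  rewrite geq_max inE => /andP[NM N'M] /orP[/eqP ->|ys]; first exact: h.
  exact: IH.
suff [N hN] : exists N, forall x y, x \in s -> y \in s -> pattern N x = pattern N y -> x = y.
  by exists N.
suff [N hN] : exists N, forall M x y, (N <= M)%N -> x \in s -> y \in s -> pattern M x = pattern M y -> x = y.
  by exists N => x y; exact: hN.
move: {1}s => t; elim: t => [|z t [N IH]]; first by exists 0%N.
have [N' h] := sep2 z; exists (maxn N N') => M x y.
rewrite geq_max inE => /andP[NM N'M] /orP[/eqP ->|xt]; first exact: h.
exact: IH.
Qed.

(** The witnesses for all [E i] are determined by [x], so projecting the sequences of witnesses is
    injective and [presentation_borel] applies. *)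
Lemma bor_unique_proj Q (E : nat -> set T) : bor2 Q -> (forall i, bor (E i)) ->
  (forall x, (forall i, exists2 y, E i y & Q (x, y)) ->
     forall i y y', E i y -> E i y' -> Q (x, y) -> Q (x, y') -> y = y') ->
  bor [set x | forall i, exists2 y, E i y & Q (x, y)].
Proof.
move=> bQ bE uniqQ; pose Qi i := Q `&` (setT `*` E i).
have /choice[c hc] : forall i, lusin op2 (Qi i).
  move=> i; apply: bor2_lusin; apply: borI => //; apply: sub_sigma_algebra.
  by exists setT; [exact: borT|exists (E i)].
have hfst V : op V -> op2 (fst @^-1` V).
  by move=> oV; exists V, setT; split=> //; rewrite eqEsubset; split=> -[? ?] // [].
have hp := @presentation_proj _ _ hT _ _ _ _ _ hfst hc.
set Z := (X in presentation _ X _ _) in hp; set p := (X in presentation _ _ X _) in hp.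
have -> : [set x | forall i, exists2 y, E i y & Q (x, y)] = p @` Z.
  rewrite eqEsubset; split=> x.
    move=> h; have /choice[w hw] : forall i, exists y, E i y /\ Q (x, y).
      by move=> i; have [y] := h i; exists y.
    exists (fun i => (x, w i)) => // i; split=> //.
    by have [Ew Qw] := hw i; split.
  move=> [w Zw <-] i; have [[Qw [_ Ew]] wi] := Zw i.
  by exists (w i).2 => //; rewrite /p -wi -surjective_pairing.
have := presentation_borel hT op_union opT hp; apply => w w' Zw Zw' pp.
suff -> : w = w' by [].
apply: funext => i; have [[Qw [_ Ew]] wi] := Zw i; have [[Qw' [_ Ew']] wi'] := Zw' i.
move: wi wi' pp Ew Ew' Qw Qw'; rewrite /p.
case: (w i) => x y /= ->; case: (w' i) => x' y' /= -> <- Ey Ey' Qy Qy'.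
congr pair; apply: (uniqQ (w 0%N).1 _ i) => // j.
have [[Qj [_ Ej]] wj] := Zw j; exists (w j).2 => //.
by rewrite -wj -surjective_pairing.
Qed.

(** A bounded form of the theorem of Lusin and Novikov, by induction on the bound. A section has
    [k.+1] points exactly when it meets [k.+1] different cells of equal length, and then it meets
    each of them once. The points with such sections form the Borel set [DD]; over its complement
    the sections have at most [k] points. *)
Theorem bor_proj k Q : bor2 Q -> section_le Q k -> bor [set x | exists y, Q (x, y)].
Proof.
elim: k Q => [|k IH] Q bQ sQ.
  suff -> : [set x | exists y, Q (x, y)] = set0 by exact: bor0.
  rewrite -subset0 => x [y Qxy]; suff : (size [:: y] <= 0)%N by [].
  by apply: (sQ x) => // z; rewrite inE => /eqP ->.
pose good (bs : seq (seq bool)) := [/\ size bs = k.+1, uniq bs &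
  forall b, b \in bs -> size b = size (head [::] bs)].
(* Indices beyond the list repeat its first cell, because [bor_unique_proj] wants an infinite
   sequence. *)
pose E bs i := cell (nth (head [::] bs) bs i).
pose D bs := [set x | forall i, exists2 y, E bs i y & Q (x, y)].
have bD bs : good bs -> bor (D bs).
  move=> [sbs ubs hbs]; apply: bor_unique_proj => // [i|x hx i y y' Ey Ey' Qy Qy'].
    exact: bor_cell.
  apply: contrapT => yy'.
  have [j jk EE] : exists2 j, (j < k.+1)%N & E bs i = E bs j.
    have [ik|ik] := ltnP i k.+1; first by exists i.
    exists 0%N => //; rewrite /E nth_default ?sbs//.
    by move: sbs; case: (bs).
  rewrite {}EE in Ey Ey'.
  have /choice[w hw] : forall i, exists y, E bs i y /\ Q (x, y).
    by move=> l; have [z] := hx l; exists z.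
  pose v l := if l == j then y else w l.
  have hv l : E bs l (v l) /\ Q (x, v l).
    by rewrite /v; case: eqP => [->|_]; [split|exact: hw].
  have inb l : (l < k.+1)%N -> nth (head [::] bs) bs l \in bs.
    by move=> lk; rewrite mem_nth// sbs.
  have vE l l' z : (l < k.+1)%N -> (l' < k.+1)%N -> E bs l z -> E bs l' z -> l = l'.
    move=> lk l'k El El'; have := cell_eq _ El El'.
    rewrite !hbs ?inb// => /(_ erefl) /eqP.
    by rewrite nth_uniq ?sbs// => /eqP.
  have : (size (y' :: mkseq v k.+1) <= k.+1)%N.
    apply: (sQ x) => [|z].
      rewrite cons_uniq; apply/andP; split; last first.
        apply/mkseq_uniqP => l l'; rewrite !inE => lk l'k vv; apply: (vE _ _ (v l)) => //.
          exact: (hv l).1.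
        by rewrite vv; exact: (hv l').1.
      apply/negP => /mapP[l]; rewrite mem_iota /= add0n => lk y'l.
      have lj : l = j by apply: (vE _ _ y') => //; rewrite y'l; exact: (hv l).1.
      by apply: yy'; rewrite y'l lj /v eqxx.
    by rewrite inE => /orP[/eqP ->//|/mapP[l _ ->]]; exact: (hv l).2.
  by rewrite -cat1s size_cat size_mkseq ltnn.
pose dec n : seq (seq bool) := odflt [::] (unpickle n).
have decK bs : dec (pickle bs) = bs by rewrite /dec pickleK.
move: dec decK => dec decK.
pose DD := \bigcup_n (if `[< good (dec n) >] then D (dec n) else set0).
have bDD : bor DD.
  by apply: bor_bigcup => n; case: asboolP => [/bD//|_]; exact: bor0.
have Dproj : DD `<=` [set x | exists y, Q (x, y)].
  move=> x [n _]; by case: asboolP => // _ /(_ 0%N)[y _ Qxy]; exists y.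
pose Q' := Q `&` (~` DD `*` setT).
have -> : [set x | exists y, Q (x, y)] = DD `|` [set x | exists y, Q' (x, y)].
  rewrite eqEsubset; split=> x.
    move=> [y Qxy]; have [?|nD] := pselect (DD x); first by left.
    by right; exists y.
  by case=> [/Dproj//|[y []]]; exists y.
apply: borU => //; apply: IH => [|x s us sQ'].
  apply: borI => //; apply: sub_sigma_algebra.
  by exists (~` DD); [exact: borC|exists setT => //; exact: borT].
rewrite leqNgt; apply/negP => ks.
have [y ys] : exists y, y \in s by case: s ks {us sQ'} => // y s _; exists y; rewrite mem_head.
have [_ [nD _]] := sQ' _ ys; apply: nD.
pose t := take k.+1 s.
have st : size t = k.+1 by rewrite size_take_min; apply/minn_idPl.
have ut : uniq t by exact: take_uniq.
have ts z : z \in t -> z \in s by exact: mem_take.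
have [N injN] := pattern_inj t.
exists (pickle (map (pattern N) t)) => //.
have gt : good (map (pattern N) t).
  split; rewrite ?size_map ?st// ?map_inj_in_uniq//.
  move=> b /mapP[z zt ->]; rewrite size_mkseq.
  by case: (t) zt => //= a l _; rewrite size_mkseq.
rewrite decK asboolT// => i.
have [z zt zi] : exists2 z, z \in t &
   nth (head [::] (map (pattern N) t)) (map (pattern N) t) i = pattern N z.
  have : nth (head [::] (map (pattern N) t)) (map (pattern N) t) i \in map (pattern N) t.
    have [ik|ik] := ltnP i (size (map (pattern N) t)); first exact: mem_nth.
    rewrite nth_default//; case: (t) st => //= a l _; exact: mem_head.
  by move=> /mapP[z zt ->]; exists z.
exists z; first by rewrite /E zi; exact: cell_pattern.
by have [] := sQ' z (ts _ zt).
Qed.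

End Projection.

(** * Measurability along the edges *)

(* The data shared by the Borel sigma-algebra and its later enlargement: nb x
   lists the neighbors of x, U is a countable family in S separating points
   from finite sets, and the maps g i send x to itself or to a neighbor and
   together reach every neighbor. *)
Record local_graph (X : choiceType) (e : rel X) (nb : X -> seq X) (d : nat)
    (U : nat -> set X) (g : nat -> X -> X) (S : set (set X)) : Prop := LocalGraph {
  lg_sigma : sigma_algebra setT S;
  lg_sym : symmetric e;
  lg_irr : irreflexive e;
  lg_nb : forall x y, (y \in nb x) = e x y;
  lg_uniq : forall x, uniq (nb x);
  lg_size : forall x, (size (nb x) <= d)%N;
  lg_U : forall n, S (U n);
  lg_sep : forall x (s : seq X), x \notin s -> exists n, U n x /\ forall y, y \in s -> ~ U n y;
  lg_g : forall i A, S A -> S (g i @^-1` A);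
  lg_ge : forall x y, e x y -> exists i, g i x = y;
  lg_eg : forall i x, g i x = x \/ e x (g i x);
  lg_e : forall i, S [set x | e x (g i x)] }.

Definition gw {X : Type} (g : nat -> X -> X) (w : seq nat) (x : X) := foldr g x w.

Lemma gw_cat {X : Type} (g : nat -> X -> X) v w x : gw g v (gw g w x) = gw g (v ++ w) x.
Proof. by rewrite /gw foldr_cat. Qed.

Definition word_of (n : nat) : seq nat := odflt [::] (unpickle n).

Lemma word_ofK w : word_of (pickle w) = w.
Proof. by rewrite /word_of pickleK. Qed.

(** * Closure rules for measurable predicates *)

Section Calculus.
Context {X : choiceType} (e : rel X) (nb : X -> seq X) (d : nat)
  (U : nat -> set X) (g : nat -> X -> X) (S : set (set X)).
Hypothesis HG : local_graph e nb d U g S.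
Local Notation gw := (gw g).

Definition conn x y := exists w, gw w x = y.

Lemma conn_refl x : conn x x. Proof. by exists [::]. Qed.

Lemma conn_trans x y z : conn x y -> conn y z -> conn x z.
Proof. by move=> [u <-] [v <-]; exists (v ++ u); rewrite gw_cat. Qed.

Lemma conn_edge x y : e x y -> conn x y.
Proof. by move=> exy; have [i gi] := lg_ge HG exy; exists [:: i]. Qed.

Lemma conn_gw x u : conn x (gw u x). Proof. by exists u. Qed.

Lemma conn_sym x y : conn x y -> conn y x.
Proof.
move=> [w <-]; elim: w => [|i w IH] /=; first exact: conn_refl.
apply: conn_trans IH; have [-> |exg] := lg_eg HG i (gw w x); first exact: conn_refl.
by apply: conn_edge; rewrite (lg_sym HG).
Qed.

Lemma M_ext (P Q : X -> Prop) : (forall x, P x <-> Q x) -> S P -> S Q.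
Proof. by move=> PQ; suff -> : P = Q by []; apply: funext => x; apply: propext. Qed.

Lemma M_not (P : X -> Prop) : S P -> S (fun x => ~ P x).
Proof. by case: (lg_sigma HG) => _ h _ /h; rewrite setTD. Qed.

Lemma M_exc (I : countType) (P : I -> X -> Prop) :
  (forall i, S (P i)) -> S (fun x => exists i, P i x).
Proof.
case: (lg_sigma HG) => S0 _ hU hP.
pose F n := if (unpickle n : option I) is Some i then P i else set0.
suff : S (\bigcup_n F n).
  apply: M_ext => x; split=> [[n _]|[i Pi]].
    by rewrite /F; case: unpickle => // i Pix; exists i.
  by exists (pickle i); rewrite /F ?pickleK.
by apply: hU => n; rewrite /F; case: unpickle.
Qed.

Lemma M_const (A : Prop) : S (fun=> A).
Proof.
case: (lg_sigma HG) => S0 _ _; have [h|h] := pselect A.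
  by apply: (@M_ext (fun x => ~ set0 x)); [move=> x; split=> // _ []|exact: M_not].
by apply: (@M_ext set0).
Qed.

Lemma M_allc (I : countType) (P : I -> X -> Prop) :
  (forall i, S (P i)) -> S (fun x => forall i, P i x).
Proof.
move=> hP; apply: (@M_ext (fun x => ~ exists i, ~ P i x)) => [x|].
  by split=> [h i|h [i]]; [apply: contrapT => hi; apply: h; exists i|apply].
by apply: M_not; apply: M_exc => i; apply: M_not.
Qed.

Lemma M_and (P Q : X -> Prop) : S P -> S Q -> S (fun x => P x /\ Q x).
Proof.
move=> hP hQ; apply: (@M_ext (fun x => forall b : bool, (if b then P else Q) x)) => [x|].
  by split=> [h|[? ?] []//]; split; [exact: (h true)|exact: (h false)].
by apply: M_allc => -[].
Qed.

Lemma M_and3 (P Q P' : X -> Prop) : S P -> S Q -> S P' ->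
  S (fun x => [/\ P x, Q x & P' x]).
Proof.
move=> hP hQ hP'; apply: (@M_ext (fun x => P x /\ Q x /\ P' x)); last by do 2 apply: M_and => //.
by move=> x; split=> [[? []]|[]].
Qed.

Lemma M_and4 (P Q P' Q' : X -> Prop) : S P -> S Q -> S P' -> S Q' ->
  S (fun x => [/\ P x, Q x, P' x & Q' x]).
Proof.
move=> hP hQ hP' hQ'; apply: (@M_ext (fun x => P x /\ Q x /\ P' x /\ Q' x)).
  by move=> x; split=> [[? [? []]]|[]].
by do 3 apply: M_and => //.
Qed.

Lemma M_or (P Q : X -> Prop) : S P -> S Q -> S (fun x => P x \/ Q x).
Proof.
move=> hP hQ; apply: (@M_ext (fun x => exists b : bool, (if b then P else Q) x)) => [x|].
  by split=> [[[] h]|[h|h]]; [left|right|exists true|exists false].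
by apply: M_exc => -[].
Qed.

Lemma M_imp (P Q : X -> Prop) : S P -> S Q -> S (fun x => P x -> Q x).
Proof.
move=> hP hQ; apply: (@M_ext (fun x => ~ P x \/ Q x)) => [x|].
  by split=> [[]//|h]; have [/h|] := pselect (P x); [right|left].
by apply: M_or => //; apply: M_not.
Qed.

Lemma M_iff (P Q : X -> Prop) : S P -> S Q -> S (fun x => P x <-> Q x).
Proof. by move=> hP hQ; apply: M_and; apply: M_imp. Qed.

Lemma M_gw (P : X -> Prop) u : S P -> S (fun x => P (gw u x)).
Proof.
elim: u P => [|i u IH] P hP //=.
exact: (IH (fun y => P (g i y)) (lg_g HG i hP)).
Qed.

Lemma U_sep x y : x <> y -> exists n, U n x /\ ~ U n y.
Proof.
move=> /eqP xy; have [|n [Ux Uy]] := lg_sep HG (x := x) (s := [:: y]).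
  by rewrite inE.
by exists n; split=> //; apply: Uy; rewrite inE.
Qed.

Lemma M_eq u v : S (fun x => gw u x = gw v x).
Proof.
apply: (@M_ext (fun x => forall n, U n (gw u x) <-> U n (gw v x))) => [x|].
  split=> [h|-> //]; apply: contrapT => /U_sep[n [h1 h2]].
  by apply: h2; apply/h.
by apply: M_allc => n; apply: M_iff; apply: M_gw; exact: (lg_U HG).
Qed.

Lemma M_e u v : S (fun x => e (gw u x) (gw v x)).
Proof.
apply: (@M_ext (fun x => exists i, gw v x = gw (i :: u) x /\ e (gw u x) (gw (i :: u) x))).
  move=> x; split=> [[i [-> //]]|h].
  by have [i gi] := lg_ge HG h; exists i; rewrite /= gi.
apply: M_exc => i; apply: M_and; first exact: M_eq.
exact: (M_gw u (lg_e HG i)).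
Qed.

(** A point of the component of [x] is [gw w x] for one of countably many words [w], so this
    quantifier is a countable union. *)
Lemma M_ex (Q : X -> X -> Prop) : (forall x z, Q x z -> conn x z) ->
  (forall w, S (fun x => Q x (gw w x))) -> S (fun x => exists z, Q x z).
Proof.
move=> Qc hQ; apply: (@M_ext (fun x => exists w, Q x (gw w x))); last exact: M_exc.
move=> x; split=> [[w Qw]|[z Qxz]]; first by exists (gw w x).
by have [w wz] := Qc _ _ Qxz; exists w; rewrite wz.
Qed.

Lemma M_all (Q : X -> X -> Prop) : (forall x z, ~ Q x z -> conn x z) ->
  (forall w, S (fun x => Q x (gw w x))) -> S (fun x => forall z, Q x z).
Proof.
move=> Qc hQ; apply: (@M_ext (fun x => ~ exists z, ~ Q x z)) => [x|].
  by split=> [h i|h [i]]; [apply: contrapT => hi; apply: h; exists i|apply].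
by apply: M_not; apply: M_ex => // w; apply: M_not.
Qed.

(** Testing the relation on pairs of words replaces a sigma-algebra on pairs of points. *)
Definition local_meas (H : X -> X -> Prop) := forall u v, S (fun x => H (gw u x) (gw v x)).

Lemma M_fun_eq (I : countType) (f : X -> I) (P : I -> X -> Prop) :
  (forall i, S (fun x => f x = i)) -> (forall i, S (P i)) -> S (fun x => P (f x) x).
Proof.
move=> hf hP; apply: (@M_ext (fun x => exists i, f x = i /\ P i x)) => [x|].
  by split=> [[i [<-]]//|h]; exists (f x).
by apply: M_exc => i; apply: M_and.
Qed.

End Calculus.

Ltac meas HG :=
  repeat first
    [ assumption
    | apply: (M_const HG)
    | apply: (M_eq HG) | apply: (M_e HG)
    | match goal with
      | H : local_meas _ _ _ |- _ => exact: H
      end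
    | match goal with
      | H : is_true (_ _) |- _ => fail 1
      | H : ?S ?P |- ?S (fun x => ?P (gw _ _ x)) => exact: (M_gw HG _ H)
      end
    | apply: (M_and HG) | apply: (M_or HG) | apply: (M_not HG) | apply: (M_imp HG)
    | apply: (M_iff HG)
    | apply: (M_exc HG) => ? | apply: (M_allc HG) => ? ].

Lemma polish_structure (R : realType) (T : topologicalType) :
  polish T R -> inhabited T -> exists U : nat -> set T,
  [/\ (forall n, open (U n)),
      (forall O x, open O -> O x -> exists2 n, U n x & U n `<=` O),
      op_hausdorff (@open T), (forall n, bilusin (@open T) (U n)) &
      lusin (@open T) setT].
Proof.
move=> [[D cD dD] [m mE mC]] iT; rewrite /dense -mE in dD *.
pose M : metricType R := Metric.Pack m.
have sM : separable (T := M) by exists D.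
have [U [oU bU]] := metric_base sM iT.
exists U; split=> //.
- move=> x y xy; apply: contrapT => h; apply: xy.
  apply: (@metric_hausdorff R M) => A B; rewrite nbhsE => -[V [oV Vx] VA].
  rewrite nbhsE => -[W [oW Wy] WB]; apply: contrapT => /set0P/negP/negPn/eqP AB.
  apply: h; exists V, W; split=> //; rewrite -subset0 => z [/VA Az /WB Bz].
  by rewrite -AB.
- move=> n; split; apply: (decided_lusin mC oU bU (n0 := n)) => x y h.
    by move/h.
  by move=> /= nU /h.
- exact: (decided_lusin mC oU bU (n0 := 0%N)).
Qed.

(** * Borel functions that enumerate the neighbors *)

Section Neighbors.
Context (R : realType) (disp : measure_display) (X : measurableType disp) (d : nat)
  (G : set (X * X)).
Hypotheses (hX : standard_borel R X) (hG : borel_graph G) (hdeg : max_degree_le G d).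

Definition adj : rel X := fun x y => `[< G (x, y) >].

Lemma neighbor_list : exists nb : X -> seq X, forall x,
  [/\ uniq (nb x), (forall y, (y \in nb x) = adj x y) & (size (nb x) <= d)%N].
Proof.
suff /choice[nb hnb] : forall x, exists s : seq X,
    [/\ uniq s, (forall y, (y \in s) = adj x y) & (size s <= d)%N] by exists nb.
move=> x.
have fN : finite_set (neighbors G x).
  exact: card_le_finite (hdeg x) (finite_II d).
have /finite_setP[n hn] := fN.
exists (finmap.enum_fset (fset_set (neighbors G x))); split; first exact: finmap.fset_uniq.
  by move=> y; rewrite in_fset_set// inE.
by rewrite (card_fset_set hn) -card_le_II -(card_le_eql hn).
Qed.

Lemma standard_borel_base : exists U : nat -> set X,
  [/\ (forall n, measurable (U n)),
      (forall x (s : seq X), x \notin s -> exists n, U n x /\ forall y, y \in s -> ~ U n y) &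
      forall k Q, measurable Q -> section_le Q k ->
        measurable [set x : X | exists y : X, Q (x, y)]].
Proof.
have [tau [polX borX]] := hX.
have [U [oU bU hT lU lT]] := polish_structure polX (inhabits point).
pose T := Topological.Pack tau.
exists U; split.
- by move=> n; rewrite -borX; apply: sub_sigma_algebra.
- move=> x s xs.
  have [V0 [oO Ox Os]] : exists V0 : set T, [/\ open V0, V0 x & forall y, y \in s -> ~ V0 y].

    elim: s xs => [|y s IH]; first by exists setT; split=> //; exact: openT.
    rewrite inE negb_or => /andP[/eqP xy /IH[V0 [oO Ox Os]]].
    have [V [W [oV oW Vx Wy VW]]] := hT _ _ xy.
    exists (V0 `&` V); split=> //; first exact: openI.
    move=> z; rewrite inE => /orP[/eqP ->|/Os h []//] [_ Vy].
    by suff : (V `&` W) y by rewrite VW.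
  by have [n Un UO] := bU _ _ oO Ox; exists n; split=> // y /Os h /UO.
- move=> k Q mQ sQ; rewrite -borX.
  apply: (@bor_proj T (@open T) hT _ _ U oU bU lU lT k) => //.
  + by move=> F hF; apply: bigcup_open.
  + exact: openT.
  + move: mQ; rewrite measurable_prod_measurableType /rect -borX.
    exact: sub_smallest2r.
  + (* T and X carry the same points but unrelated decidable equalities *)
    have memTX (y : X) (s : seq X) : y \in s -> (y : T) \in (s : seq T).
      elim: s => // z s IH; rewrite in_cons => /orP[/eqP ->|/IH ys].
        by rewrite in_cons eqxx.
      by rewrite in_cons ys orbT.
    move=> x s us hs; apply: (sQ x) => [|y /memTX]; last exact: hs.
    elim: s us {hs} => //= y s IH /andP[ys /IH ->]; rewrite andbT.
    by apply: contra ys => /memTX.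
Qed.

(** [g n x] is the neighbor of [x] in [U n] if there is exactly one, and [x] otherwise. Every
    neighbor is reached, as some [U n] separates it from the others; and a second neighbor in [U n]
    is detected by a set [U m] that separates the two, so the domain [P n] is Borel. *)
Theorem borel_local_graph : exists nb U g, local_graph adj nb d U g (@measurable _ X).
Proof.
have [nb hnb] := neighbor_list.
have [U [mU sU proj]] := standard_borel_base.
have nbE x y : (y \in nb x) = adj x y by case: (hnb x).
pose N (B : set X) := [set x | exists y, G (x, y) /\ B y].
have mN B : measurable B -> measurable (N B).
  move=> mB.
  have -> : N B = [set x | exists y, (G `&` (setT `*` B)) (x, y)].
    by rewrite eqEsubset; split=> x [y]; [case=> ? ?|case=> ? []]; exists y.
  apply: (proj d).
    by apply: measurableI; [exact: hG.1|exact: measurableX].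
  move=> x s us hs; have [_ _] := hnb x; apply: leq_trans.
  apply: uniq_leq_size => // y /hs[Gxy _]; rewrite nbE; exact/asboolP.
pose uq n x y := [/\ G (x, y), U n y & forall z, G (x, z) -> U n z -> z = y].
pose P n := [set x | exists y, uq n x y].
have mP n : measurable (P n).
  have -> : P n = N (U n) `\` \bigcup_m (N (U n `&` U m) `&` N (U n `&` ~` U m)).
    rewrite eqEsubset; split=> x.
      move=> [y [Gxy Uy hy]]; split; first by exists y.
      move=> [m _ [[z [Gz [Uz mz]]] [z' [Gz' [Uz' mz']]]]].
      by apply: mz'; rewrite (hy z')// -(hy z).
    move=> [[y [Gxy Uy]] h]; exists y; split=> // z Gz Uz.
    apply: contrapT => /eqP zy.
    have [|m [mz my]] := sU z [:: y]; first by rewrite inE.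
    apply: h; exists m => //; split; [by exists z|exists y; split=> //; split=> //].
    by apply: my; rewrite inE.
  apply: measurableD; first exact: mN.
  by apply: bigcupT_measurable => m; apply: measurableI; apply: mN;
    apply: measurableI => //; apply: measurableC.
pose g n x := xget x [set y | uq n x y].
have gE n x y : uq n x y -> g n x = y.
  move=> h; have [_ _ hy] := h.
  have [Gg Ug _] := @xgetPex _ x [set y | uq n x y] (ex_intro _ y h).
  exact: hy.
have gN n x : ~ P n x -> g n x = x.
  by move=> h; apply: xgetPN => y hy; apply: h; exists y.
have adjG x y : adj x y <-> G (x, y) by split; [move/asboolP|move=> ?; apply/asboolP].
exists nb, U, g; split=> //.
- exact: sigma_algebra_measurable.
- by move=> x y; apply/idP/idP => /adjG h; apply/adjG; apply: hG.2.1.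
- by move=> x; apply/negP => /adjG; exact: hG.2.2.
- by move=> x; case: (hnb x).
- by move=> x; case: (hnb x).
- move=> n A mA.
  have -> : g n @^-1` A = (P n `&` N (U n `&` A)) `|` (~` P n `&` A).
    rewrite eqEsubset; split=> x.
      move=> /= gA; have [Px|nP] := pselect (P n x); last by right; rewrite (gN n x) in gA.
      left; split=> //; have [y hy] := Px; rewrite (gE _ _ _ hy) in gA.
      by case: hy => Gxy Uy _; exists y.
    move=> [[[y hy] [z [Gz [Uz Az]]]]|[nP Ax]] /=; last by rewrite gN.
    by rewrite (gE _ _ _ hy); case: hy => _ _ h; rewrite -(h z).
  apply: measurableU; apply: measurableI => //; last exact: measurableC.
  by apply: mN; apply: measurableI.
- move=> x y /adjG Gxy.
  have [|n [Uy hn]] := sU y [seq z <- nb x | z != y]; first by rewrite mem_filter eqxx.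
  exists n; apply: gE; split=> // z Gz Uz; apply/eqP/negPn/negP => zy.
  by apply: (hn z) => //; rewrite mem_filter zy nbE; apply/adjG.
- move=> n x; have [[y hy]|nP] := pselect (P n x); last by left; exact: gN.
  by right; rewrite (gE _ _ _ hy); case: hy => /adjG.
- move=> n; suff -> : [set x | adj x (g n x)] = P n by [].
  rewrite eqEsubset; split=> x.
    move=> /adjG Gg; apply: contrapT => /gN gx.
    by rewrite gx in Gg; exact: hG.2.2 Gg.
  by move=> [y hy] /=; rewrite (gE _ _ _ hy); case: hy => /adjG.
Qed.

End Neighbors.

(** * Measurable ranks and greedy colorings *)

Section Greedy.
Context {X : choiceType} (e : rel X) (nb : X -> seq X) (d : nat)
  (U : nat -> set X) (g : nat -> X -> X) (S : set (set X)).
Hypothesis HG : local_graph e nb d U g S.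
Local Notation gw := (gw g).
Local Notation conn := (conn g).

Definition meas_nat (f : X -> nat) := forall n, S (fun x => f x = n).

Lemma M_first (W : nat -> X -> Prop) : (forall n, S (W n)) -> meas_nat (first W).
Proof.
move=> hW k; apply: (M_ext (P := fun x => (W k x /\ forall j, (j < k)%N -> ~ W j x) \/
   (k = 0%N /\ ~ exists m, W m x))); last by meas HG.
move=> x; split=> [[[Wk h]|[-> h]]|<-].
- exact: first_eq.
- exact: first0.
have [h|h] := pselect (exists m, W m x); first by left; exact: firstP.
by right; rewrite first0.
Qed.

Lemma M_nat_gw f u n : meas_nat f -> S (fun x => f (gw u x) = n).
Proof. by move=> mf; exact: (M_gw HG u (mf n)). Qed.

Lemma M_nat_rel f (P : nat -> nat -> Prop) u v : meas_nat f ->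
  S (fun x => P (f (gw u x)) (f (gw v x))).
Proof.
move=> mf; apply: (M_fun_eq HG (P := fun i x => P i (f (gw v x)))) => [i|i].
  exact: M_nat_gw.
apply: (M_fun_eq HG (P := fun j x => P i j)) => [j|j]; first exact: M_nat_gw.
exact: (M_const HG).
Qed.

(** [A n] holds at the vertices of height less than [n]. As a vertex has finitely many predecessors,
    their heights are bounded, and by well-founded induction every height is finite. *)
Lemma rank_exists (lt : X -> X -> Prop) : (forall x y, lt y x -> e x y) ->
  local_meas g S lt -> well_founded lt ->
  exists2 rho : X -> nat, meas_nat rho & forall x y, lt y x -> (rho y < rho x)%N.
Proof.
move=> lte mlt wf.
pose A := fix A n x := if n is m.+1 then forall y, lt y x -> A m y else False.
have AS n x : A n x -> A n.+1 x.
  by elim: n x => //= n IH x h y yx; apply: IH; exact: h.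
have AW n m x : (n <= m)%N -> A n x -> A m x.
  by move=> /subnK <-; elim: (m - n)%N => //= k IH /IH/AS.
have mA n : S (A n).
  elim: n => [|n IH]; first exact: (M_const HG).
  apply: (M_all HG) => [x z h|w].
    by apply: (conn_edge HG); apply: lte; apply: contrapT => nl; apply: h.
  by apply: (M_imp HG); [exact: (mlt w [::])|exact: (M_gw HG w IH)].
have ex x : exists n, A n x.
  elim/(well_founded_ind wf): x => x IH.
  suff [n hn] : exists n, forall y, y \in nb x -> lt y x -> A n y.
    by exists n.+1 => y yx; apply: hn => //; rewrite (lg_nb HG); exact: lte.
  elim: (nb x) => [|y s [n hn]]; first by exists 0%N.
  have [/IH[m Am]|ny] := pselect (lt y x).
    exists (maxn n m) => z; rewrite inE => /orP[/eqP -> _|zs zx].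
      by apply: AW Am; rewrite leq_maxr.
    by apply: AW (hn z zs zx); rewrite leq_maxl.
  by exists n => z; rewrite inE => /orP[/eqP ->|] //; exact: hn.
exists (first A); first exact: M_first.
move=> x y yx; have [Ax _] := firstP (ex x); have [_ ymin] := firstP (ex y).
case: (first A x) Ax => //= m h; rewrite ltnNge; apply/negP => my.
exact: ymin my (h _ yx).
Qed.

Lemma greedy_coloring (Q : X -> X -> Prop) (Z : X -> Prop) (rho : X -> nat) K :
  local_meas g S Q -> (forall x y, Q x y -> conn x y) -> S Z -> meas_nat rho ->
  (forall x, Z x -> exists2 s : seq X, (size s < K)%N &
     forall y, Z y -> Q x y -> (rho y < rho x)%N -> y \in s) ->
  exists2 c : X -> nat, meas_nat c & (forall x, Z x -> (c x < K)%N) /\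
    forall x y, Z x -> Z y -> Q x y -> Q y x -> rho x <> rho y -> c x <> c y.
Proof.
move=> mQ Qconn mZ mrho hs.
pose W (f : X -> nat) n k x := forall y, Z y /\ Q x y /\ (rho y < n)%N -> f y <> k.
pose C := fix C n x := if n is m.+1 then
   (if rho x == m then first (W (C m) m) x else C m x) else 0%N.
have CE n x : (rho x < n)%N -> C n x = C (rho x).+1 x.
  elim: n => // n IH; rewrite ltnS leq_eqVlt => /orP[/eqP <-//|h].
  by rewrite /= [rho x == n](ltn_eqF h) IH.
have mW f n k : meas_nat f -> S (W f n k).
  move=> mf; apply: (M_all HG) => [x z h|w].
    by apply: Qconn; apply: contrapT => nQ; apply: h => -[_ []].
  apply: (M_imp HG); last by apply: (M_not HG); exact: M_nat_gw.
  apply: (M_and HG); first exact: (M_gw HG w mZ).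
  apply: (M_and HG); first exact: (mQ [::] w).
  apply: (M_fun_eq HG (P := fun j x => (j < n)%N)) => j; first exact: M_nat_gw.
  exact: (M_const HG).
have mC n : meas_nat (C n).
  elim: n => [|n IH] k /=; first exact: (M_const HG).
  apply: (M_ext (P := fun x => (rho x = n /\ first (W (C n) n) x = k) \/
                              (rho x <> n /\ C n x = k))).
    by move=> x; case: eqP => h; split=> [[[]|[]]|?] //; [left|right].
  apply: (M_or HG); apply: (M_and HG) => //.
  - by apply: M_first => j; exact: mW.
  - exact: (M_not HG).
have cE x : C (rho x).+1 x = first (W (fun y => C (rho y).+1 y) (rho x)) x.
  rewrite /= eqxx; congr first; apply: funext => k; apply: funext => z.
  apply: propext; split=> h y [Zy [Qy yx]]; have := h y (conj Zy (conj Qy yx));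
  by rewrite (CE (rho x) y yx).
pose c x := C (rho x).+1 x.
have cfree x : Z x -> exists2 k, (k < K)%N & W c (rho x) k x.
  move=> Zx; have [s sK hsx] := hs x Zx.
  have [k kK ks] : exists2 k, (k < K)%N & k \notin map c s.
    apply: contrapT => h; have : (K <= size s)%N.
      rewrite -(size_map c) -(size_iota 0 K); apply: uniq_leq_size => [|k].
        exact: iota_uniq.
      rewrite mem_iota add0n => kK; apply/negPn/negP => ks; apply: h; by exists k.
    by rewrite leqNgt sK.
  exists k => // y [Zy [Qy yx]] cyk; move/negP: ks; apply.
  by rewrite -cyk map_f// hsx.
exists c => [k|].
  apply: (M_ext (P := fun x => exists n, rho x = n /\ C n.+1 x = k)).
    by move=> x; split=> [[n [<-]]//|<-]; exists (rho x).
  by apply: (M_exc HG) => n; apply: (M_and HG) => //; exact: mC.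
have cW x : Z x -> W c (rho x) (c x) x.
  move=> /cfree[k _ Wk]; rewrite /c cE.
  by have [] := firstP (ex_intro (fun k => W c (rho x) k x) k Wk).
split=> [x Zx|x y Zx Zy Qxy Qyx].
  have [k kK Wk] := cfree x Zx; apply: leq_ltn_trans kK.
  rewrite /c cE leqNgt; apply/negP => kc.
  by have [_ /(_ k kc)] := firstP (ex_intro (fun k => W c (rho x) k x) k Wk).
case: (ltngtP (rho x) (rho y)) => // h _; first exact: (cW y Zy).
by apply/nesym; exact: (cW x Zx).
Qed.

(** Color [x] by the first [U n] that contains it and none of its other [Q]-neighbors. *)
Lemma countable_coloring (Q : X -> X -> Prop) (nbQ : X -> seq X) :
  local_meas g S Q -> (forall x y, Q x y -> conn x y) ->
  (forall x y, Q x y -> y \in nbQ x) ->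
  exists2 c : X -> nat, meas_nat c &
    forall x y, Q x y -> x <> y -> c x <> c y.
Proof.
move=> mQ Qconn Qnb.
pose W n x := U n x /\ forall y, Q x y /\ x <> y -> ~ U n y.
have ex x : exists n, W n x.
  have [|n [Ux hn]] := lg_sep HG (x := x) (s := [seq y <- nbQ x | y != x]).
    by rewrite mem_filter eqxx.
  exists n; split=> // y [Qy /nesym/eqP xy]; apply: hn.
  by rewrite mem_filter xy Qnb.
exists (first W).
  apply: M_first => n; apply: (M_and HG); first exact: (lg_U HG).
  apply: (M_all HG) => [x z h|w].
    by apply: Qconn; apply: contrapT => nQ; apply: h => -[].
  apply: (M_imp HG); last by apply: (M_not HG); exact: (M_gw HG w (lg_U HG n)).
  apply: (M_and HG); first exact: (mQ [::] w).
  by apply: (M_not HG); exact: (M_eq HG [::] w).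
move=> x y Qxy xy E; have [[_ hx] _] := firstP (ex x); have [[Uy _] _] := firstP (ex y).
by apply: (hx y) => //; rewrite E.
Qed.

Lemma finite_coloring (Q : X -> X -> Prop) (nbQ : X -> seq X) D :
  local_meas g S Q -> (forall x y, Q x y -> conn x y) ->
  (forall x y, Q x y -> y \in nbQ x) -> (forall x y, Q x y -> Q y x) ->
  (forall x, (size (nbQ x) <= D)%N) ->
  exists2 c : X -> nat, meas_nat c & (forall x, (c x < D.+1)%N) /\
    forall x y, Q x y -> x <> y -> c x <> c y.
Proof.
move=> mQ Qconn Qnb Qsym sD; have [rho mrho hrho] := countable_coloring mQ Qconn Qnb.
have [|c mc [cD hc]] := greedy_coloring mQ Qconn (M_const HG True) mrho (K := D.+1).
  by move=> x _; exists (nbQ x) => [|y _ /Qnb]; rewrite ?ltnS.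
exists c => //; split=> [x|x y Qxy xy]; first exact: cD.
by apply: hc => //; [exact: Qsym|exact: hrho].
Qed.

(* Color along the flow: a vertex of Z of degree d still has an uncolored
   neighbor when its turn comes. *)
Lemma flow_coloring (Z : X -> Prop) (flow : X -> X -> Prop) :
  S Z -> local_meas g S flow -> (forall x y, flow x y -> e x y) ->
  well_founded flow ->
  (forall x, Z x -> (size (nb x) < d)%N \/ exists2 y, e x y & ~ Z y \/ flow x y) ->
  exists2 c : X -> nat, meas_nat c & (forall x, Z x -> (c x < d)%N) /\
    forall x y, Z x -> Z y -> e x y -> c x <> c y.
Proof.
move=> mZ mflow fe wf later.
have [h mh hh] := rank_exists (fun x y yx => etrans (lg_sym HG x y) (fe _ _ yx)) mflow wf.
have me : local_meas g S e by move=> u v; exact: (M_e HG).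
have ec x y : e x y -> conn x y by exact: (conn_edge HG).
have [c0 mc0 hc0] := countable_coloring me ec (fun x y xy => etrans (lg_nb HG x y) xy).
pose lt y x := e x y /\ ((h y < h x)%N \/ h y = h x /\ (c0 y < c0 x)%N).
have [rho mrho hrho] : exists2 rho : X -> nat, meas_nat rho &
    forall x y, lt y x -> (rho y < rho x)%N.
  apply: rank_exists => [x y []//|u v|].
    apply: (M_and HG); first exact: (M_e HG).
    apply: (M_or HG); first exact: (M_nat_rel (fun a b => is_true (a < b)%N) u v mh).
    apply: (M_and HG); first exact: (M_nat_rel eq u v mh).
    exact: (M_nat_rel (fun a b => is_true (a < b)%N) u v mc0).
  suff acc n m x : (h x < n)%N -> (c0 x < m)%N -> Acc lt x.
    by move=> x; exact: (acc (h x).+1 (c0 x).+1).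
  elim: n m x => [m x|n IHn]; first by rewrite ltn0.
  elim=> [x _|m IHm x hn cm]; first by rewrite ltn0.
  constructor=> y [_ [yx|[yx cyx]]].
    by apply: (IHn (c0 y).+1 y _ (ltnSn _)); exact: leq_trans yx hn.
  by apply: IHm; [rewrite yx|exact: leq_trans cyx cm].
have [|c mc [cd hc]] := greedy_coloring me ec mZ mrho (K := d).
  move=> x Zx; have [sd|[y xy hy]] := later x Zx.
    by exists (nb x) => // y _ xy _; rewrite (lg_nb HG).
  exists (rem y (nb x)).
    have yx : y \in nb x by rewrite (lg_nb HG).
    rewrite size_rem//; apply: leq_trans (lg_size HG x).
    by case: (nb x) yx => //= *; rewrite ltnS.
  move=> z Zz xz zx; rewrite (rem_filter _ (lg_uniq HG x)) mem_filter (lg_nb HG).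
  apply/andP; split=> //; apply/eqP => zy; subst z.
  case: hy => // /hh hxy; have : (rho x < rho y)%N.
    by apply: hrho; split; [rewrite (lg_sym HG)|left].
  by rewrite ltnNge ltnW.
exists c => //; split=> // x y Zx Zy xy; apply: hc => //; first by rewrite (lg_sym HG).
have xy' : x <> y by move=> E; rewrite E (lg_irr HG) in xy.
have yx : e y x by rewrite (lg_sym HG).
move=> E; case: (ltngtP (h x) (h y)) => hxy.
- by have := hrho y x (conj yx (or_introl hxy)); rewrite E ltnn.
- by have := hrho x y (conj xy (or_introl hxy)); rewrite E ltnn.
case: (ltngtP (c0 x) (c0 y)) => cxy.
- by have := hrho y x (conj yx (or_intror (conj hxy cxy))); rewrite E ltnn.
- by have := hrho x y (conj xy (or_intror (conj (esym hxy) cxy))); rewrite E ltnn.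
exact: hc0 xy xy' cxy.
Qed.

End Greedy.

(** * Pruning sequences *)

(* Among N sets D covering L, a selector picks, for each of countably many
   tests, one that is large relative to L.  If a decreasing sequence of sets L n
   passes every test infinitely often with sets D n such that each point is in
   finitely many of them, then the intersection of the L n is negligible, and so
   are its preimages under the maps gw g w. *)
Definition selector (X : Type) (g : nat -> X -> X) (S : set (set X))
    (null : set X -> Prop) (N : nat) (sel : nat -> set X -> set X -> Prop) :=
  (forall j (L : set X) (D : nat -> set X), S L -> (forall i, S (D i)) ->
     L `<=` \bigcup_(i in [set i | (i < N)%N]) D i ->
     exists2 i, (i < N)%N & sel j L (D i)) /\
  (forall L D : nat -> set X, (forall n, S (L n)) -> (forall n, S (D n)) ->
     (forall n, L n.+1 `<=` L n) ->
     (forall x, exists n, forall m, (n <= m)%N -> ~ D m x) ->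
     (forall j n, exists2 m, (n <= m)%N & sel j (L m) (D m)) ->
     forall w, null (gw g w @^-1` \bigcap_n L n)).

Lemma size_flatten_map (T T' : Type) (f : T -> seq T') (s : seq T) K :
  (forall y, (size (f y) <= K)%N) -> (size (flatten (map f s)) <= size s * K)%N.
Proof.
move=> h; elim: s => //= y s IH; rewrite size_cat mulSn.
exact: leq_add.
Qed.

(** The exponent of 2 in [n.+1] takes every value infinitely often, so each test of the selector
    recurs. *)
Definition schedule n := logn 2 n.+1.

Lemma scheduleP j n : exists2 m, (n <= m)%N & schedule m = j.
Proof.
have h0 : (0 < 2 ^ j * n.*2.+1)%N by rewrite muln_gt0 expn_gt0.
exists (2 ^ j * n.*2.+1).-1.
  rewrite -ltnS prednK//; apply: (@leq_trans n.*2.+1); last first.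
    by rewrite leq_pmull// expn_gt0.
  by rewrite ltnS -addnn leq_addr.
rewrite /schedule prednK// lognM ?expn_gt0// pfactorK// lognE /=.
by rewrite dvdn2 /= odd_double addn0.
Qed.

Section Sequence.
Context {X : choiceType} (e : rel X) (nb : X -> seq X) (d : nat)
  (U : nat -> set X) (g : nat -> X -> X) (S : set (set X)).
Hypothesis HG : local_graph e nb d U g S.
Variable F : X -> Prop.
Hypothesis mF : S F.
Local Notation gw := (gw g).
Local Notation conn := (conn g).
Local Notation local_meas := (local_meas g S).

Section Measurability.
Variable H : X -> X -> Prop.
Hypotheses (He : forall x y, H x y -> e x y) (mH : local_meas H).

Lemma conn_H x y : H x y -> conn x y.
Proof. by move=> /He; exact: (conn_edge HG). Qed.

Lemma M_node : S (node H F).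
Proof.
apply: (M_or HG) => //.
apply: (M_ex HG) => [x z [y2 [y3 [[/conn_H//]]]]|u].
apply: (M_ex HG) => [x z [y3 [[_ /conn_H//]]]|v].
apply: (M_ex HG) => [x z [[_ _ /conn_H//]]|w].
apply: (M_and HG); apply: (M_and3 HG); by [exact: (mH [::] _)|apply: (M_not HG); exact: (M_eq HG)].
Qed.

Lemma reach_conn n x y a b : reach H F n x y a b -> [/\ conn x y, conn x a & conn x b].
Proof.
elim: n x y => [|n IH] x y /=.
  move=> [/conn_H xy _ -> ->]; split=> //; exact: conn_refl.
move=> [/conn_H xy _ [z [_ yz /IH[_ h1 h2]]]].
by split=> //; exact: conn_trans xy _.
Qed.

Lemma M_reach n u v s t : S (fun x => reach H F n (gw u x) (gw v x) (gw s x) (gw t x)).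
Proof.
elim: n u v s t => [|n IH] u v s t /=.
  apply: (M_and4 HG) => //; [exact: (M_gw HG v M_node)|exact: (M_eq HG)|exact: (M_eq HG)].
apply: (M_and3 HG) => //; first by apply: (M_not HG); exact: (M_gw HG v M_node).
apply: (M_ex HG) => [x z [_ /conn_H h _]|w].
  by apply: conn_trans h; exact: conn_gw.
by apply: (M_and3 HG) => //; apply: (M_not HG); exact: (M_eq HG).
Qed.

Lemma M_prune M : local_meas M -> local_meas (prune F H M).
Proof.
move=> mM u v; apply: (M_and HG) => //; apply: (M_not HG).
apply: (M_exc HG) => n.
apply: (M_ex HG) => [x a [b [h _]]|s].
  case: h => /reach_conn[_ h _]; apply: conn_trans h; exact: conn_gw.
apply: (M_ex HG) => [x b [h _]|t].
  case: h => /reach_conn[_ _ h]; apply: conn_trans h; exact: conn_gw.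
by apply: (M_and HG) => //; apply: (M_or HG); exact: M_reach.
Qed.

Lemma M_flow M : local_meas M -> local_meas (flow F H M).
Proof.
move=> mM u v; apply: (M_and HG) => //.
apply: (M_exc HG) => n.
apply: (M_ex HG) => [x a [b [/reach_conn[_ h _] _]]|s].
  by apply: conn_trans h; exact: conn_gw.
apply: (M_ex HG) => [x b [/reach_conn[_ _ h] _]|t].
  by apply: conn_trans h; exact: conn_gw.
by apply: (M_and HG) => //; exact: M_reach.
Qed.

Lemma M_adjacent u v : S (fun x => adjacent_nodes F H (gw u x) (gw v x)).
Proof.
apply: (M_or HG); first exact: (M_eq HG).
apply: (M_exc HG) => n.
apply: (M_ex HG) => [x y [a /reach_conn[h _ _]]|s].
  by apply: conn_trans h; exact: conn_gw.
apply: (M_ex HG) => [x a /reach_conn[_ h _]|t].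
  by apply: conn_trans h; exact: conn_gw.
exact: M_reach.
Qed.

Definition live x := ~ F x /\ exists y, H x y.

Lemma M_live : S live.
Proof.
apply: (M_and HG); first exact: (M_not HG).
by apply: (M_ex HG) => [x z /conn_H//|w]; exact: (mH [::] w).
Qed.

End Measurability.

Definition marking (H M : X -> X -> Prop) := [/\ local_meas M,
  (forall a b, M a b -> node H F b /\ H a b),
  (forall a a' b, M a b -> M a' b -> a = a') &
  forall a b a' b' p q, M a b -> M a' b' -> node H F p -> node H F q ->
    adjacent_nodes F H b p -> adjacent_nodes F H p q -> adjacent_nodes F H q b' ->
    b = b'].

Definition loses (H H' : X -> X -> Prop) x := exists y, H x y /\ ~ H' x y.

(** Different end nodes at most three segments apart are told apart by the first factor of colors,
    and different vertices with a common neighbor by the second. A marking is given by a pair of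
    colors. *)
Let N := ((d.+1 ^ 3).+1 * (d * d).+1)%N.

Lemma marking_exists (H : X -> X -> Prop) null sel j :
  pruned F H -> local_meas H -> (forall x y, H x y -> e x y) ->
  selector g S null N sel ->
  exists M, marking H M /\ sel j (live H) (loses H (prune F H M)).
Proof.
move=> hH mH He [hsel _].
have mnode := M_node He mH.
have madj := M_adjacent He mH.
pose Q b b' := exists p q, [/\ node H F b, node H F b', node H F p & node H F q] /\
  [/\ adjacent_nodes F H b p, adjacent_nodes F H p q & adjacent_nodes F H q b'].
have adj_conn x y : adjacent_nodes F H x y -> conn x y.
  case=> [->|[n [z [a /(reach_conn He)[]]]]] //; exact: conn_refl.
have mQ : local_meas Q.
  move=> u v; apply: (M_ex HG) => [x p [q [_ [/adj_conn h _ _]]]|s].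
    by apply: conn_trans h; exact: conn_gw.
  apply: (M_ex HG) => [x q [_ [/adj_conn h1 /adj_conn h2 _]]|t].
    by apply: conn_trans h2; exact: conn_gw.
  apply: (M_and HG); [apply: (M_and4 HG)|apply: (M_and3 HG)] => //; exact: (M_gw HG _ mnode).
(* The nodes within one segment of a node [p]: [p] itself and the end of the segment through each
   neighbor, with [p] as default where there is none. *)
pose l p := p :: [seq xget p [set q | exists n a, reach H F n p y a q] | y <- nb p].
have lP p q : adjacent_nodes F H p q -> q \in l p.
  case=> [->|[n [y [a h]]]]; first by rewrite mem_head.
  rewrite inE; apply/orP; right; apply/mapP; exists y.
    by rewrite (lg_nb HG); apply: He; case: (reach_node h).
  have [n' [a' h']] := @xgetPex _ p [set q | exists n a, reach H F n p y a q]
    (ex_intro _ q (ex_intro _ n (ex_intro _ a h))).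
  by have [_ _ ->] := reach_fun hH h h'.
have sl p : (size (l p) <= d.+1)%N by rewrite /= size_map ltnS (lg_size HG).
pose nbQ b := flatten [seq flatten [seq l q | q <- l p] | p <- l b].
have [||||col mcol [colN colP]] := finite_coloring HG (nbQ := nbQ) (D := (d.+1 ^ 3)%N) mQ.
- by move=> x y [p [q [_ [/adj_conn h1 /adj_conn h2 /adj_conn h3]]]];
    apply: conn_trans (conn_trans h1 h2) h3.
- move=> b b' [p [q [_ [/lP h1 /lP h2 /lP h3]]]].
  apply/flatten_mapP; exists p => //; apply/flatten_mapP; by exists q.
- move=> b b' [p [q [[h1 h2 h3 h4] [a1 a2 a3]]]]; exists q, p; split=> //.
  by split; apply: adjacent_nodes_sym.
- move=> x; apply: leq_trans (_ : (size (l x) * (d.+1 * d.+1) <= _)%N).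
    apply: size_flatten_map => p; apply: leq_trans (_ : (size (l p) * d.+1 <= _)%N).
      exact: size_flatten_map.
    by rewrite leq_mul2r sl orbT.
  by rewrite expnS expnS expn1 leq_mul2r sl orbT.
pose Q2 a a' := exists b, e b a /\ e b a'.
have [|||||c2 mc2 [c2N c2P]] := finite_coloring HG (Q := Q2)
    (nbQ := fun a => flatten [seq nb b | b <- nb a]) (D := (d * d)%N).
- move=> u v; apply: (M_ex HG) => [x b [h _]|w].
    apply: conn_trans (conn_gw g x u) _; apply: (conn_edge HG).
    by rewrite (lg_sym HG).
  by apply: (M_and HG); exact: (M_e HG).
- move=> x y [b [h1 h2]]; apply: (conn_trans (y := b)); apply: (conn_edge HG) => //.
  by rewrite (lg_sym HG).
- move=> a a' [b [h1 h2]]; apply/flatten_mapP; exists b; rewrite (lg_nb HG)//.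
  by rewrite (lg_sym HG).
- by move=> a a' [b [h1 h2]]; exists b.
- move=> a; apply: leq_trans (_ : (size (nb a) * d <= _)%N).
    by apply: size_flatten_map => b; exact: (lg_size HG).
  by rewrite leq_mul2r (lg_size HG) orbT.
pose M i a b := [/\ node H F b, H a b, col b = i %/ (d * d).+1 & c2 a = i %% (d * d).+1]%N.
have mM i : marking H (M i).
  split.
  - move=> u v; apply: (M_and4 HG) => //; first exact: (M_gw HG v mnode).
      exact: (M_nat_gw HG).
    exact: (M_nat_gw HG).
  - by move=> a b [].
  - move=> a a' b [nb_ ab _ ca] [_ ab' _ ca']; apply: contrapT => aa'.
    apply: (c2P a a') => //; last by rewrite ca ca'.
    by exists b; split; rewrite (lg_sym HG); exact: He.
  - move=> a b a' b' p q [nb_ _ cb _] [nb' _ cb' _] np nq h1 h2 h3.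
    apply: contrapT => bb'; apply: (colP b b') => //; last by rewrite cb cb'.
    by exists p, q.
have [||| i iN hi] := hsel j (live H) (fun i => loses H (prune F H (M i))).
- exact: M_live.
- move=> i; case: (mM i) => mMi _ _ _; apply: (M_ex HG) => [x z [/(conn_H He)]//|w].
  by apply: (M_and HG); [exact: (mH [::] w)|apply: (M_not HG); exact: (M_prune He mH mMi [::] w)].
- move=> x [nFx [y xy]]; have [n [a [b h]]] := pr_reach hH xy.
  (* The index combines the colors of the end [b] and of the entering vertex [a] of the segment that
     starts with [x y]. *)
  exists (col b * (d * d).+1 + c2 a)%N => /=.
    rewrite /N; apply: (@leq_trans ((col b).+1 * (d * d).+1)).
      by rewrite mulSn addnC ltn_add2r c2N.
    by rewrite leq_mul2r colN orbT.
  exists y; split=> // -[_]; apply; exists n, a, b; split; first by left.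
  have [_ ab nb_] := reach_node h.
  split=> //; first by rewrite divnMDl// divn_small// addn0.
  by rewrite modnMDl modn_small.
by exists (M i).
Qed.

Theorem prune_sequence (T : X -> X -> Prop) null sel :
  pruned F T -> local_meas T -> (forall x y, T x y -> e x y) ->
  selector g S null N sel ->
  exists H M : nat -> X -> X -> Prop, [/\ H 0%N = T,
    (forall n, H n.+1 = prune F (H n) (M n)),
    (forall n, [/\ pruned F (H n), local_meas (H n) & forall x y, H n x y -> e x y]),
    (forall n, marking (H n) (M n)) &
    forall w, null (gw w @^-1` \bigcap_n live (H n))].
Proof.
move=> hT mT Te hsel; have [_ hlim] := hsel.
pose good H := [/\ pruned F H, local_meas H & forall x y, H x y -> e x y].
have /choice[step hstep] : forall jH : nat * (X -> X -> Prop), exists M,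
    good jH.2 -> marking jH.2 M /\ sel jH.1 (live jH.2) (loses jH.2 (prune F jH.2 M)).
  move=> [j H]; have [gH|nH] := pselect (good H); last by exists H => /nH.
  case: (gH) => h1 h2 h3.
  by have [M hM] := marking_exists j h1 h2 h3 hsel; exists M.
pose H := fix H n := if n is m.+1 then prune F (H m) (step (schedule m, H m)) else T.
pose M n := step (schedule n, H n).
have gH n : good (H n).
  elim: n => [//|n IH]; case: (IH) => h1 h2 h3.
  have [[mM M1 M2 M3] _] := hstep (schedule n, H n) IH.
  split; [exact: prune_pruned|exact: M_prune|by move=> x y [/h3]].
have mkM n : marking (H n) (M n) by have [] := hstep (schedule n, H n) (gH n).
exists H, M; split=> //.
have Hdec n x y : H n.+1 x y -> H n x y by case.
apply: (hlim (fun n => live (H n)) (fun n => loses (H n) (H n.+1))).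
- by move=> n; case: (gH n) => h1 h2 h3; exact: M_live.
- move=> n; case: (gH n) => h1 h2 h3; case: (gH n.+1) => h4 h5 h6.
  apply: (M_ex HG) => [x z [/(conn_H h3)]//|w].
  by apply: (M_and HG); [exact: (h2 [::] w)|apply: (M_not HG); exact: (h5 [::] w)].
- by move=> n x [nF [y /Hdec xy]]; split=> //; exists y.
- move=> x.
  suff [n hn] : exists n, forall y, y \in nb x -> forall m, (n <= m)%N -> H m x y -> H m.+1 x y.
    exists n => m nm [y [xy nxy]]; apply: nxy; apply: hn => //.
    by rewrite (lg_nb HG); case: (gH m) => _ _; exact.
  elim: (nb x) => [|z s [n hn]]; first by exists 0%N.
  have [[m [hm nhm]]|nm] := pselect (exists m, H m x z /\ ~ H m.+1 x z).
    have never k : (m < k)%N -> ~ H k x z.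
      elim: k => // k IH; rewrite ltnS leq_eqVlt => /orP[/eqP <-//|mk] /Hdec.
      exact: IH.
    exists (maxn n m.+1) => y; rewrite inE => /orP[/eqP ->|ys] k; rewrite geq_max => /andP[nk mk].
      by move=> /(never _ mk).
    exact: hn.
  exists n => y; rewrite inE => /orP[/eqP -> k _ hk|ys]; last exact: hn.
  by apply: contrapT => nhk; apply: nm; exists k.
- move=> j n; have [m nm sm] := scheduleP j n; exists m => //.
  by have [_] := hstep (schedule m, H m) (gH m); rewrite /= sm.
Qed.

End Sequence.

(** * Removing good cycles *)

Lemma next_nth_mod (T : eqType) (x0 : T) (K : seq T) i : uniq K -> (i < size K)%N ->
  next K (nth x0 K i) = nth x0 K (i.+1 %% size K).
Proof.
move=> uK iK; rewrite next_nth mem_nth// index_uniq//.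
case: K uK iK => // y p uK; rewrite [size _]/= ltnS leq_eqVlt => /orP[/eqP ->|ip].
  by rewrite nth_default// modnn.
by rewrite modn_small ?ltnS//= (set_nth_default x0).
Qed.

(** With indices in place of vertices, chords of [tuple_at k x] are described by finitely many
    words, which makes goodness measurable in [x]. *)
Lemma chord_index (T : eqType) (x0 : T) (e : rel T) (K : seq T) : uniq K ->
  (exists u v, chord e K u v) <-> (exists i j : nat, [/\ (i < size K)%N /\ (j < size K)%N,
    e (nth x0 K i) (nth x0 K j), j <> i.+1 %% size K & i <> j.+1 %% size K])%N.
Proof.
move=> uK; split=> [[u [v [uin vin uv un vn]]]|[i [j [[iK jK] ij n1 n2]]]].
  have iK : (index u K < size K)%N by rewrite index_mem.
  have jK : (index v K < size K)%N by rewrite index_mem.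
  exists (index u K), (index v K); rewrite !nth_index//; split=> // E.
    by move: un; rewrite -{1}(nth_index x0 uin) next_nth_mod// -E nth_index// eqxx.
  by move: vn; rewrite -{1}(nth_index x0 vin) next_nth_mod// -E nth_index// eqxx.
have K0 : (0 < size K)%N by exact: leq_ltn_trans iK.
exists (nth x0 K i), (nth x0 K j); split; rewrite ?mem_nth//.
  by rewrite next_nth_mod// nth_uniq// ?ltn_mod//; apply/eqP.
by rewrite next_nth_mod// nth_uniq// ?ltn_mod//; apply/eqP.
Qed.

Section GoodCycles.
Context {X : choiceType} (e : rel X) (nb : X -> seq X) (d : nat)
  (U : nat -> set X) (g : nat -> X -> X).
Local Notation gw := (gw g).

Definition code (n : nat) : seq (seq nat) * nat := odflt ([::], 0%N) (unpickle n).

Lemma codeK c : code (pickle c) = c.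
Proof. by rewrite /code pickleK. Qed.

Definition tuple_at (k : seq (seq nat)) x : seq X := [seq gw w x | w <- k].

Definition touch (s t : seq X) := exists a b, [/\ a \in s, b \in t & a = b \/ e a b].

(** The second component of the code is the index of a set in which [x] is the only point whose
    tuple touches that of [x]. This keeps the tuples with the same code apart. *)
Definition candidate n x := [/\ U (code n).2 x, ham_good e (tuple_at (code n).1 x) &
  forall y, touch (tuple_at (code n).1 x) (tuple_at (code n).1 y) -> U (code n).2 y -> y = x].

(* Good cycles are selected greedily, code after code; those with the same code
   never touch each other. *)
Fixpoint selected n v := if n is m.+1 then selected m v \/
    exists x, [/\ candidate m x, v \in tuple_at (code m).1 x &
      forall a b, b \in tuple_at (code m).1 x -> a = b \/ e a b -> ~ selected m a]
  else False.

Definition chosen n x := candidate n x /\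
  forall a b, b \in tuple_at (code n).1 x -> a = b \/ e a b -> ~ selected n a.

Definition Wset v := exists n, selected n v.

Lemma selected_chosen n v : selected n v -> exists m x, [/\ (m < n)%N, chosen m x &
  v \in tuple_at (code m).1 x].
Proof.
elim: n => //= n IH [/IH[m [x [mn h1 h2]]]|[x [h1 h2 h3]]]; last by exists n, x.
by exists m, x; split=> //; exact: leqW.
Qed.

Lemma chosen_selected n x v : chosen n x -> v \in tuple_at (code n).1 x -> selected n.+1 v.
Proof. by move=> [h1 h2] vx; right; exists x. Qed.

Lemma selected_le n m v : (n <= m)%N -> selected n v -> selected m v.
Proof.
by move=> /subnK <-; elim: (m - n)%N => //= k IH h; left; exact: IH.
Qed.

Lemma WsetP v : Wset v <-> exists n x, chosen n x /\ v \in tuple_at (code n).1 x.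
Proof.
split=> [[n /selected_chosen[m [x [_ h1 h2]]]]|[n [x [h1 h2]]]]; first by exists m, x.
by exists n.+1; exact: chosen_selected h1 h2.
Qed.

Hypothesis esym : symmetric e.

Lemma chosen_touch n x m y a b : chosen n x -> chosen m y ->
  a \in tuple_at (code n).1 x -> b \in tuple_at (code m).1 y -> a = b \/ e a b ->
  n = m /\ x = y.
Proof.
have lt k z l t c f : chosen k z -> chosen l t -> (k < l)%N ->
    c \in tuple_at (code k).1 z -> f \in tuple_at (code l).1 t -> ~ (c = f \/ e c f).
  move=> hk [_ hl] kl cz ft cf; apply: (hl c f ft cf).
  by apply: selected_le kl _; exact: chosen_selected hk cz.
move=> hn hm ax bx ab; have ba : b = a \/ e b a by case: ab => [->|]; [left|rewrite esym; right].
case: (ltngtP n m) => nm.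
- by case: (lt _ _ _ _ _ _ hn hm nm ax bx ab).
- by case: (lt _ _ _ _ _ _ hm hn nm bx ax ba).
split=> //; rewrite -nm in hm bx; case: hm => -[_ _ hm] _; apply: hm; last first.
  by case: hn => -[].
by exists b, a.
Qed.

Section Measurability.
Variable S : set (set X).
Hypothesis HG : local_graph e nb d U g S.

Lemma M_in_tuple u k : S (fun x => gw u x \in tuple_at k x).
Proof.
elim: k => [|w k IH]; first exact: (M_const HG (is_true false)).
apply: (M_ext (P := fun x => gw u x = gw w x \/ gw u x \in tuple_at k x)).
  by move=> x; rewrite inE; split=> [[->|->]|/predU1P//]; rewrite ?eqxx ?orbT.
by apply: (M_or HG) => //; exact: (M_eq HG).
Qed.

Lemma M_uniq_tuple k : S (fun x => uniq (tuple_at k x)).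
Proof.
elim: k => [|w k IH]; first exact: (M_const HG (is_true true)).
apply: (M_ext (P := fun x => ~ gw w x \in tuple_at k x /\ uniq (tuple_at k x))).
  by move=> x /=; split=> [[/negP -> ->]|/andP[/negP]].
by apply: (M_and HG) => //; apply: (M_not HG); exact: M_in_tuple.
Qed.

Lemma M_path_tuple u k : S (fun x => path e (gw u x) (tuple_at k x)).
Proof.
elim: k u => [|w k IH] u; first exact: (M_const HG (is_true true)).
apply: (M_ext (P := fun x => e (gw u x) (gw w x) /\ path e (gw w x) (tuple_at k x))).
  by move=> x /=; split=> [[-> ->]|/andP].
by apply: (M_and HG) => //; exact: (M_e HG).
Qed.

Lemma M_ham_good k : S (fun x => ham_good e (tuple_at k x)).
Proof.
pose w i := nth [::] k i.
have nE x i : (i < size k)%N -> nth x (tuple_at k x) i = gw (w i) x.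
  by move=> ik; rewrite (nth_map [::]).
apply: (M_ext (P := fun x => [/\ uniq (tuple_at k x), cycle e (tuple_at k x),
  exists i j : nat, ((i < size k)%N /\ (j < size k)%N) /\ gw (w i) x <> gw (w j) x /\ ~ e (gw (w i) x) (gw (w j) x)
  & odd (size k) -> exists i j : nat, ([/\ (i < size k)%N /\ (j < size k)%N,
      j <> i.+1 %% size k & i <> j.+1 %% size k]%N) /\ e (gw (w i) x) (gw (w j) x)])).
  move=> x; have sz : size (tuple_at k x) = size k by rewrite size_map.
  split=> [[uK cK [i [j [[ik jk] [n1 /negP n2]]]] ch]|[uK cK [a [b [ain bin /eqP ab nab]]] ch]].
    split=> //; last first.
      rewrite sz => /ch[i' [j' [[[h1 h1'] h2 h3] h4]]]; apply/(chord_index x) => //.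
      by rewrite sz; exists i', j'; rewrite !nE.
    exists (gw (w i) x), (gw (w j) x); split=> //; last exact/eqP.
      by apply/mapP; exists (w i) => //; rewrite mem_nth.
    by apply/mapP; exists (w j) => //; rewrite mem_nth.
  split=> //; last first.
    rewrite -sz => /ch/(chord_index x e uK)[i [j [[h1 h1'] h2 h3 h4]]]; exists i, j.
    by rewrite sz in h1 h1' h3 h4 *; split=> //; rewrite -!nE.
  exists (index a (tuple_at k x)), (index b (tuple_at k x)).
  by rewrite -sz !index_mem ain bin -!nE ?nth_index ?index_mem -?sz ?index_mem//; split=> //; split=> //; apply/negP.
apply: (M_and4 HG); first exact: M_uniq_tuple.
- case: (k) => [|u l]; first exact: (M_const HG (is_true true)).
  by have := M_path_tuple u (rcons l u); rewrite /tuple_at; under eq_fun do rewrite map_rcons.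
- apply: (M_exc HG) => i; apply: (M_exc HG) => j; apply: (M_and HG); first exact: (M_const HG).
  by apply: (M_and HG); apply: (M_not HG); [exact: (M_eq HG)|exact: (M_e HG)].
apply: (M_imp HG); first exact: (M_const HG).
apply: (M_exc HG) => i; apply: (M_exc HG) => j; apply: (M_and HG); first exact: (M_const HG).
exact: (M_e HG).
Qed.

Lemma tuple_gw k s x : tuple_at k (gw s x) = tuple_at [seq w ++ s | w <- k] x.
Proof. by rewrite /tuple_at -map_comp; apply: eq_map => w /=; rewrite gw_cat. Qed.

Lemma M_in_tuple_gw v k s : S (fun x => gw v x \in tuple_at k (gw s x)).
Proof.
apply: (M_ext (P := fun x => gw v x \in tuple_at [seq w ++ s | w <- k] x)).
  by move=> x; rewrite tuple_gw.
exact: M_in_tuple.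
Qed.

Lemma tuple_conn k x v : v \in tuple_at k x -> conn g x v.
Proof. by move=> /mapP[w _ ->]; exact: conn_gw. Qed.

Lemma touch_edge_conn a b : a = b \/ e a b -> conn g a b.
Proof. by case=> [->|/(conn_edge HG)//]; exact: conn_refl. Qed.

Lemma M_touch k s : S (fun x => touch (tuple_at k x) (tuple_at k (gw s x))).
Proof.
apply: (M_ex HG) => [x a [b [/tuple_conn//]]|u].
apply: (M_ex HG) => [x b [_ h _]|v].
  by apply: conn_trans (tuple_conn h); exact: conn_gw.
apply: (M_and3 HG); first exact: M_in_tuple.
  exact: M_in_tuple_gw.
by apply: (M_or HG); [exact: (M_eq HG)|exact: (M_e HG)].
Qed.

Lemma M_candidate n : S (candidate n).
Proof.
apply: (M_and3 HG); [exact: (lg_U HG)|exact: M_ham_good|].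
apply: (M_all HG) => [x z h|w].
  have [a [b [ax bz ab]]] : touch (tuple_at (code n).1 x) (tuple_at (code n).1 z).
    by apply: contrapT => nt; apply: h.
  apply: conn_trans (tuple_conn ax) _; apply: conn_trans (touch_edge_conn ab) _.
  exact: (conn_sym HG (tuple_conn bz)).
apply: (M_imp HG); first exact: M_touch.
by apply: (M_imp HG); [exact: (M_gw HG w (lg_U HG _))|exact: (M_eq HG w [::])].
Qed.

Lemma M_untouched k (P : X -> Prop) : S P ->
  S (fun x => forall a b, b \in tuple_at k x -> a = b \/ e a b -> ~ P a).
Proof.
move=> mP; apply: (M_all HG) => [x a h|u].
  apply: contrapT => nc; apply: h => b bx ab _; apply: nc.
  exact: conn_trans (tuple_conn bx) (conn_sym HG (touch_edge_conn ab)).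
apply: (M_all HG) => [x b h|v].
  by apply: contrapT => nc; apply: h => bx; case: nc; exact: tuple_conn bx.
apply: (M_imp HG); first exact: M_in_tuple.
apply: (M_imp HG); first by apply: (M_or HG); [exact: (M_eq HG)|exact: (M_e HG)].
by apply: (M_not HG); exact: (M_gw HG u mP).
Qed.

Lemma M_selected n : S (selected n).
Proof.
elim: n => [|n IH]; first exact: (M_const HG).
apply: (M_or HG) => //.
apply: (M_ex HG) => [v x [_ h _]|s]; first exact: (conn_sym HG (tuple_conn h)).
apply: (M_and3 HG); first exact: (M_gw HG s (M_candidate n)).
  exact: (M_in_tuple_gw [::]).
exact: (M_gw HG s (M_untouched _ IH)).
Qed.

Lemma M_Wset : S Wset.
Proof. by apply: (M_exc HG) => n; exact: M_selected. Qed.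

Lemma M_chosen n : S (chosen n).
Proof.
by apply: (M_and HG); [exact: M_candidate|apply: M_untouched; exact: M_selected].
Qed.

Fixpoint preimages (w : seq nat) (b : X) : seq X :=
  if w is i :: w' then flatten [seq preimages w' z | z <- b :: nb b] else [:: b].

Lemma preimagesP w y : y \in preimages w (gw w y).
Proof.
elim: w => [|i w IH]; first by rewrite /= inE.
apply/flatten_mapP; exists (gw w y) => //=; rewrite inE.
have [->|h] := lg_eg HG i (gw w y); first by rewrite eqxx.
by rewrite (lg_nb HG) (lg_sym HG) h orbT.
Qed.

(** Every [g i] moves points along edges or fixes them, so it has finite fibers, and only finitely
    many [y] have a tuple touching that of [x]. *)
Lemma isolating k x : exists u, U u x /\
  forall y, touch (tuple_at k x) (tuple_at k y) -> U u y -> y = x.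
Proof.
pose l := flatten [seq flatten [seq preimages w b | w <- k] |
  b <- flatten [seq a :: nb a | a <- tuple_at k x]].
have lP y : touch (tuple_at k x) (tuple_at k y) -> y \in l.
  move=> [a [b [ax /mapP[w wk ->] ab]]]; apply/flatten_mapP; exists (gw w y).
    apply/flatten_mapP; exists a => //; rewrite inE (lg_nb HG).
    by case: ab => [->|->]; rewrite ?eqxx ?orbT.
  by apply/flatten_mapP; exists w => //; exact: preimagesP.
have [|u [Ux hu]] := lg_sep HG (x := x) (s := [seq y <- l | y != x]).
  by rewrite mem_filter eqxx.
exists u; split=> // y /lP yl Uy; apply/eqP/negPn/negP => yx.
by apply: (hu y) Uy; rewrite mem_filter yx.
Qed.

Lemma path_tuple x u s : path e (gw u x) s -> exists k, s = tuple_at k x.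
Proof.
elim: s u => [|y s IH] u /=; first by exists [::].
move=> /andP[uy ps]; have [i gi] := lg_ge HG uy.
have [|k ->] := IH (i :: u); first by rewrite /= gi.
by exists ((i :: u) :: k); rewrite /= gi.
Qed.

(** Maximality of the family: [K] is a tuple at one of its points and has an isolating set, so at
    the stage of its code nothing would prevent it from being chosen. *)
Lemma no_good_outside (K : seq X) : ham_good e K ->
  (forall v, v \in K -> ~ Wset v /\ forall a, e a v -> ~ Wset a) -> False.
Proof.
move=> hK hW; have [x [s KE]] : exists x s, K = x :: s.
  by case: K hK {hW} => [[_ _ [u [v []]]]|x s _] //; exists x, s.
have [k Kk] : exists k, K = tuple_at k x.
  have [_ + _ _] := hK; rewrite KE /= rcons_path => /andP[/(@path_tuple x [::])[k ->] _].
  by exists ([::] :: k).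
have [u [Ux hu]] := isolating k x.
pose n := pickle (k, u).
have cn : chosen n x.
  split; first by rewrite /candidate codeK /= -Kk; split=> //; rewrite Kk.
  rewrite codeK /= -Kk => a b /hW[nb_ nab] [->|ab] sa; first by apply: nb_; exists n.
  by apply: (nab a ab); exists n.
have xK : x \in K by rewrite KE mem_head.
have [nx _] := hW x xK; apply: nx; apply/WsetP; exists n, x; split=> //.
by rewrite codeK /= -Kk.
Qed.

Section Extension.
Variable c : X -> nat.
Hypothesis mc : meas_nat S c.
Hypothesis d0 : (0 < d)%N.

Definition extends n (t : seq nat) x := forall i, (i < size (code n).1)%N ->
  [/\ (nth 0 t i < d)%N,
    forall j, (j < size (code n).1)%N ->
      e (gw (nth [::] (code n).1 i) x) (gw (nth [::] (code n).1 j) x) -> nth 0%N t i <> nth 0%N t j &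
    forall v, e (gw (nth [::] (code n).1 i) x) v /\ ~ Wset v -> c v <> nth 0%N t i].

(** The list of [v] omits the colors of its neighbors outside [K]. As [v] has at most [d] neighbors,
    at least as many colors remain as it has neighbors in [K]. *)
Lemma extends_exists n x : chosen n x -> exists t, extends n t x.
Proof.
move=> hn; set K := tuple_at (code n).1 x.
have KW v : v \in K -> Wset v by move=> vK; apply/WsetP; exists n, x.
have hK : ham_good e K by case: hn => -[].
have [uK _ _ _] := hK.
pose L (v : X) : {set 'I_d} := 
    finset (fun q : 'I_d => all (fun v' => (v' \in K) || (c v' != q)) (nb v)).
have hL v : (count (e v) K <= #|L v|)%N.
  have E : count (e v) K = count (mem K) (nb v).
    rewrite -!size_filter; apply: perm_size; apply: uniq_perm.
    - exact: filter_uniq.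
    - by apply: filter_uniq; exact: (lg_uniq HG).
    - by move=> y; rewrite !mem_filter (lg_nb HG) andbC.
  rewrite E -(leq_add2r (count (predC (mem K)) (nb v))) count_predC.
  apply: leq_trans (lg_size HG v) _.
  rewrite -[X in (X <= _)%N](card_ord d) -(cardsC (L v)) leq_add2l.
  rewrite -size_filter -(size_map c) cardE -(size_map val).
  apply: uniq_leq_size; first by rewrite map_inj_uniq ?enum_uniq//; exact: val_inj.
  move=> _ /mapP[q + ->]; rewrite mem_enum !inE => /allPn[v' v'nb].
  rewrite negb_or negbK => /andP[v'K /eqP cq].
  rewrite (_ : val q = c v'); last by rewrite cq.
  apply: map_f.
  by rewrite mem_filter /= v'K.
have [f [fL fp]] := ham_colorable (Ordinal d0) (lg_sym HG) (lg_irr HG) hK (fun v _ => hL v).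
exists [seq val (f v) | v <- K] => i ik.
have iK : (i < size K)%N by rewrite size_map.
have nE j : (j < size (code n).1)%N -> nth 0%N [seq val (f v) | v <- K] j =
    val (f (gw (nth [::] (code n).1 j) x)).
  by move=> jk; rewrite (nth_map x) ?size_map// (nth_map [::]).
have inK j : (j < size (code n).1)%N -> gw (nth [::] (code n).1 j) x \in K.
  by move=> jk; apply/mapP; exists (nth [::] (code n).1 j) => //; rewrite mem_nth.
rewrite nE//; split=> [|j jk ij|v [iv nWv] cv]; first exact: ltn_ord.
  rewrite nE// => /val_inj; apply: fp => //; exact: inK.
have := fL _ (inK i ik); rewrite inE => /allP/(_ v).
rewrite (lg_nb HG) => /(_ iv)/orP[/KW//|]; by rewrite cv eqxx.
Qed.

Definition extension n x := word_of (first (fun m => extends n (word_of m)) x).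

Lemma extensionP n x : chosen n x -> extends n (extension n x) x.
Proof.
move=> /extends_exists[t ht].
have [] := @firstP _ (fun m => extends n (word_of m)) x; last by [].
by exists (pickle t); rewrite word_ofK.
Qed.

Definition extension_color q v := exists n (i : nat) x, [/\ chosen n x, (i < size (code n).1)%N,
  gw (nth [::] (code n).1 i) x = v & nth 0%N (extension n x) i = q].

Lemma M_extends n t : S (extends n t).
Proof.
apply: (M_allc HG) => i; apply: (M_imp HG); first exact: (M_const HG).
apply: (M_and3 HG); first exact: (M_const HG).
  apply: (M_allc HG) => j; apply: (M_imp HG); first exact: (M_const HG).
  by apply: (M_imp HG); [exact: (M_e HG)|exact: (M_const HG)].
apply: (M_all HG) => [x v h|w].
  apply: contrapT => nc; apply: h => -[iv _]; case: nc.
  by apply: conn_trans (conn_edge HG iv); exact: conn_gw.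
apply: (M_imp HG); last by apply: (M_not HG); exact: (M_nat_gw HG).
apply: (M_and HG); first exact: (M_e HG).
by apply: (M_not HG); exact: (M_gw HG w M_Wset).
Qed.

Lemma M_extension_color q : S (extension_color q).
Proof.
apply: (M_exc HG) => n; apply: (M_exc HG) => i.
apply: (M_ex HG) => [v x [_ _ <- _]|s].
  by apply: (conn_sym HG); exact: conn_gw.
apply: (M_and4 HG); first exact: (M_gw HG s (M_chosen n)).
- exact: (M_const HG).
- by under eq_fun do rewrite gw_cat; exact: (M_eq HG _ [::]).
apply: (M_gw HG s (P := fun x => nth 0%N (extension n x) i = q)).
apply: (M_fun_eq HG (f := first (fun m => extends n (word_of m)))
   (P := fun m x => nth 0%N (word_of m) i = q)) => m; last exact: (M_const HG).
by apply: (M_first HG) => k; exact: M_extends.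
Qed.

Definition recolored v := if pselect (Wset v) then first extension_color v else c v.

Lemma recoloredN v : ~ Wset v -> recolored v = c v.
Proof. by rewrite /recolored; case: pselect. Qed.

Lemma recoloredW n x i : chosen n x -> (i < size (code n).1)%N ->
  recolored (gw (nth [::] (code n).1 i) x) = nth 0%N (extension n x) i.
Proof.
move=> hn ik; set v := gw _ x.
have vK : v \in tuple_at (code n).1 x by apply/mapP; exists (nth [::] (code n).1 i) => //; rewrite mem_nth.
have Wv : Wset v by apply/WsetP; exists n, x.
rewrite /recolored; case: pselect => [?|//] /=.
have [|h _] := @firstP _ extension_color v.
  by exists (nth 0%N (extension n x) i), n, i, x.
move: h => [m [j [y [hm jk yv qE]]]]; rewrite -{}qE.
have vK' : v \in tuple_at (code m).1 y.
  by apply/mapP; exists (nth [::] (code m).1 j); rewrite ?mem_nth.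
have [E1 E2] := chosen_touch hm hn vK' vK (or_introl erefl).
rewrite E1 E2 in jk yv *; suff -> : j = i by [].
have [[_ [uK _ _ _] _] _] := hn; apply/eqP.
rewrite -(nth_uniq x (s := tuple_at (code n).1 x)) ?size_map//.
by rewrite !(nth_map [::])// yv.
Qed.

Lemma meas_recolored : meas_nat S recolored.
Proof.
move=> q; apply: (M_ext (P := fun v => (Wset v /\ first extension_color v = q) \/
  (~ Wset v /\ c v = q))).
  move=> v; rewrite /recolored; case: pselect => h; split=> [[[]|[]]//|];
    by [left|right].
apply: (M_or HG); apply: (M_and HG); [exact: M_Wset| |apply: (M_not HG); exact: M_Wset|exact: mc].
by apply: (M_first HG) => k; exact: M_extension_color.
Qed.

Lemma recolored_coloring : (forall v, ~ Wset v -> (c v < d)%N) ->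
  (forall u v, ~ Wset u -> ~ Wset v -> e u v -> c u <> c v) ->
  (forall v, (recolored v < d)%N) /\ forall u v, e u v -> recolored u <> recolored v.
Proof.
move=> cd cp.
have inW v : Wset v -> exists n x i, [/\ chosen n x, (i < size (code n).1)%N &
    v = gw (nth [::] (code n).1 i) x].
  move=> /WsetP[n [x [hn /(nthP x)[i]]]]; rewrite size_map => ik.
  by rewrite (nth_map [::])// => <-; exists n, x, i.
have half u v : Wset u -> ~ Wset v -> e u v -> recolored u <> recolored v.
  move=> /inW[n [x [i [hn ik ->]]]] nWv uv; rewrite recoloredW// recoloredN//.
  have [_ _ h] := extensionP hn ik; apply/nesym; exact: h.
split=> [v|u v uv].
  have [/inW[n [x [i [hn ik ->]]]]|nW] := pselect (Wset v); last by rewrite recoloredN// cd.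
  by rewrite recoloredW//; have [] := extensionP hn ik.
have [Wu|nWu] := pselect (Wset u); have [Wv|nWv] := pselect (Wset v).
- have [n [x [i [hn ik uE]]]] := inW u Wu; have [m [y [j [hm jk vE]]]] := inW v Wv.
  have uK : u \in tuple_at (code n).1 x.
    by apply/mapP; exists (nth [::] (code n).1 i); rewrite ?mem_nth.
  have vK : v \in tuple_at (code m).1 y.
    by apply/mapP; exists (nth [::] (code m).1 j); rewrite ?mem_nth.
  have [E1 E2] := chosen_touch hn hm uK vK (or_intror uv).
  rewrite -{}E1 -{}E2 in jk vE {hm vK}; rewrite uE vE in uv *; rewrite !recoloredW//.
  by have [_ h _] := extensionP hn ik; exact: h.
- exact: half.
- by apply/nesym; apply: half; rewrite // esym.
- by rewrite !recoloredN//; exact: cp.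
Qed.

End Extension.
End Measurability.
End GoodCycles.

(** * Measure and category *)

Section MeasureSelector.
Context (R : realType) (disp : measure_display) (X : measurableType disp)
  (mu : probability X R) (g : nat -> X -> X).
Hypothesis mg : forall i (A : set X), measurable A -> measurable (g i @^-1` A).
Import Order.TTheory GRing.Theory Num.Theory.
Local Open Scope ring_scope.

Lemma measurable_gw w (A : set X) : measurable A -> measurable (gw g w @^-1` A).
Proof.
elim: w A => [|i w IH] A mA; first by rewrite preimage_id.
exact: (IH _ (mg i mA)).
Qed.

Let p (A : set X) : R := fine (mu A).

Let pE A : measurable A -> mu A = (p A)%:E.
Proof. by move=> mA; rewrite fineK// fin_num_measure. Qed.

Let p_le A B : measurable A -> measurable B -> A `<=` B -> p A <= p B.
Proof. by move=> mA mB AB; rewrite -lee_fin -!pE// le_measure ?inE. Qed.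

(** One of [N] covering sets has at least the fraction [1/N] of the measure. A limit of positive
    measure would bound the measure of infinitely many [D m] from below, while their tails [C k]
    decrease to the empty set. *)
Lemma measure_selector N : (0 < N)%N ->
  selector g (@measurable _ X) (fun A => mu A = 0%E) N
    (fun j L D => p (gw g (word_of j) @^-1` L) <= N%:R * p (gw g (word_of j) @^-1` D)).
Proof.
case: N => // N _; split=> [j L D mL mD LD|L D mL mD Ldec Dfin hsel w].
  set w := word_of j.
  pose b (i : 'I_N.+1) := p (gw g w @^-1` D i).
  have [i hi] : exists i, forall k, b k <= b i.
    pose i := [arg max_(i > ord0) b i]%O.
    by exists i => k; rewrite /i; case: arg_maxP => // l _ hl; exact: hl.
  exists i => //.
  have mwD k : measurable (gw g w @^-1` D k) by exact: measurable_gw.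
  have : (mu (gw g w @^-1` L) <= \sum_(k < N.+1) mu (gw g w @^-1` D k))%E.
    apply: le_trans (Boole_inequality mu (fun k _ => mwD k)).
    apply: le_measure; rewrite ?inE; first exact: measurable_gw.
      exact: bigsetU_measurable.
    by move=> x /LD[k /= kN Dk]; rewrite -(bigcup_mkord _ (fun k => gw g w @^-1` D k)); exists k.
  rewrite pE; last exact: measurable_gw.
  under eq_bigr do rewrite pE//.
  rewrite sumEFin lee_fin => /le_trans; apply.
  apply: (@le_trans _ _ (\sum_(k < N.+1) b i)).
    by apply: ler_sum => k _; exact: hi.
  by rewrite sumr_const card_ord mulr_natl.
set A := fun n => gw g w @^-1` L n.
have mA n : measurable (A n) by exact: measurable_gw.
pose B n := gw g w @^-1` D n.
have mB n : measurable (B n) by exact: measurable_gw.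
pose C k := \bigcup_n (if (k <= n)%N then B n else set0).
have mC k : measurable (C k).
  by apply: bigcupT_measurable => n; case: ifP.
have C0 : \bigcap_k C k = set0.
  rewrite -subset0 => x Cx; have [n hn] := Dfin (gw g w x).
  by have [m _] := Cx n I; case: ifP => // /hn.
have cvC : mu \o C @ \oo --> (0 : \bar R)%E.
  rewrite -(measure0 mu) -C0; apply: nonincreasing_cvg_mu => //.
  - exact: (le_lt_trans (probability_le1 mu (mC 0%N)) (ltry 1)).
  - by rewrite C0.
  - move=> k k' kk'; apply/subsetPset => x [n _]; case: ifP => // kn Bx.
    by exists n => //; rewrite (leq_trans kk').
have mI : measurable (gw g w @^-1` \bigcap_n L n).
  by apply: measurable_gw; exact: bigcapT_measurable.
suff : p (gw g w @^-1` \bigcap_n L n) / N.+1%:R <= 0.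
  rewrite pmulr_lle0 ?invr_gt0// => h; rewrite pE//; congr _%:E.
  by apply/eqP; rewrite eq_le h fine_ge0.
rewrite -lee_fin; apply: (cvge_to_ge cvC); apply: nearW => k /=.
have [m km sm] := hsel (pickle w) k; rewrite word_ofK in sm.
rewrite pE// lee_fin ler_pdivrMr// mulrC.
apply: (@le_trans _ _ (p (A m))).
  by apply: p_le => // x Lx; exact: Lx.
apply: le_trans sm _; rewrite ler_pM2l//; apply: p_le; [exact: mB|exact: mC|move=> x Bx].
by exists m => //; rewrite km.
Qed.

End MeasureSelector.

(** * Baire category and the selector for meager sets *)

Section BaireSelector.
Context (T : topologicalType).
Implicit Types A B : set T.

Lemma nowhere_denseS A B : A `<=` B -> nowhere_dense B -> nowhere_dense A.
Proof.
by move=> AB hB; rewrite /nowhere_dense -subset0 -hB; apply: interiorS; exact: closureS.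
Qed.

Lemma meagerS A B : A `<=` B -> meager B -> meager A.
Proof.
move=> AB [F hF BE]; exists (fun n => F n `&` A).
  by move=> n; apply: nowhere_denseS (hF n) => x [].
rewrite eqEsubset; split=> x; last by move=> [n _ []].
by move=> Ax; have := AB x Ax; rewrite BE => -[n _ Fx]; exists n.
Qed.

Lemma meager0 : meager (set0 : set T).
Proof.
exists (fun=> set0); last by rewrite bigcup0.
by move=> _; rewrite /nowhere_dense closure0 interior0.
Qed.

Lemma meager_bigcup (F : nat -> set T) : (forall n, meager (F n)) -> meager (\bigcup_n F n).
Proof.
move=> hF; have /choice[f hf] : forall n, exists f : nat -> set T,
    (forall k, nowhere_dense (f k)) /\ F n = \bigcup_k f k.
  by move=> n; have [f h1 h2] := hF n; exists f.
exists (fun m => f (unpair m).1 (unpair m).2) => [m|]; first by case: (hf (unpair m).1).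
rewrite eqEsubset; split=> x; last first.
  by move=> [m _ fx]; exists (unpair m).1 => //; case: (hf (unpair m).1) => _ ->; exists (unpair m).2.
move=> [n _]; case: (hf n) => _ -> [k _ fx]; exists (pickle (n, k)) => //.
by rewrite /unpair pickleK.
Qed.

Lemma meagerU A B : meager A -> meager B -> meager (A `|` B).
Proof.
move=> mA mB; apply: meagerS (_ : meager (\bigcup_n (if n is 0 then A else B))).
  by move=> x [h|h]; [exists 0%N|exists 1%N].
by apply: meager_bigcup => -[].
Qed.

Lemma closed_minus_interior A : closed A -> meager (A `\` interior A).
Proof.
move=> cA; exists (fun=> A `\` interior A); last by rewrite bigcup_const.
move=> _; rewrite /nowhere_dense -subset0 => x hx.
have clA : closure (A `\` interior A) `<=` A.
  by rewrite [X in _ `<=` X](closure_id A).1//; apply: closureS => y [].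
have oI := open_interior (closure (A `\` interior A)).
have xA : interior A x.
  by apply: interiorS hx.
have clN : closure (A `\` interior A) `<=` ~` interior A.
  have cN : closed (~` interior A) by apply: open_closedC; exact: open_interior.
  by rewrite [X in _ `<=` X](closure_id _).1//; apply: closureS => y [].
by apply: (clN x) xA; exact: interior_subset hx.
Qed.

Lemma borel_baire A : borel T A -> exists V, [/\ open V, meager (A `\` V) & meager (V `\` A)].
Proof.
move=> bA; pose C := [set A : set T | exists V, [/\ open V, meager (A `\` V) & meager (V `\` A)]].
suff : borel T `<=` C by move=> /(_ A bA).
apply: smallest_sub => [|V oV]; last first.
  by exists V; split=> //; rewrite setDv; exact: meager0.
split.
- by exists set0; split; rewrite ?setDv; [exact: open0|exact: meager0|exact: meager0].
- move=> B [V [oV m1 m2]]; rewrite setTD; exists (interior (~` V)); split.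
  + exact: open_interior.
  + apply: meagerS (meagerU m2 (closed_minus_interior (open_closedC oV))) => x [nB nV].
    by have [Vx|nVx] := pselect (V x); [left|right].
  + apply: meagerS m1 => x [/interior_subset nV nnB]; split=> //.
    exact: contrapT.
- move=> F hF; have /choice[V hV] := hF; exists (\bigcup_n V n); split.
  + by apply: bigcup_open => n _; case: (hV n).
  + apply: meagerS (_ : meager (\bigcup_n (F n `\` V n))).
      move=> x [[n _ Fx] nV]; exists n => //; split=> // Vx; apply: nV; by exists n.
    by apply: meager_bigcup => n; case: (hV n).
  + apply: meagerS (_ : meager (\bigcup_n (V n `\` F n))).
      move=> x [[n _ Fx] nV]; exists n => //; split=> // Vx; apply: nV; by exists n.
    by apply: meager_bigcup => n; case: (hV n).
Qed.

Variable U : nat -> set T.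
Hypothesis bU : forall O x, open O -> O x -> exists2 n, U n x & U n `<=` O.

Lemma nonmeager_localize A : borel T A -> ~ meager A ->
  exists n, meager (U n `\` A) /\ ~ meager (U n).
Proof.
move=> /borel_baire[V [oV m1 m2]] nA.
have nV : ~ meager V.
  move=> mV; apply: nA; apply: meagerS (meagerU m1 mV) => x Ax.
  by have [?|?] := pselect (V x); [right|left].
apply: contrapT => h; apply: nV.
apply: meagerS (_ : meager (\bigcup_n (if `[< U n `<=` V >] then U n else set0))).
  by move=> x /(bU oV)[n Ux UV]; exists n => //; rewrite asboolT.
apply: meager_bigcup => n; case: asboolP => UV; last exact: meager0.
apply: contrapT => nU; apply: h; exists n; split=> //.
by apply: meagerS m2 => x [Ux nAx]; split=> //; exact: UV.
Qed.

Variable g : nat -> T -> T.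
Hypothesis mg : forall i A, borel T A -> borel T (g i @^-1` A).

Lemma borel_gw w A : borel T A -> borel T (gw g w @^-1` A).
Proof.
elim: w A => [|i w IH] A mA; first by rewrite preimage_id.
exact: (IH _ (mg i mA)).
Qed.

(** The tests run over pairs of a word [w] and a base set [U n]. If the preimage of the limit is
    nonmeager, then for some [k] so is the set [C k] of its points that avoid the preimages of all
    [D m] with [m >= k], and [C k] is comeager in some nonmeager [U n]. A later test for [w] and [n]
    requires such a preimage to be nonmeager in [U n], which is impossible. *)
Lemma baire_selector N : (0 < N)%N -> (forall n, open (U n)) ->
  selector g (borel T) meager N (fun j L D =>
    let w := word_of (unpair j).1 in let V := U (unpair j).2 in
    ~ meager (V `&` gw g w @^-1` L) -> ~ meager (V `&` gw g w @^-1` D)).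
Proof.
move=> N0 oU; split=> [j L D mL mD LD /=|L D mL mD Ldec Dfin hsel w].
  set w := word_of _; set V := U _.
  have [mLV|nm] := pselect (meager (V `&` gw g w @^-1` L)); first by exists 0%N.
  apply: contrapT => h; apply: nm.
  apply: meagerS (_ : meager (\bigcup_i (if (i < N)%N then V `&` gw g w @^-1` D i else set0))).
    by move=> x [Vx /LD[i /= iN Di]]; exists i => //; rewrite iN.
  apply: meager_bigcup => i; case: ifP => iN; last exact: meager0.
  by apply: contrapT => nD; apply: h; exists i.
have bD n : borel T (gw g w @^-1` D n) by exact: borel_gw.
have bI : borel T (gw g w @^-1` \bigcap_n L n).
  by apply: borel_gw; exact: bor_bigcap.
apply: contrapT => nm.
pose C k := gw g w @^-1` (\bigcap_n L n) `&` \bigcap_m (if (k <= m)%N then ~` (gw g w @^-1` D m) else setT).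
have bC k : borel T (C k).
  apply: borI => //; apply: bor_bigcap => m; case: ifP => _; last exact: borT.
  apply: borC; exact: bD.
have [k nCk] : exists k, ~ meager (C k).
  apply: contrapT => h; apply: nm.
  apply: meagerS (_ : meager (\bigcup_k C k)).
    move=> x Lx; have [k hk] := Dfin (gw g w x); exists k => //; split=> // m _.
    by case: ifP => // /hk.
  by apply: meager_bigcup => k; apply: contrapT => nk; apply: h; exists k.
have [n [mU nU]] := nonmeager_localize (bC k) nCk.
have [m km] := hsel (pickle (pickle w, n)) k.
rewrite /unpair pickleK /= word_ofK; apply.
  move=> mL'; apply: nU; apply: meagerS (meagerU mU mL') => x Ux.
  have [[Lx _]|nCx] := pselect (C k x); last by left.
  by right; split=> //; apply: Lx.
apply: meagerS mU => x [Ux Dx]; split=> // -[_ /(_ m I)].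
by rewrite km.
Qed.

End BaireSelector.

(** * Brooks' theorem off a null set *)

Section Rooted.
Context {X : choiceType} (H : X -> X -> Prop) (B : set X).
Hypotheses (Hsym : forall x y, H x y -> H y x) (Hacyclic : acyclic H).
Hypothesis Htwo : forall x, B x -> exists y1 y2, [/\ H x y1, H x y2 & y1 <> y2].

Fixpoint walk n x y := if n is m.+1 then exists2 z, walk m x z & H z y else x = y.

Lemma nbw_rev x y u v : nbw H x y u v -> nbw H v u y x.
Proof.
elim=> [xy|{}u {}v w _ h vw wu]; first by apply: nbw0; exact: Hsym.
by apply: nbw_turn (nbw0 (Hsym vw)) _ h; exact/nesym.
Qed.

(** [dist] is the distance to a root picked by choice in each component. If two neighbors of [x]
    were no farther from the root than [x], two walks from the root without backtracking would enter
    [x] by different edges, and together they would contradict acyclicity. *)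
Lemma rooted_distance : exists dist : X -> nat,
  forall x, B x -> exists2 y, H x y & (dist x < dist y)%N.
Proof.
have [[x0 Bx0]|nB] := pselect (exists x, B x); last first.
  by exists (fun=> 0%N) => x Bx; case: nB; exists x.
pose cls x := [set y | exists n, walk n y x].
pose rep x := xget x0 (cls x).
have repP x : exists n, walk n (rep x) x.
  exact: (@xgetPex _ x0 (cls x) (ex_intro _ x (ex_intro _ 0%N erefl))).
have rep_eq x y : H x y -> rep x = rep y.
  move=> xy; congr xget; rewrite eqEsubset; split=> z [n zn]; exists n.+1.
    by exists x.
  by exists y => //; exact: Hsym.
pose dist x := first (fun n => walk n (rep x)) x.
have first_dist x := @firstP _ (fun n => walk n (rep x)) x (repP x).
have distP x : walk (dist x) (rep x) x by have [] := first_dist x.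
have dist_le n x : walk n (rep x) x -> (dist x <= n)%N.
  move=> h; rewrite leqNgt; apply/negP => nd.
  by have [_ /(_ n nd)] := first_dist x.
have dist_edge x y : H x y -> (dist y <= (dist x).+1)%N.
  by move=> xy; apply: dist_le; rewrite -(rep_eq _ _ xy); exists x.
have geo n z : dist z = n.+1 -> exists y u, nbw H (rep z) y u z /\ dist u = n.
  elim: n z => [|n IH] z dz; have := distP z; rewrite dz => -[u hu uz].
    rewrite -hu in uz; exists z, (rep z); split; first exact: nbw0.
    by apply/eqP; rewrite -leqn0; apply: dist_le; rewrite (rep_eq _ _ uz).
  have ru := rep_eq _ _ uz.
  have du : dist u = n.+1.
    apply/eqP; rewrite eqn_leq dist_le/=; last by rewrite ru.
    by rewrite -ltnS -dz dist_edge.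
  have [y [t [h dt]]] := IH u du; exists y, u; split=> //.
  rewrite -ru; apply: nbwS h uz _ => E.
  by move: dz; rewrite E dt => nn; have := ltnW (leqnn n.+2); rewrite -nn ltnn.
have toward x y : H y x -> (dist y <= dist x)%N -> exists z, nbw H (rep x) z y x.
  move=> yx; rewrite -(rep_eq _ _ yx).
  case E : (dist y) => [|n] dx.
    have := distP y; rewrite E /= => ry; exists x; rewrite {1}ry; exact: nbw0.
  have [z [u [h du]]] := geo n y E; exists z; apply: nbwS h yx _ => xu.
  by move: dx; rewrite xu du ltnn.
exists dist => x Bx; have [y1 [y2 [h1 h2 y12]]] := Htwo Bx.
have [d1|d1] := ltnP (dist x) (dist y1); first by exists y1.
have [d2|d2] := ltnP (dist x) (dist y2); first by exists y2.
exfalso; have [z1 n1] := toward x y1 (Hsym h1) d1.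
have [z2 n2] := toward x y2 (Hsym h2) d2.
exact: Hacyclic (nbw_turn n1 (nesym y12) (nbw_rev n2)) erefl.
Qed.

End Rooted.

(** * Measurability off an invariant set *)

Section Ignoring.
Context {X : choiceType} (e : rel X) (nb : X -> seq X) (d : nat)
  (U : nat -> set X) (g : nat -> X -> X) (S : set (set X)).
Hypothesis HG : local_graph e nb d U g S.
Variable N : set X.
Hypotheses (mN : S N) (N_inv : forall i x, N (g i x) <-> N x).

(** All subsets of [N] become measurable, which makes room for a flow on [N] chosen without regard
    to measurability. *)
Definition ignoring : set (set X) := fun A => S (fun x => A x /\ ~ N x).

Lemma ignoringW A : S A -> ignoring A.
Proof. by move=> mA; rewrite /ignoring; apply: (M_and HG) => //; exact: (M_not HG). Qed.

Lemma ignoring_sub A : A `<=` N -> ignoring A.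
Proof.
move=> AN; rewrite /ignoring; apply: (M_ext (P := fun _ => False)); last exact: (M_const HG).
by move=> x; split=> // -[/AN].
Qed.

Lemma ignoring_graph : local_graph e nb d U g ignoring.
Proof.
case: (HG) => h1 h2 h3 h4 h5 h6 h7 h8 h9 h10 h11 h12; split=> //.
- split.
  + by apply: ignoring_sub => x [].
  + move=> A mA; rewrite /ignoring; apply: (M_ext (P := fun x => ~ (A x /\ ~ N x) /\ ~ N x)).
      move=> x; split=> [[h nN]|[[_ nA] nN]]; split=> //; last by move=> [].
      by split=> // Ax; apply: h.
    by apply: (M_and HG); apply: (M_not HG).
  + move=> A mA; rewrite /ignoring; apply: (M_ext (P := fun x => exists n, A n x /\ ~ N x)).
      move=> x; split=> [[n [An nN]]|[[n _ An] nN]]; last by exists n.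
      by split=> //; exists n.
    exact: (M_exc HG).
- by move=> n; exact: ignoringW.
- move=> i A mA; rewrite /ignoring; apply: (M_ext (P := g i @^-1` (fun x => A x /\ ~ N x))); last exact: h9.
  by move=> x /=; rewrite /preimage/= N_inv.
- by move=> i; exact: ignoringW.
Qed.

End Ignoring.

(** * The flow on the complement of the good cycles *)

Section Assembly.
Context {X : choiceType} (e : rel X) (nb : X -> seq X) (d : nat)
  (U : nat -> set X) (g : nat -> X -> X) (S : set (set X)).
Hypothesis HG : local_graph e nb d U g S.
Hypothesis d3 : (2 < d)%N.
Hypothesis noclique : forall s : seq X, uniq s -> size s = d.+1 -> ~ clique e s.
Local Notation gw := (gw g).
Local Notation conn := (conn g).

Lemma M_degree k : S (fun x => (k <= size (nb x))%N).
Proof.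
apply: (M_ext (P := fun x => exists l : seq (seq nat), size l = k /\
   uniq (tuple_at g l x) /\ forall w, w \in l -> e x (gw w x))).
  move=> x; split=> [[l [<- [ul el]]]|kx].
    rewrite -(size_map (fun w => gw w x)); apply: uniq_leq_size => // y /mapP[w /el xw ->].
    by rewrite (lg_nb HG).
  have /choice[i hi] : forall y, exists i, e x y -> g i x = y.
    move=> y; have [xy|nxy] := pselect (e x y); last by exists 0%N.
    by have [i gi] := lg_ge HG xy; exists i.
  pose l := [seq [:: i y] | y <- take k (nb x)].
  have lE : tuple_at g l x = take k (nb x).
    rewrite /tuple_at -map_comp -[RHS]map_id; apply/eq_in_map => y /mem_take.
    by rewrite (lg_nb HG) => /hi.
  exists l; split; first by rewrite size_map size_take_min; exact/minn_idPl.
  rewrite lE; split; first by apply: take_uniq; exact: (lg_uniq HG).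
  by move=> _ /mapP[y /mem_take + ->] /=; rewrite (lg_nb HG) => xy; rewrite hi.
apply: (M_exc HG) => l; apply: (M_and HG); first exact: (M_const HG).
apply: (M_and HG); first exact: (M_uniq_tuple HG).
apply: (M_allc HG) => w; apply: (M_imp HG); first exact: (M_const HG).
exact: (M_e HG [::]).
Qed.

Let W := Wset e U g.
Let Y x := ~ W x /\ forall y, e x y -> ~ W y.
Let F x := Y x /\ ~ (size (nb x) = d /\ forall y, e x y -> Y y).
Let D x := ~ W x /\ ~ Y x.
(** The key tells which sets [U n] meet the pair of ends; it determines this unordered pair because
    [U] separates points from finite sets. *)
Let key x y n := `[< U n x \/ U n y >].

Lemma M_all_nbrs (P : X -> Prop) : S P -> S (fun x => forall y, e x y -> P y).
Proof.
move=> mP; apply: (M_all HG) => [x z h|w].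
  by apply: (conn_edge HG); apply: contrapT => nxz; apply: h.
by apply: (M_imp HG); [exact: (M_e HG [::])|exact: (M_gw HG w mP)].
Qed.

Let mW : S W. Proof. exact: (M_Wset HG). Qed.

Let mY : S Y.
Proof.
apply: (M_and HG); first exact: (M_not HG).
by apply: M_all_nbrs; exact: (M_not HG).
Qed.

Let mF : S F.
Proof.
apply: (M_and HG) => //; apply: (M_not HG); apply: (M_and HG); last exact: M_all_nbrs.
apply: (M_ext (P := fun x => (d <= size (nb x))%N)); last exact: M_degree.
by move=> x; split=> [h|->//]; apply/eqP; rewrite eqn_leq h (lg_size HG).
Qed.

Let mD : S D.
Proof. by apply: (M_and HG); exact: (M_not HG). Qed.

Let key_sym x y : key x y =1 key y x.
Proof. by move=> n; rewrite /key orC. Qed.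

Let key_inj x y u v : key x y =1 key u v -> x = u /\ y = v \/ x = v /\ y = u.
Proof.
have sep a b f h : key a b =1 key f h -> a = f \/ a = h.
  move=> E; apply: contrapT => nab.
  have [|n [Ua hn]] := lg_sep HG (x := a) (s := [:: f; h]).
    by rewrite !inE negb_or; apply/andP; split; apply/eqP => E'; apply: nab; [left|right].
  have := E n; rewrite /key asboolT; last by left.
  rewrite asboolF// => -[]; apply: hn; by rewrite !inE eqxx ?orbT.
move=> E; have E' : key y x =1 key u v by move=> n; rewrite key_sym.
have E1 : key u v =1 key x y by move=> n; rewrite E.
have E2 : key v u =1 key x y by move=> n; rewrite key_sym.
case: (sep _ _ _ _ E) (sep _ _ _ _ E') (sep _ _ _ _ E1) (sep _ _ _ _ E2);
  by move=> -> [] -> [] h1 [] h2; rewrite ?h1 ?h2; auto.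
Qed.

Lemma nogood_Y (K : seq X) : (forall v, v \in K -> Y v) -> ~ ham_good e K.
Proof.
move=> KY hK; apply: (no_good_outside HG hK) => v /KY[nW nbW]; split=> // a av.
by apply: nbW; rewrite (lg_sym HG).
Qed.

Lemma nonfree_full x : Y x -> ~ F x -> size (nb x) = d /\ forall y, e x y -> Y y.
Proof. by move=> Yx nFx; apply: contrapT => h; apply: nFx. Qed.

Let T := forest e Y key.

Lemma M_lexlt u v s t : S (fun x => lexlt (key (gw u x) (gw v x)) (key (gw s x) (gw t x))).
Proof.
have mk a b n : S (fun x => key (gw a x) (gw b x) n).
  apply: (M_ext (P := fun x => U n (gw a x) \/ U n (gw b x))).
    by move=> x; split=> [?|/asboolP//]; apply/asboolP.
  by apply: (M_or HG); apply: (M_gw HG); exact: (lg_U HG).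
apply: (M_exc HG) => n; apply: (M_and3 HG).
- apply: (M_ext (P := fun x => ~ key (gw u x) (gw v x) n)); last exact: (M_not HG).
  by move=> x; split=> /negP.
- exact: mk.
apply: (M_allc HG) => m; apply: (M_imp HG); first exact: (M_const HG).
apply: (M_ext (P := fun x => key (gw u x) (gw v x) m <-> key (gw s x) (gw t x) m)).
  by move=> x; split=> [h|->//]; apply/idP/idP => /h.
exact: (M_iff HG).
Qed.

Lemma M_below n a b u v : S (fun x => below e Y key n (gw a x) (gw b x) (gw u x) (gw v x)).
Proof.
elim: n u v => [|n IH] u v /=; first exact: (M_eq HG).
apply: (M_ex HG) => [x z [uz _ _ _ _]|w].
  by apply: conn_trans (conn_edge HG uz); exact: conn_gw.
apply: (M_ext (P := fun x => [/\ e (gw u x) (gw w x), Y (gw u x) & Y (gw w x)] /\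
  lexlt (key (gw u x) (gw w x)) (key (gw a x) (gw b x)) /\
  below e Y key n (gw a x) (gw b x) (gw w x) (gw v x))).
  by move=> x; split=> [[[? ? ?] [? ?]]|[]].
apply: (M_and HG).
  by apply: (M_and3 HG); [exact: (M_e HG)|exact: (M_gw HG u mY)|exact: (M_gw HG w mY)].
by apply: (M_and HG) => //; exact: M_lexlt.
Qed.

Lemma M_forest : local_meas g S T.
Proof.
move=> u v; apply: (M_and4 HG); [exact: (M_e HG)|exact: (M_gw HG u mY)|exact: (M_gw HG v mY)|].
by apply: (M_allc HG) => n; apply: (M_not HG); exact: M_below.
Qed.

Lemma pruned_forest : pruned F T.
Proof.
have sym := lg_sym HG; have irr := lg_irr HG; have nbE := lg_nb HG; have nbU := lg_uniq HG.
split.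
- exact: forest_sym.
- by move=> x []; rewrite irr.
- exact: (forest_acyclic sym irr key_sym key_inj).
- move=> x y nFx; exact: (forest_inv sym irr nbE nbU d3 noclique nogood_Y nonfree_full nFx).
- exact: (forest_reach sym irr nbE nbU d3 noclique nogood_Y nonfree_full key_sym).
Qed.

(** A vertex outside [W] is next to [W], or free, or in [B], or freed at some stage. In each case it
    has degree less than [d], or a neighbor in [W], or a neighbor into which it flows, as
    [flow_coloring] requires. *)
Lemma local_brooks null sel :
  selector g S null ((d.+1 ^ 3).+1 * (d * d).+1)%N sel ->
  exists B : set X, [/\ S B, (forall w, null (gw w @^-1` B)) & exists c : X -> nat,
    [/\ (forall x, (c x < d)%N), (forall x y, e x y -> c x <> c y) &
        forall q, S (fun x => c x = q /\ forall w, ~ B (gw w x))]].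
Proof.
move=> hsel.
have Te x y : T x y -> e x y by case.
have [H [M [H0 HS hH hM hnull]]] := prune_sequence HG mF pruned_forest M_forest Te hsel.
have He n x y : H n x y -> e x y by case: (hH n) => _ _; exact.
have mH n : local_meas g S (H n) by case: (hH n).
have pH n : pruned F (H n) by case: (hH n).
have Hle m n x y : (m <= n)%N -> H n x y -> H m x y.
  by move=> /subnK <-; elim: (n - m)%N => // k IH; rewrite addSn HS => -[/IH].
have HY n x y : H n x y -> Y x by move=> /(Hle 0%N _ _ _ (leq0n n)); rewrite H0 => -[].
pose B := \bigcap_n live F (H n).
have mB : S B.
  apply: (M_ext (P := fun x => forall n, live F (H n) x)).
    by move=> x; split=> [h n _|h n]; exact: h.
  by apply: (M_allc HG) => n; apply: (M_live HG mF (He n) (mH n)).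
(* The saturation of [B] under the edges; the choice of roots matters only there. *)
pose N0 : set X := fun x => exists w, B (gw w x).
have mN0 : S N0 by apply: (M_exc HG) => w; exact: (M_gw HG w mB).
have N0_conn x y : conn x y -> N0 y -> N0 x.
  by move=> [u <-] [w Bw]; exists (w ++ u); rewrite -gw_cat.
have N0_inv i x : N0 (g i x) <-> N0 x.
  have xi : conn x (g i x) by exists [:: i].
  by split; apply: N0_conn => //; exact: (conn_sym HG).
have BN0 x : B x -> N0 x by exists [::].
pose Hinf x y := forall n, H n x y.
have [dist hdist] : exists dist : X -> nat, forall x, B x -> exists2 y, Hinf x y & (dist x < dist y)%N.
  apply: (@rooted_distance _ Hinf B) => [x y h n|x y u v h|x Bx].
  - exact: (pr_sym (pH n)).
  - exact: (pr_acyclic (pH 0%N) (nbw_sub (fun a b (k : Hinf a b) => k 0%N) h)).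
  (* After some stage the finitely many edges at [x] no longer change, so two edges of that stage
     persist in the limit. *)
  suff [n hn] : exists n, forall y, y \in nb x -> H n x y -> Hinf x y.
    have [nFx [y1 xy1]] := Bx n I; have [y2 y21 xy2] := pr_deg (pH n) nFx xy1.
    by exists y1, y2; split; [apply: hn => //; rewrite (lg_nb HG); exact: He xy1
      |apply: hn => //; rewrite (lg_nb HG); exact: He xy2|exact/nesym].
  elim: (nb x) => [|y s [n hn]]; first by exists 0%N.
  have [xy|nxy] := pselect (Hinf x y).
    by exists n => z; rewrite inE => /orP[/eqP -> //|]; exact: hn.
  have [m hm] : exists m, ~ H m x y by apply: contrapT => h; apply: nxy => m; apply: contrapT => k; apply: h; exists m.
  exists (maxn n m) => z; rewrite inE => /orP[/eqP ->|zs].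
    by move=> /(Hle _ _ _ _ (leq_maxr n m)).
  by move=> /(Hle _ _ _ _ (leq_maxl n m)); exact: hn.
(* Free vertices flow to neighbors outside [Y], freed vertices along the segment deleted at their
   stage, and the vertices of [B] away from their roots. *)
pose fl x y := [\/ [/\ F x, D y & e x y],
  exists n, freed F (H n) (M n) x /\ flow F (H n) (M n) x y |
  [/\ B x, Hinf x y & (dist x < dist y)%N]].
have HG' := ignoring_graph HG mN0 N0_inv.
have fle x y : fl x y -> e x y.
  by move=> [[]|[n [_ [/He]]]|[_ /(_ 0%N)/He]].
have mfl : local_meas g (ignoring S N0) fl.
  move=> u v; pose P2 x := exists n, freed F (H n) (M n) (gw u x) /\ flow F (H n) (M n) (gw u x) (gw v x).
  pose P3 x := [/\ B (gw u x), Hinf (gw u x) (gw v x) & (dist (gw u x) < dist (gw v x))%N].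
  apply: (M_ext (P := fun x => [/\ F (gw u x), D (gw v x) & e (gw u x) (gw v x)] \/ (P2 x \/ P3 x))).
    by move=> x; split=> [[h|[h|h]]|[h|h|h]]; [exact: Or31|exact: Or32|exact: Or33|left|right; left|right; right].
  apply: (M_or HG'); last apply: (M_or HG').
  - apply: ignoringW; first exact: HG.
      exact: mN0.
    by apply: (M_and3 HG); [exact: (M_gw HG u mF)|exact: (M_gw HG v mD)|exact: (M_e HG)].
  - apply: ignoringW; first exact: HG.
      exact: mN0.
    apply: (M_exc HG) => n; apply: (M_and HG); last first.
      by apply: (M_flow HG mF (He n) (mH n)); case: (hM n).
    apply: (M_gw HG u (P := freed F (H n) (M n))).
    apply: (M_and3 HG); first exact: (M_not HG).
      by apply: (M_ex HG) => [x z /(conn_H HG (He n))//|w]; exact: (mH n [::] w).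
    apply: (M_ext (P := fun x => forall y, ~ H n.+1 x y)); first by rewrite HS.
    apply: (M_all HG) => [x z h|w].
      by apply: (conn_H HG (He n.+1)); apply: contrapT => k; apply: h.
    by apply: (M_not HG); exact: (mH n.+1 [::] w).
  apply: ignoring_sub; first exact: HG.
  by move=> x [Bx _ _]; exists u.
(* A vertex freed at stage [n] has no edges afterwards, so whatever flows into it was freed at stage
   [n] or earlier; within a stage [flow_acc] applies. *)
have freed_acc n x : freed F (H n) (M n) x -> Acc (fun y x => fl y x) x.
  elim/ltn_ind: n x => n IH x fx.
  have [mm m1 m2 m3] := hM n.
  have ax := flow_acc (pH n) m1 m2 m3 fx; elim: ax fx => {}x _ IH' fx.
  have Yx : Y x by case: fx => _ [y /HY].
  have dead k y : (n < k)%N -> H k x y -> False.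
    by move=> nk /(Hle _ _ _ _ nk); rewrite HS; case: fx => _ _; exact.
  constructor=> y [[_ [_ nY] _]|[m [fy yx]]|[_ /(_ n.+1)/(pr_sym (pH n.+1))/dead]]; [by []| |by case].
  have [mn|nm|E] := ltngtP m n; first exact: (IH m).
    by case: yx => /(pr_sym (pH m))/dead; case.
  by subst m; exact: IH'.
have acc x : B x -> Acc (fun y x => fl y x) x.
  have [k kx] := ubnP (dist x); elim: k x kx => [x|k IH x kx Bx]; first by rewrite ltn0.
  have Yx : Y x by case: (Bx 0%N I) => _ [y /HY].
  constructor=> y [[_ [_ nY] _]|[m [fy yx]]|[By _ yx]]; [by []|exact: freed_acc fy|].
  by apply: IH By; rewrite ltnS in kx; exact: leq_trans yx kx.
have accF x : F x -> Acc (fun y x => fl y x) x.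
  move=> [Yx _]; constructor=> y [[_ [_ nY] _]|[m [fy yx]]|[By _ yx]];
    [by []|exact: freed_acc fy|exact: acc].
have wf : well_founded fl.
  by move=> x; constructor=> y [[Fy _ _]|[m [fy yx]]|[By _ yx]]; [exact: accF|exact: freed_acc fy|exact: acc].
have [c mc [cd cne]] : exists2 c : X -> nat, meas_nat (ignoring S N0) c &
    (forall x, ~ W x -> (c x < d)%N) /\ forall x y, ~ W x -> ~ W y -> e x y -> c x <> c y.
  apply: (flow_coloring HG' _ mfl fle wf); first by apply: (M_not HG'); exact: (ignoringW HG mN0 mW).
  move=> x nW; have [Yx|nY] := pselect (Y x); last first.
    right; have [y [xy Wy]] : exists y, e x y /\ W y.
      by apply: contrapT => h; apply: nY; split=> // y xy Wy; apply: h; exists y.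
    by exists y => //; left; apply.
  have [Fx|nFx] := pselect (F x).
    have [sd|sd] := ltnP (size (nb x)) d; [by left|right].
    have [y [xy nYy]] : exists y, e x y /\ ~ Y y.
      apply: contrapT => h; case: Fx => _; apply; split.
        by apply/eqP; rewrite eqn_leq sd (lg_size HG).
      by move=> y xy; apply: contrapT => nYy; apply: h; exists y.
    by exists y => //; right; apply: Or31; split=> //; split=> //; case: Yx => _; exact.
  have [Bx|nBx] := pselect (B x).
    by right; have [y xy dxy] := hdist x Bx; exists y; [exact: He (xy 0%N)|right; exact: Or33].
  (* A nonfree vertex of [Y] starts with a forest edge; outside [B] it is freed at the stage that
     deletes its last edge. *)
  have [n fx] : exists n, freed F (H n) (M n) x.
    apply: contrapT => nfr; apply: nBx => n _; split=> //.
    elim: n => [|n [y xy]].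
      have [y _ xy] := forest_two key (lg_sym HG) (lg_irr HG) (lg_nb HG) (lg_uniq HG) d3 noclique nogood_Y nonfree_full Yx nFx x.
      by exists y; rewrite H0.
    apply: contrapT => h; apply: nfr; exists n; split=> //; first by exists y.
    by move=> z xz; apply: h; exists z; rewrite HS.
  have [mm m1 m2 m3] := hM n; have [y xy] := freed_flow (pH n) m2 m3 fx.
  by right; exists y; [exact: He xy.1|right; apply: Or32; exists n].
have [cd' cne'] := recolored_coloring (lg_sym HG) HG' (ltnW (ltnW d3)) cd cne.
exists B; split=> //; exists (recolored e d U g c); split=> // q.
have := meas_recolored HG' mc q; rewrite /ignoring; apply: M_ext => x; split=> -[h1 h2]; split=> //.
  by move=> w Bw; apply: h2; exists w.
by move=> [w]; exact: h2.
Qed.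

End Assembly.

(** * From local colorings to measure and category *)

Section Conclusion.
Context (R : realType) (disp : measure_display) (X : measurableType disp)
  (d : nat) (G : set (X * X)).
Hypotheses (hX : standard_borel R X) (d3 : (2 < d)%N) (hG : borel_graph G).
Hypotheses (hdeg : max_degree_le G d) (hclique : ~ has_clique G d.+1).

Lemma adj_noclique (s : seq X) : uniq s -> size s = d.+1 -> ~ clique (adj G) s.
Proof.
move=> us ss cs; apply: hclique.
have x0 : X by case: s ss {us cs}.
have lt (i : 'I_d.+1) : (i < size s)%N by rewrite ss.
exists (fun i => nth x0 s i) => [i j /eqP|i j ij].
  by rewrite nth_uniq// => /eqP/val_inj.
by apply/asboolP; apply: cs; rewrite ?mem_nth// nth_uniq.
Qed.

(** Measure and category are treated at once: a color class is a measurable set together with a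
    subset of the union of countably many null preimages of [B]. *)
Lemma brooks_modulo_null (null : set X -> Prop) (E : set (set X)) :
  @measurable _ X `<=` <<s E >> ->
  (forall g, (forall i A, measurable A -> measurable (g i @^-1` A)) ->
    exists sel, selector g (@measurable _ X) null ((d.+1 ^ 3).+1 * (d * d).+1)%N sel) ->
  (forall B : nat -> set X, (forall n, measurable (B n)) -> (forall n, null (B n)) ->
    forall A, A `<=` \bigcup_n B n -> <<s E >> A) ->
  exists c : X -> 'I_d, coloring G c /\ measurable_coloring <<s E >> c.
Proof.
move=> mE hsel hnull.
have [nb [U [g HG]]] := borel_local_graph hX hG hdeg.
have [sel hs] := hsel g (lg_g HG).
have [B [mB nB [c [cd cG mc]]]] := local_brooks HG d3 adj_noclique hs.
exists (fun x => Ordinal (cd x)); split=> [x y xy /(congr1 val)/=|V].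
  by apply: cG; apply/asboolP.
have -> : (fun x => Ordinal (cd x)) @^-1` V =
    (\bigcup_q [set x | (exists2 i : 'I_d, V i & i = q :> nat) /\
       c x = q /\ forall w, ~ B (gw g w x)]) `|`
    [set x | V (Ordinal (cd x)) /\ exists w, B (gw g w x)].
  rewrite eqEsubset; split=> x /=.
    move=> Vx; have [?|nB'] := pselect (exists w, B (gw g w x)); [by right|left].
    exists (c x) => //=; split; first by exists (Ordinal (cd x)).
    by split=> // w Bw; apply: nB'; exists w.
  move=> [[q _ [[i Vi iq] [cq _]]]|[]//].
  by rewrite (_ : Ordinal _ = i)//; apply: val_inj; rewrite /= cq.
apply: borU.
  apply: mE; apply: bigcupT_measurable => q.
  have [h|h] := pselect (exists2 i : 'I_d, V i & i = q :> nat).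
    by apply: (M_ext _ (mc q)) => x; split=> [?|[]].
  by rewrite (_ : mkset _ = set0)//; rewrite -subset0 => x [].
apply: (hnull (fun n => gw g (word_of n) @^-1` B)) => [n|n|x [_ [w Bw]]] //.
  exact: (M_gw HG (word_of n) mB).
by exists (pickle w) => //; rewrite /= word_ofK.
Qed.

End Conclusion.

Theorem theorem1p2 (R : realType) (disp : measure_display)
    (X : measurableType disp) (d : nat) (G : set (X * X))
    (hX : standard_borel R X) (hd : (3 <= d)%N) (hG : borel_graph G)
    (hdeg : max_degree_le G d) (hclique : ~ has_clique G d.+1) :
  (forall mu : probability X R,
     exists c : X -> 'I_d,
       coloring G c /\ measurable_coloring <<s completed_algebra_gen mu >> c) /\
  (forall tau : Topological X, compatible_polish R tau ->
     exists c : X -> 'I_d,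
       coloring G c /\
       measurable_coloring (baire_property (Topological.Pack tau)) c).
Proof.
split=> [mu|tau [ptau btau]].
- apply: (brooks_modulo_null hX hd hG hdeg hclique (null := fun A => mu A = 0%E)).
  + move=> A mA; apply: sub_sigma_algebra; exists A => //; exists set0.
      exact: negligible_set0.
    by rewrite setU0.
  + move=> g mg; eexists; exact: measure_selector.
  move=> B mB nB A AB; apply: sub_sigma_algebra.
  exists set0; first exact: measurable0.
  exists A; last by rewrite set0U.
  have nU : mu.-negligible (\bigcup_n B n).
    by apply: negligible_bigcup => n; exists (B n); split; [exact: mB|exact: nB|exact: subset_refl].
  exact: negligibleS AB nU.
- have [[x]|nX] := pselect (inhabited X); last first.
    have noX (x : X) : False by apply: nX; exists.
    exists (fun x => False_rect _ (noX x)); split=> [x|V]; first by case: (noX x).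
    rewrite (_ : _ @^-1` V = set0).
      exact: bor0.
    by rewrite -subset0 => x; case: (noX x).
  have [U [oU bU _ _ _]] := polish_structure ptau (inhabits (x : Topological.Pack tau)).
  apply: (brooks_modulo_null hX hd hG hdeg hclique (null := @meager (Topological.Pack tau))).
  + by move=> A mA; apply: sub_sigma_algebra; left; rewrite btau.
  + move=> g mg; rewrite -btau; eexists; apply: (baire_selector bU) oU => // i A.
    by rewrite btau; exact: mg.
  move=> B _ nB A AB; apply: sub_sigma_algebra; right.
  exact: (@meagerS (Topological.Pack tau) _ _ AB (meager_bigcup nB)).
Qed.
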